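(* Let $\mathcal F$ be an Ore FS category with FS groups $G\subset G^T\subset G^V$ and normal subgroups $K_o,K_\omega,K\lhd G$ (as defined in the context). The following are equivalent: (1) the homogeneous action $G\curvearrowright G^T/G$ (by left multiplication) is faithful; (2) at least one of the derived subgroups $[K,K]$, $[G^T,G^T]$, $[G^V,G^V]$ is simple; (2') each of the derived subgroups $[K,K]$, $[G^T,G^T]$, $[G^V,G^V]$ is simple. Moreover, the following are equivalent: (3) the homogeneous action $G\curvearrowright G^T/G$ is faithful and the two germ groups $G/K_o$ and $G/K_\omega$ are abelian; (4) the derived subgroup $[G,G]$ is simple.
   Context: FS categories. A tree is a finite rooted planar binary tree in which each vertex has zero children (a leaf) or two children (an interior vertex); leaves are ordered from left to right and labelled $1,2,\dots$. $I$ is the one-vertex tree, $Y$ the tree with two leaves (caret). For a non-empty set $S$ of colours, a coloured tree is a tree with a map from its interior vertices to $S$. A (coloured) forest is a finite list $f=(f_1,\dots,f_n)$ of coloured trees; it has $n$ roots, and its leaves are those of $f_1,\dots,f_n$ in order. If $f$ has as many leaves as $g$ has roots, $f\circ g$ (or $fg$) is obtained by gluing the $i$th tree of $g$ to the $i$th leaf of $f$; $f\otimes g$ is concatenation of lists. This gives a monoidal category $\mathrm{FS}\langle S\rangle$ with object set $\{1,2,3,\dots\}$ (a forest with $r$ roots and $l$ leaves is a morphism $l\to r$). A skein relation is a pair $(u,v)$ of coloured trees with the same number of leaves. For a set $R$ of skein relations, $\mathrm{FS}\langle S|R\rangle$ is the quotient of $\mathrm{FS}\langle S\rangle$ by the smallest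 equivalence relation containing $R$ and closed under $\circ$ and $\otimes$. An FS category is a category of this form (up to isomorphism); its morphisms are still called forests, and trees if they have one root. $\mathcal F$ is Ore if it is left-cancellative ($fg=fh\Rightarrow g=h$) and has common right-multiples (if $f,g$ have the same number of roots there are $h,k$ with $fh=gk$). FS groups. Let $\mathcal F$ be an Ore FS category. $\mathcal F^V$ is the category of pairs $(f,\pi)=f\pi$ with $f\in\mathcal F$ having $l$ leaves and $\pi$ in the symmetric group $\Sigma_l$, with $(f,\sigma)\circ(g,\tau)=(f\circ g^\sigma,\sigma^g\circ\tau)$, where $g^\sigma$ is the forest whose $\sigma(j)$th tree is the $j$th tree of $g$, and $\sigma^g$ maps the block of leaves of the $j$th tree of $g$ order-preservingly onto the block of leaves of the $\sigma(j)$th tree of $g^\sigma$. $\mathcal F^T$ is the subcategory where $\pi$ is a cyclic permutation (a power of $(1\,2\cdots l)$), and $\mathcal F\subset\mathcal F^T$. The FS group $G^V$ is the set of classes $[x,y]$ of pairs of one-rooted elements $x,y\in\mathcal F^V$ with the same number of leaves, modulo $(x,y)\sim(xp,yp)$, with product determined by $[x,y][y,z]=[x,z]$; every element has the form $[t\pi,s]$ with $t,s$ trees and $\pi$ a permutation. $G^T$ and $G$ are defined in the same way from $\mathcal F^T$ and $\mathcal F$; so $G\subset G^T\subset G^V$. The space $\mathfrak C$ and the groups $K_o,K_\omega,K$. Let $\mathcal T$ be the set of trees of $\mathcal F$, partially ordered by $t\leqslant tf$. $\mathfrak C=\varprojlim_{t\in\mathcal T}\mathrm{Leaf}(t)$ is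 the profinite space of families $x=(x(t))_{t\in\mathcal T}$ of leaves $x(t)$ of $t$ such that $x(tf)$ is a leaf of the tree of $f$ attached at $x(t)$. $G^V$ acts on $\mathfrak C$ by homeomorphisms through $(g\cdot x)(t)=\pi(x(s))$ for $g=[t\pi,s]$. $\mathfrak C$ is totally ordered by $x\leqslant y$ iff $x(t)\leqslant y(t)$ for all large enough $t$; let $o=\min\mathfrak C$ and $\omega=\max\mathfrak C$, which are fixed by $G$. $K_o$ (resp. $K_\omega$) is the normal subgroup of all $g\in G$ acting trivially on a neighbourhood of $o$ (resp. $\omega$), and $K=K_o\cap K_\omega$. The germ groups are $G/K_o$ and $G/K_\omega$. $[\Gamma,\Gamma]$ denotes the derived (commutator) subgroup of $\Gamma$. *)

(* Defs.v *)
From HB Require Import structures.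
From mathcomp Require Import all_boot fingroup perm generic_quotient.
From mathcomp Require Import all_classical topology.
From Stdlib Require Import Relation_Operators.

Set Implicit Arguments.
Unset Strict Implicit.
Unset Printing Implicit Defensive.

Local Open Scope classical_set_scope.
Local Open Scope quotient_scope.

Section Trees.
Variable S : Type.

(* [Leaf] is the one-vertex tree I; interior vertices carry a colour. *)
Inductive ctree := Leaf | Node of S & ctree & ctree.

HB.instance Definition _ := gen_eqMixin ctree.
HB.instance Definition _ := gen_choiceMixin ctree.

Fixpoint leaves (t : ctree) : nat :=
  if t is Node _ a b then leaves a + leaves b else 1.

Definition tshape (f : seq ctree) : seq nat := map leaves f.

Definition rleaves (f : seq ctree) : nat := sumn (tshape f).

(* Glues the i-th tree of gs to the i-th leaf of t; meaningful only when gs has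
   as many trees as t has leaves. *)
Fixpoint graft (t : ctree) (gs : seq ctree) : ctree :=
  match t with
  | Leaf => head Leaf gs
  | Node c a b => Node c (graft a (take (leaves a) gs))
                         (graft b (drop (leaves a) gs))
  end.

(* f o g, meaningful only when rleaves f = size g. *)
Fixpoint rcomp (f g : seq ctree) : seq ctree :=
  if f is t :: f' then
    graft t (take (leaves t) g) :: rcomp f' (drop (leaves t) g)
  else [::].

Lemma leaves_gt0 t : 0 < leaves t.
Proof. by elim: t => //= _ a la b lb; rewrite addn_gt0 la. Qed.

Lemma rleaves_cat f g : rleaves (f ++ g) = rleaves f + rleaves g.
Proof. by rewrite /rleaves /tshape map_cat sumn_cat. Qed.

Lemma rleaves_cons t f : rleaves (t :: f) = leaves t + rleaves f.
Proof. by []. Qed.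

Lemma leaves_graft t gs : size gs = leaves t -> leaves (graft t gs) = rleaves gs.
Proof.
elim: t gs => [|c a IHa b IHb] gs /=.
  by case: gs => [|g []] //= _; rewrite /rleaves /= addn0.
move=> szg; rewrite IHa ?IHb.
- by rewrite -rleaves_cat cat_take_drop.
- by rewrite size_drop szg addKn.
- by rewrite size_takel // szg leq_addr.
Qed.

Lemma size_rcomp f g : size (rcomp f g) = size f.
Proof. by elim: f g => //= t f IHf g; rewrite IHf. Qed.

Lemma tshape_rcomp f g : rleaves f = size g ->
  tshape (rcomp f g) = map sumn (reshape (tshape f) (tshape g)).
Proof.
elim: f g => [|t f IHf] g //=; rewrite rleaves_cons => szg.
rewrite leaves_graft; last by rewrite size_takel // -szg leq_addr.
rewrite IHf; last by rewrite size_drop -szg addKn.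
by rewrite /rleaves /tshape map_take map_drop.
Qed.

Lemma rleaves_rcomp f g : rleaves f = size g -> rleaves (rcomp f g) = rleaves g.
Proof.
move=> szg; rewrite /rleaves tshape_rcomp // -sumn_flatten reshapeKr //.
by rewrite size_map -szg.
Qed.

Lemma rcomp_cat f1 f2 g : rcomp (f1 ++ f2) g =
  rcomp f1 (take (rleaves f1) g) ++ rcomp f2 (drop (rleaves f1) g).
Proof.
elim: f1 g => [|t f IHf] g /=; first by rewrite /rleaves /= drop0.
rewrite {}IHf rleaves_cons.
by rewrite take_takel ?leq_addr // take_drop addnC drop_drop [leaves t + _]addnC.
Qed.

Lemma rcomp_take f g : rcomp f (take (rleaves f) g) = rcomp f g.
Proof. by have := rcomp_cat f [::] g; rewrite !cats0. Qed.

Lemma take_rcomp n f g : take n (rcomp f g) = rcomp (take n f) g.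
Proof. by elim: n f g => [|n IHn] [|t f] g //=; rewrite IHn. Qed.

Lemma drop_rcomp n f g :
  drop n (rcomp f g) = rcomp (drop n f) (drop (rleaves (take n f)) g).
Proof.
elim: n f g => [|n IHn] [|t f] g //=; first by rewrite /rleaves /= drop0.
by rewrite IHn /rleaves /= drop_drop addnC.
Qed.

Lemma graftA t g h : leaves t = size g -> rleaves g = size h ->
  graft (graft t g) h = graft t (rcomp g h).
Proof.
elim: t g h => [|c a IHa b IHb] g h /=.
  case: g => [|u []] //= _; rewrite /rleaves /= addn0 => ->.
  by rewrite take_size.
move=> szg szh.
have szga : leaves a = size (take (leaves a) g).
  by rewrite size_takel // -szg leq_addr.
have szgb : leaves b = size (drop (leaves a) g).
  by rewrite size_drop -szg addKn.
have le_h : rleaves (take (leaves a) g) <= size h.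
  by rewrite -szh -{2}(cat_take_drop (leaves a) g) rleaves_cat leq_addr.
rewrite leaves_graft // IHa ?IHb //.
- rewrite drop_rcomp take_rcomp; congr (Node _ (graft _ _) _).
  by rewrite rcomp_take.
- rewrite size_drop -szh -{2}(cat_take_drop (leaves a) g) rleaves_cat.
  by rewrite addKn.
- by rewrite size_takel.
Qed.

Lemma rcompA f g h : rleaves f = size g -> rleaves g = size h ->
  rcomp (rcomp f g) h = rcomp f (rcomp g h).
Proof.
elim: f g h => [|t f IHf] g h //=; rewrite rleaves_cons => szg szh.
have sztg : leaves t = size (take (leaves t) g).
  by rewrite size_takel // -szg leq_addr.
have szfg : rleaves f = size (drop (leaves t) g).
  by rewrite size_drop -szg addKn.
have szh' := szh; rewrite -(cat_take_drop (leaves t) g) rleaves_cat in szh'.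
rewrite leaves_graft // graftA // ?IHf //.
- rewrite drop_rcomp take_rcomp; congr (graft _ _ :: _).
  by rewrite rcomp_take.
- by rewrite size_drop -szh' addKn.
- by rewrite size_takel // -szh' leq_addr.
Qed.

Lemma graft_id t : graft t (nseq (leaves t) Leaf) = t.
Proof.
elim: t => //= c a IHa b IHb; congr Node.
  by rewrite nseqD take_size_cat ?size_nseq.
by rewrite nseqD drop_size_cat ?size_nseq.
Qed.

Lemma rcompf1 f : rcomp f (nseq (rleaves f) Leaf) = f.
Proof.
elim: f => //= t f IHf; rewrite rleaves_cons nseqD.
by rewrite take_size_cat ?drop_size_cat ?size_nseq // IHf graft_id.
Qed.

Lemma rcomp1f g : rcomp (nseq (size g) Leaf) g = g.
Proof. by elim: g => //= t g IHg; rewrite drop0 IHg. Qed.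

Lemma nth_rcomp f g i : i < size f -> nth Leaf (rcomp f g) i =
  graft (nth Leaf f i)
    (take (leaves (nth Leaf f i)) (drop (rleaves (take i f)) g)).
Proof.
elim: f g i => [|t f IHf] g [|i] //= lt_i; first by rewrite drop0.
by rewrite IHf // /rleaves /= drop_drop addnC.
Qed.

Lemma rleaves_nseq n : rleaves (nseq n Leaf) = n.
Proof. by rewrite /rleaves /tshape map_nseq sumn_nseq mul1n. Qed.

End Trees.
Arguments Leaf {S}.

Section PermSeq.
Variables (T : Type) (x0 : T) (l : nat).
Implicit Types (s : seq T) (a b : 'S_l).

(* The list whose (a j)-th entry is the j-th entry of s. *)
Definition perm_seq a s : seq T := [seq nth x0 s ((a^-1)%g i) | i : 'I_l].

Lemma size_perm_seq a s : size (perm_seq a s) = l.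
Proof. by rewrite size_image card_ord. Qed.

Lemma nth_perm_seq y0 a s (i : 'I_l) : size s = l ->
  nth y0 (perm_seq a s) i = nth y0 s ((a^-1)%g i).
Proof.
move=> szs; rewrite /perm_seq /image_mem (nth_map i) ?size_enum_ord //.
by rewrite nth_ord_enum; apply: set_nth_default; rewrite szs.
Qed.

Lemma nth_perm_seqV y0 a s (i : 'I_l) : size s = l ->
  nth y0 (perm_seq a s) (a i) = nth y0 s i.
Proof. by move=> szs; rewrite nth_perm_seq // permK. Qed.

Lemma eq_from_nth_ord s1 s2 : size s1 = l -> size s2 = l ->
  (forall i : 'I_l, nth x0 s1 i = nth x0 s2 i) -> s1 = s2.
Proof.
move=> sz1 sz2 eq12; apply: (@eq_from_nth _ x0); first by rewrite sz2.
by move=> i; rewrite sz1 => lt_i; exact: (eq12 (Ordinal lt_i)).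
Qed.

Lemma perm_seq1 s : size s = l -> perm_seq 1 s = s.
Proof.
move=> szs; apply: eq_from_nth_ord => // [|i]; first exact: size_perm_seq.
by rewrite nth_perm_seq // invg1 perm1.
Qed.

Lemma perm_seqM a b s : size s = l ->
  perm_seq (a * b)%g s = perm_seq b (perm_seq a s).
Proof.
move=> szs; apply: eq_from_nth_ord => [||i]; try exact: size_perm_seq.
by rewrite !nth_perm_seq ?size_perm_seq // invMg permM.
Qed.

End PermSeq.

Lemma map_perm_seq (T U : Type) x0 y0 (f : T -> U) l (a : 'S_l) s :
  size s = l -> map f (perm_seq x0 a s) = perm_seq y0 a (map f s).
Proof.
move=> szs; apply: (@eq_from_nth_ord _ y0 l).
- by rewrite size_map size_perm_seq.
- by rewrite size_perm_seq.
- move=> i; rewrite nth_perm_seq ?size_map // !(nth_map x0) ?size_perm_seq //.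
    by rewrite nth_perm_seq.
  by rewrite szs.
Qed.

Lemma sumn_perm_seq l (a : 'S_l) s : size s = l ->
  sumn (perm_seq 0 a s) = sumn s.
Proof.
move=> szs; rewrite !sumnE big_map big_enum /=.
rewrite (big_nth 0) szs big_mkord [RHS](reindex_inj (@perm_inj _ a^-1%g)) /=.
by [].
Qed.

(* Leaf counts of the l trees of a forest with m leaves. *)
Record shp (l m : nat) := Shp {
  shp_seq :> seq nat;
  size_shp : size shp_seq = l;
  sumn_shp : sumn shp_seq = m
}.

Lemma shp_inj l m (s t : shp l m) : s = t :> seq nat -> s = t.
Proof.
case: s t => [s sz_s sum_s] [t sz_t sum_t] /= eq_st.
by case: t / eq_st sz_t sum_t => sz_t sum_t; congr Shp; apply: eq_irrelevance.
Qed.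

Section Blocks.
Variables (l m : nat).
Implicit Types (s : shp l m) (a b : 'S_l) (i : 'I_m) (j : 'I_l).

Fact block_root_subproof s i : reshape_index s i < l.
Proof. by rewrite -{2}(size_shp s) reshape_indexP // sumn_shp. Qed.

(* Index of the tree containing the i-th leaf. *)
Definition block_root s i : 'I_l := Ordinal (block_root_subproof s i).

Fact perm_shp_size a s : size (perm_seq 0 a s) = l.
Proof. exact: size_perm_seq. Qed.
Fact perm_shp_sumn a s : sumn (perm_seq 0 a s) = m.
Proof. by rewrite sumn_perm_seq ?size_shp ?sumn_shp. Qed.
Definition perm_shp a s := Shp (perm_shp_size a s) (perm_shp_sumn a s).

Lemma nth_perm_shp a s j : nth 0 (perm_shp a s) (a j) = nth 0 s j.
Proof. by rewrite nth_perm_seqV // size_shp. Qed.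

Lemma lt_offset s i : reshape_offset s i < nth 0 s (block_root s i).
Proof. by apply: reshape_offsetP; rewrite sumn_shp. Qed.

Fact block_map_subproof a s i :
  flatten_index (perm_shp a s) (a (block_root s i)) (reshape_offset s i) < m.
Proof.
rewrite -[X in _ < X](sumn_shp (perm_shp a s)) flatten_indexP //.
by rewrite nth_perm_shp lt_offset.
Qed.

(* Sends the c-th leaf of the j-th tree to the c-th leaf of the (a j)-th tree of
   the permuted forest; see block_mapE. *)
Definition block_map a s i : 'I_m := Ordinal (block_map_subproof a s i).

Lemma blockP s i : exists j c, c < nth 0 s j /\ i = flatten_index s j c :> nat.
Proof.
exists (block_root s i), (reshape_offset s i).
by rewrite lt_offset reshape_indexK.
Qed.

Lemma lt_block s j c : c < nth 0 s j -> flatten_index s j c < m.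
Proof. by move=> ltc; rewrite -[X in _ < X](sumn_shp s) flatten_indexP. Qed.

Lemma block_rootE s i j c : c < nth 0 s j -> i = flatten_index s j c :> nat ->
  block_root s i = j.
Proof. by move=> ltc Ei; apply: val_inj; rewrite /= Ei flatten_indexKl. Qed.

Lemma block_mapE a s i j c : c < nth 0 s j -> i = flatten_index s j c :> nat ->
  block_map a s i = flatten_index (perm_shp a s) (a j) c :> nat.
Proof.
move=> ltc Ei; rewrite [LHS]/= (block_rootE ltc Ei).
by congr flatten_index; rewrite Ei flatten_indexKr.
Qed.

Lemma block_map_inj a s : injective (block_map a s).
Proof.
move=> i i'; have [j [c [ltc Ei]]] := blockP s i.
have [j' [c' [ltc' Ei']]] := blockP s i' => /(congr1 val) /=.
rewrite -/(nat_of_ord (block_map a s i)) -/(nat_of_ord (block_map a s i')).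
move: (block_mapE a ltc Ei) (block_mapE a ltc' Ei') => /= -> -> Eii'.
have := flatten_indexKl (sh := perm_shp a s) (r := a j) (c := c).
rewrite nth_perm_shp Eii' => /(_ ltc); rewrite flatten_indexKl ?nth_perm_shp //.
move=> /val_inj/perm_inj Ej; subst j'.
have := flatten_indexKr (sh := perm_shp a s) (r := a j) (c := c).
rewrite nth_perm_shp Eii' => /(_ ltc); rewrite flatten_indexKr ?nth_perm_shp //.
by move=> Ec; apply: val_inj; rewrite /= Ei Ei' Ec.
Qed.

Definition block_perm a s : 'S_m := perm (@block_map_inj a s).

Lemma block_permE a s i j c : c < nth 0 s j -> i = flatten_index s j c :> nat ->
  block_perm a s i = flatten_index (perm_shp a s) (a j) c :> nat.
Proof. by rewrite permE; exact: block_mapE. Qed.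

Lemma block_root_perm a s i :
  block_root (perm_shp a s) (block_perm a s i) = a (block_root s i).
Proof.
have [j [c [ltc Ei]]] := blockP s i; rewrite (block_rootE ltc Ei).
by apply: (@block_rootE _ _ _ c); rewrite ?nth_perm_shp // (block_permE _ ltc).
Qed.

Lemma perm_shp1 s : perm_shp 1 s = s.
Proof. by apply: shp_inj; apply: perm_seq1; exact: size_shp. Qed.

Lemma perm_shpM a b s : perm_shp (a * b) s = perm_shp b (perm_shp a s).
Proof. by apply: shp_inj; apply: perm_seqM; exact: size_shp. Qed.

Lemma block_perm1 s : block_perm 1 s = 1%g.
Proof.
apply/permP => i; rewrite perm1; apply: val_inj.
have [j [c [ltc Ei]]] := blockP s i.
by rewrite /= (block_permE _ ltc Ei) perm_shp1 perm1.
Qed.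

Lemma block_permM a b s :
  block_perm (a * b) s = (block_perm a s * block_perm b (perm_shp a s))%g.
Proof.
apply/permP => i; rewrite permM; apply: val_inj.
have [j [c [ltc Ei]]] := blockP s i.
rewrite /= (block_permE _ ltc Ei) perm_shpM permM.
by rewrite (@block_permE _ _ _ (a j) c) ?nth_perm_shp // (block_permE _ ltc Ei).
Qed.

End Blocks.

Section ShpComp.
Variables (r l m : nat).
Implicit Types (s : shp r l) (t : shp l m) (a : 'S_r).

Definition comp_seq (s t : seq nat) := map sumn (reshape s t).

Fact comp_shp_size s t : size (comp_seq s t) = r.
Proof. by rewrite size_map size_reshape size_shp. Qed.
Fact comp_shp_sumn s t : sumn (comp_seq s t) = m.
Proof. by rewrite -sumn_flatten reshapeKr ?sumn_shp ?size_shp. Qed.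
Definition comp_shp s t := Shp (comp_shp_size s t) (comp_shp_sumn s t).

End ShpComp.

Lemma sumn_take_comp_seq s t n :
  sumn (take n (comp_seq s t)) = sumn (take (sumn (take n s)) t).
Proof.
elim: s t n => [|k s IHs] t [|n] //=; rewrite ?take0 //.
by rewrite IHs takeD sumn_cat.
Qed.

Lemma nth_comp_seq s t n :
  nth 0 (comp_seq s t) n = sumn (take (nth 0 s n) (drop (sumn (take n s)) t)).
Proof.
elim: s t n => [|k s IHs] t [|n] //=; rewrite ?drop0 ?take0 //.
by rewrite IHs drop_drop addnC.
Qed.

Lemma le_sumn_take (s : seq nat) n n' : n <= n' ->
  sumn (take n s) <= sumn (take n' s).
Proof. by move=> len; rewrite -(subnKC len) takeD sumn_cat leq_addr. Qed.

Lemma sumn_takeS (s : seq nat) n : sumn (take n.+1 s) = sumn (take n s) + nth 0 s n.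
Proof.
elim: s n => [|x s IHs] [|n] //=; first by rewrite take0 addn0.
by rewrite IHs addnA.
Qed.

Section ShpCompTheory.
Variables (r l m : nat).
Implicit Types (s : shp r l) (t : shp l m) (a : 'S_r).

Lemma block_le s (j : 'I_r) : sumn (take j s) + nth 0 s j <= l.
Proof.
rewrite -sumn_takeS -{2}(sumn_shp s) -{2}[shp_seq s]take_size.
by apply: le_sumn_take; rewrite size_shp.
Qed.

Lemma comp_blockP s t (i : 'I_m) :
  exists (j : 'I_r) (d : nat) (k : 'I_l) (c : nat),
  [/\ d < nth 0 s j, k = flatten_index s j d :> nat, c < nth 0 t k,
      i = flatten_index t k c :> nat &
    let c' := sumn (take d (drop (sumn (take j s)) t)) + c in
      c' < nth 0 (comp_shp s t) j /\ i = flatten_index (comp_shp s t) j c' :> nat].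
Proof.
have [k [c [ltc Ei]]] := blockP t i; have [j [d [ltd Ek]]] := blockP s k.
exists j, d, k, c; split=> //=; split.
  rewrite nth_comp_seq; apply: leq_trans (le_sumn_take _ ltd).
  by rewrite sumn_takeS ltn_add2l nth_drop -/(flatten_index s j d) -Ek.
rewrite /flatten_index sumn_take_comp_seq Ei Ek /flatten_index.
by rewrite takeD sumn_cat addnA.
Qed.

Lemma block_root_comp s t (i : 'I_m) :
  block_root (comp_shp s t) i = block_root s (block_root t i).
Proof.
have [j [d [k [c [ltd Ek ltc Ei [/= ltc' Ei']]]]]] := comp_blockP s t i.
by rewrite (block_rootE (s := comp_shp s t) ltc' Ei') (block_rootE ltc Ei) (block_rootE ltd Ek).
Qed.

Lemma take_drop_perm (T : Type) (x0 : T) a s (u : seq T) (j : 'I_r) d :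
    size u = l -> d <= nth 0 s j ->
  take d (drop (sumn (take (a j) (perm_shp a s)))
            (perm_seq x0 (block_perm a s) u))
    = take d (drop (sumn (take j s)) u).
Proof.
move=> szu led.
have le_l : sumn (take j s) + d <= l.
  by apply: leq_trans (block_le s j); rewrite leq_add2l.
have le_l' : sumn (take (a j) (perm_shp a s)) + d <= l.
  apply: leq_trans (block_le (perm_shp a s) (a j)).
  by rewrite leq_add2l nth_perm_shp.
have sz_take v k : size v = l -> k + d <= l -> size (take d (@drop T k v)) = d.
  by move=> szv le; rewrite size_takel // size_drop szv leq_subRL // (leq_trans (leq_addr _ _) le).
apply: (@eq_from_nth _ x0) => [|c]; rewrite !sz_take ?size_perm_seq //.
move=> ltc; rewrite !nth_take // !nth_drop.
have ltcj : c < nth 0 s j by apply: leq_trans led.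
pose k := Ordinal (lt_block ltcj).
have <- : block_perm a s k = sumn (take (a j) (perm_shp a s)) + c :> nat.
  exact: (@block_permE _ _ _ _ _ j c).
by rewrite nth_perm_seqV.
Qed.

Lemma perm_shp_comp a s t :
  perm_shp a (comp_shp s t) =
  comp_shp (perm_shp a s) (perm_shp (block_perm a s) t).
Proof.
apply: shp_inj; apply: (@eq_from_nth_ord _ 0 r); try exact: size_shp.
move=> i; rewrite -(permKV a i) nth_perm_shp /=.
rewrite !nth_comp_seq -[perm_seq 0 a s]/(shp_seq (perm_shp a s)) nth_perm_shp.
by rewrite take_drop_perm ?size_shp.
Qed.

Lemma block_perm_comp a s t :
  block_perm a (comp_shp s t) = block_perm (block_perm a s) t.
Proof.
apply/permP => i; apply: val_inj => /=.
have [j [d [k [c [ltd Ek ltc Ei [/= ltc' Ei']]]]]] := comp_blockP s t i.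
rewrite (block_permE (s := comp_shp s t) a ltc' Ei') (block_permE _ ltc Ei).
rewrite perm_shp_comp /flatten_index sumn_take_comp_seq (block_permE _ ltd Ek).
rewrite /flatten_index takeD sumn_cat take_drop_perm ?size_shp ?(ltnW ltd) //.
by rewrite addnA.
Qed.

End ShpCompTheory.

Section ShpOne.
Variable l : nat.
Implicit Types (a : 'S_l) (i : 'I_l).

Fact one_shp_sumn : sumn (nseq l 1) = l.
Proof. by rewrite sumn_nseq mul1n. Qed.
Definition one_shp := Shp (size_nseq l 1) one_shp_sumn.

Lemma flatten_index_nseq i : flatten_index (nseq l 1) i 0 = i.
Proof.
rewrite /flatten_index addn0 take_nseq ?sumn_nseq ?mul1n //.
exact: ltnW.
Qed.

Lemma block_root1 i : block_root one_shp i = i.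
Proof.
by apply: (@block_rootE _ _ _ _ _ 0); rewrite ?nth_nseq ?ltn_ord ?flatten_index_nseq.
Qed.

Lemma perm_shp_one a : perm_shp a one_shp = one_shp.
Proof.
apply: shp_inj; apply: (@eq_from_nth_ord _ 0 l); try exact: size_shp.
by move=> i; rewrite nth_perm_seq ?size_shp // !nth_nseq !ltn_ord.
Qed.

Lemma block_perm_one a : block_perm a one_shp = a.
Proof.
apply/permP => i; apply: val_inj => /=.
rewrite (@block_permE _ _ _ _ _ i 0) ?perm_shp_one ?flatten_index_nseq //.
by rewrite nth_nseq ltn_ord.
Qed.

End ShpOne.

(* An FS category, given by a presentation (S, R) of FS<S|R>: S is [colour] and
   R is [skein]. *)
Record fs_category := FSCategory {
  colour : Type;
  colour_inhabited : inhabited colour;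
  skein : ctree colour -> ctree colour -> Prop;
  skein_leaves : forall u v, skein u v -> leaves u = leaves v
}.

Section Forests.
Variable F : fs_category.
Local Notation T := (ctree (colour F)).

Inductive skein_cong : seq T -> seq T -> Prop :=
| skein_base u v : skein u v -> skein_cong [:: u] [:: v]
| skein_refl f : skein_cong f f
| skein_sym f g : skein_cong f g -> skein_cong g f
| skein_trans f g h : skein_cong f g -> skein_cong g h -> skein_cong f h
| skein_comp f f' g g' : rleaves f = size g -> rleaves f' = size g' ->
    skein_cong f f' -> skein_cong g g' -> skein_cong (rcomp f g) (rcomp f' g')
| skein_tensor f f' g g' :
    skein_cong f f' -> skein_cong g g' -> skein_cong (f ++ g) (f' ++ g').

Lemma skein_cong_shape f g : skein_cong f g -> tshape f = tshape g.
Proof.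
elim=> {f g} //=.
- by move=> u v /skein_leaves ->.
- by move=> f g h _ -> _ ->.
- move=> f f' g g' szg szg' _ Ef _ Eg.
  by rewrite !tshape_rcomp // Ef Eg.
- by move=> f f' g g' _ Ef _ Eg; rewrite /tshape !map_cat -!/(tshape _) Ef Eg.
Qed.

Lemma skein_cong_size f g : skein_cong f g -> size f = size g.
Proof. by move/skein_cong_shape/(congr1 size); rewrite !size_map. Qed.

Lemma skein_cong_take_drop f g n k : skein_cong f g ->
  skein_cong (take k (drop n f)) (take k (drop n g)).
Proof.
move=> fg; elim: fg n k => {f g}.
- move=> u v uv n k; have := skein_base uv.
  by case: n => [|n]; case: k => [|k] //= _; rewrite ?take0; apply: skein_refl.
- by move=> *; exact: skein_refl.
- by move=> f g _ IH n k; exact: skein_sym.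
- by move=> f g h _ IH1 _ IH2 n k; exact: skein_trans (IH1 n k) (IH2 n k).
- move=> f f' g g' szg szg' ff' IHf gg' IHg n k.
  rewrite !drop_rcomp !take_rcomp.
  set f1 := take k _; set f1' := take k (drop n f').
  have Ef1 : tshape f1 = tshape f1' by exact: skein_cong_shape (IHf n k).
  have -> : rleaves (take n f') = rleaves (take n f).
    rewrite /rleaves /tshape !map_take -!/(tshape _).
    by rewrite (skein_cong_shape ff').
  rewrite -(rcomp_take f1) -(rcomp_take f1').
  have -> : rleaves f1' = rleaves f1 by rewrite /rleaves Ef1.
  set u := take _ _; set u' := take _ (drop _ g').
  have uu' : skein_cong u u' by exact: IHg.
  have le_f : rleaves (take n f) + rleaves f1 <= size g.
    have -> : size g = rleaves (take n f ++ (f1 ++ drop k (drop n f))).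
      by rewrite !cat_take_drop.
    by rewrite !rleaves_cat leq_add2l leq_addr.
  have szu : rleaves f1 = size u.
    rewrite size_takel // size_drop leq_subRL //.
    exact: leq_trans (leq_addr _ _) le_f.
  apply: skein_comp => //; last exact: IHf.
  by rewrite -(skein_cong_size uu') -szu /rleaves Ef1.
- move=> f f' g g' ff' IHf gg' IHg n k.
  rewrite !drop_cat -(skein_cong_size ff'); case: ifP => // _.
  rewrite !take_cat !size_drop -(skein_cong_size ff'); case: ifP => // _.
  apply: skein_tensor; last by have := IHg 0 (k - (size f - n)); rewrite !drop0.
  have := IHf n (size f); rewrite !take_oversize // size_drop ?leq_subr //.
  by rewrite -(skein_cong_size ff') leq_subr.
Qed.

Lemma skein_cong_nth f g n : skein_cong f g ->
  skein_cong [:: nth Leaf f n] [:: nth Leaf g n].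
Proof.
move=> fg; have [ltn|len] := ltnP n (size f); last first.
  rewrite !nth_default -?(skein_cong_size fg) //; exact: skein_refl.
have := skein_cong_take_drop n 1 fg.
rewrite (drop_nth Leaf ltn) (@drop_nth _ Leaf n g) -?(skein_cong_size fg) //=.
by rewrite !take0.
Qed.

Lemma skein_cong_from_nth f g : size f = size g ->
  (forall n, skein_cong [:: nth Leaf f n] [:: nth Leaf g n]) -> skein_cong f g.
Proof.
elim: f g => [|t f IHf] [|u g] //=; first by move=> *; exact: skein_refl.
move=> [szfg] fg.
apply: (@skein_tensor [:: t] [:: u]); first exact: (fg 0).
by apply: IHf => // n; exact: (fg n.+1).
Qed.

Record rforest (r l : nat) := RForest {
  rtrees :> seq T;
  rforestP : (size rtrees == r) && (rleaves rtrees == l)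
}.

HB.instance Definition _ r l := [isSub for @rtrees r l].
HB.instance Definition _ r l := [Choice of rforest r l by <:].

Lemma size_rforest r l (f : rforest r l) : size f = r.
Proof. by have /andP[/eqP] := rforestP f. Qed.

Lemma rleaves_rforest r l (f : rforest r l) : rleaves f = l.
Proof. by have /andP[_ /eqP] := rforestP f. Qed.

Definition skein_rel r l : rel (rforest r l) := fun f g => `[< skein_cong f g >].

Fact skein_rel_refl r l : reflexive (@skein_rel r l).
Proof. by move=> f; apply/asboolP; exact: skein_refl. Qed.
Fact skein_rel_sym r l : symmetric (@skein_rel r l).
Proof. by move=> f g; apply/asboolP/asboolP; exact: skein_sym. Qed.
Fact skein_rel_trans r l : transitive (@skein_rel r l).
Proof.
by move=> g f h /asboolP fg /asboolP gh; apply/asboolP; exact: skein_trans gh.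
Qed.

Canonical skein_equiv r l := EquivRel (@skein_rel r l)
  (@skein_rel_refl r l) (@skein_rel_sym r l) (@skein_rel_trans r l).

(* The morphisms l -> r of FS<S|R>, i.e. forests with r roots and l leaves.  The extra object 0 only carries the empty
   forest, a unit for the tensor product. *)
Definition forest r l := {eq_quot @skein_rel r l}.

HB.instance Definition _ r l := Choice.on (forest r l).
HB.instance Definition _ r l := EqQuotient.on (forest r l).

Lemma forest_eqP r l (f g : rforest r l) :
  \pi_(forest r l) f = \pi_(forest r l) g <-> skein_cong f g.
Proof. by split=> [/eqquotP/asboolP|fg] //; apply/eqquotP/asboolP. Qed.

Lemma forestP r l (f : forest r l) : exists f', f = \pi_(forest r l) f'.
Proof. by exists (repr f); rewrite reprK. Qed.

Lemma repr_cong r l (f : rforest r l) : skein_cong (repr (\pi_(forest r l) f)) f.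
Proof. by apply/forest_eqP; rewrite reprK. Qed.

Fact comp_subproof r l m (f : rforest r l) (g : rforest l m) :
  (size (rcomp f g) == r) && (rleaves (rcomp f g) == m).
Proof.
rewrite size_rcomp size_rforest rleaves_rcomp rleaves_rforest ?eqxx //.
by rewrite size_rforest.
Qed.

Definition comp r l m (f : forest r l) (g : forest l m) : forest r m :=
  \pi_(forest r m) (RForest (comp_subproof (repr f) (repr g))).

Fact idf_subproof l :
  (size (nseq l (@Leaf (colour F))) == l) && (rleaves (nseq l (@Leaf (colour F))) == l).
Proof. by rewrite size_nseq rleaves_nseq eqxx. Qed.

Definition idf l : forest l l := \pi_(forest l l) (RForest (idf_subproof l)).

Fact shape_size r l (f : forest r l) : size (tshape (repr f)) = r.
Proof. by rewrite size_map size_rforest. Qed.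
Fact shape_sumn r l (f : forest r l) : sumn (tshape (repr f)) = l.
Proof. exact: rleaves_rforest. Qed.
Definition shape r l (f : forest r l) : shp r l := Shp (shape_size f) (shape_sumn f).

Fact permf_subproof l m (a : 'S_l) (g : rforest l m) :
  (size (perm_seq Leaf a g) == l) && (rleaves (perm_seq Leaf a g) == m).
Proof.
rewrite size_perm_seq eqxx /rleaves /tshape.
rewrite (@map_perm_seq _ _ _ 0) ?size_rforest // sumn_perm_seq.
  by apply/eqP; exact: rleaves_rforest.
by rewrite size_map size_rforest.
Qed.

(* The forest g^a: the (a j)-th tree of (permf a g) is the j-th tree of g. *)
Definition permf l m (a : 'S_l) (g : forest l m) : forest l m :=
  \pi_(forest l m) (RForest (permf_subproof a (repr g))).

Lemma comp_pi r l m (f : rforest r l) (g : rforest l m) :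
  comp (\pi_(forest r l) f) (\pi_(forest l m) g)
    = \pi_(forest r m) (RForest (comp_subproof f g)).
Proof.
apply/forest_eqP => /=; apply: skein_comp; try exact: repr_cong.
- by rewrite rleaves_rforest size_rforest.
- by rewrite rleaves_rforest size_rforest.
Qed.

Lemma permf_pi l m (a : 'S_l) (g : rforest l m) :
  permf a (\pi_(forest l m) g) = \pi_(forest l m) (RForest (permf_subproof a g)).
Proof.
apply/forest_eqP => /=; apply: skein_cong_from_nth; rewrite ?size_perm_seq //.
move=> n; have [ltn|len] := ltnP n l; last first.
  by rewrite !nth_default ?size_perm_seq //; exact: skein_refl.
rewrite -[n]/(nat_of_ord (Ordinal ltn)) !nth_perm_seq ?size_rforest //.
by apply: skein_cong_nth; exact: repr_cong.
Qed.

Lemma shape_pi r l (f : rforest r l) :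
  shape (\pi_(forest r l) f) = tshape f :> seq nat.
Proof. by apply: skein_cong_shape; exact: repr_cong. Qed.

Lemma rforest_eq r l (f g : rforest r l) : f = g :> seq T ->
  \pi_(forest r l) f = \pi_(forest r l) g.
Proof. by move=> fg; congr (\pi _); apply: val_inj. Qed.

Lemma compA r l m n (f : forest r l) (g : forest l m) (h : forest m n) :
  comp (comp f g) h = comp f (comp g h).
Proof.
case: (forestP f) => {}f ->; case: (forestP g) => {}g ->; case: (forestP h) => {}h ->.
rewrite !comp_pi; apply: rforest_eq => /=.
by rewrite rcompA ?rleaves_rforest ?size_rforest.
Qed.

Lemma compf1 r l (f : forest r l) : comp f (idf l) = f.
Proof.
case: (forestP f) => {}f ->; rewrite comp_pi; apply: rforest_eq => /=.
by have := rcompf1 f; rewrite rleaves_rforest.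
Qed.

Lemma comp1f r l (f : forest r l) : comp (idf r) f = f.
Proof.
case: (forestP f) => {}f ->; rewrite comp_pi; apply: rforest_eq => /=.
by have := rcomp1f f; rewrite size_rforest.
Qed.

Lemma shape_comp r l m (f : forest r l) (g : forest l m) :
  shape (comp f g) = comp_shp (shape f) (shape g).
Proof.
case: (forestP f) => {}f ->; case: (forestP g) => {}g ->; apply: shp_inj.
rewrite -[RHS]/(comp_seq (shape _) (shape _)) comp_pi !shape_pi tshape_rcomp //.
by rewrite rleaves_rforest size_rforest.
Qed.

Lemma shape_idf l : shape (idf l) = one_shp l.
Proof. by apply: shp_inj; rewrite shape_pi /= /tshape map_nseq. Qed.

Lemma shape_permf l m (a : 'S_l) (g : forest l m) :
  shape (permf a g) = perm_shp a (shape g).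
Proof.
case: (forestP g) => {}g ->; apply: shp_inj.
rewrite -[RHS]/(perm_seq 0 a (shape _)) permf_pi !shape_pi /= /tshape.
by rewrite (@map_perm_seq _ _ _ 0) ?size_rforest.
Qed.

Lemma permf1 l m (g : forest l m) : permf 1 g = g.
Proof.
case: (forestP g) => {}g ->; rewrite permf_pi; apply: rforest_eq => /=.
by rewrite perm_seq1 ?size_rforest.
Qed.

Lemma permfM l m (a b : 'S_l) (g : forest l m) :
  permf (a * b) g = permf b (permf a g).
Proof.
case: (forestP g) => {}g ->; rewrite !permf_pi; apply: rforest_eq => /=.
by rewrite perm_seqM ?size_rforest.
Qed.

Lemma permf_idf l (a : 'S_l) : permf a (idf l) = idf l.
Proof.
rewrite permf_pi; apply: rforest_eq => /=.
apply: (@eq_from_nth_ord _ Leaf l); rewrite ?size_perm_seq ?size_nseq // => i.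
by rewrite nth_perm_seq ?size_nseq // !nth_nseq !ltn_ord.
Qed.

(* The permutation a^g: it sends the leaves of the j-th tree of g, in order, to
   those of the (a j)-th tree of permf a g. *)
Definition leafperm l m (a : 'S_l) (g : forest l m) : 'S_m := block_perm a (shape g).

Lemma permf_comp r l m (a : 'S_r) (g : forest r l) (k : forest l m) :
  permf a (comp g k) = comp (permf a g) (permf (leafperm a g) k).
Proof.
rewrite /leafperm; case: (forestP g) => {}g ->; case: (forestP k) => {}k ->.
rewrite !(comp_pi, permf_pi); apply: rforest_eq => /=.
set s := shape _; have Es : s = tshape g :> seq nat by exact: shape_pi.
apply: (@eq_from_nth_ord _ Leaf r).
- by rewrite size_perm_seq.
- by rewrite size_rcomp size_perm_seq.
move=> i; rewrite -(permKV a i) nth_perm_seqV ?size_rcomp ?size_rforest //.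
rewrite !nth_rcomp ?size_perm_seq ?size_rforest //.
rewrite nth_perm_seqV ?size_rforest //; congr (graft _ _).
have -> : rleaves (take (a (a^-1%g i)) (perm_seq Leaf a g))
          = sumn (take (a (a^-1%g i)) (perm_shp a s)).
  rewrite /rleaves /tshape map_take (@map_perm_seq _ _ _ 0) ?size_rforest //.
  by rewrite -[shp_seq (perm_shp a s)]/(perm_seq 0 a s) Es.
rewrite (take_drop_perm Leaf) ?size_rforest //; last first.
  by rewrite Es (nth_map Leaf) ?size_rforest.
by rewrite /rleaves /tshape map_take Es.
Qed.

(* The index of the tree of f containing the leaf i. *)
Definition leafroot r l (f : forest r l) (i : 'I_l) : 'I_r := block_root (shape f) i.

Lemma leafroot_comp r l m (f : forest r l) (g : forest l m) i :
  leafroot (comp f g) i = leafroot f (leafroot g i).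
Proof. by rewrite /leafroot shape_comp block_root_comp. Qed.

Lemma leafroot_idf l i : leafroot (idf l) i = i.
Proof. by rewrite /leafroot shape_idf block_root1. Qed.

Lemma leafroot_permf l m (a : 'S_l) (g : forest l m) i :
  leafroot (permf a g) (leafperm a g i) = a (leafroot g i).
Proof. by rewrite /leafroot shape_permf block_root_perm. Qed.

Lemma leafperm1 l m (g : forest l m) : leafperm 1 g = 1%g.
Proof. exact: block_perm1. Qed.

Lemma leafpermM l m (a b : 'S_l) (g : forest l m) :
  leafperm (a * b) g = (leafperm a g * leafperm b (permf a g))%g.
Proof. by rewrite /leafperm shape_permf block_permM. Qed.

Lemma leafperm_comp r l m (a : 'S_r) (g : forest r l) (k : forest l m) :
  leafperm a (comp g k) = leafperm (leafperm a g) k.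
Proof. by rewrite /leafperm shape_comp block_perm_comp. Qed.

Lemma leafperm_idf l (a : 'S_l) : leafperm a (idf l) = a.
Proof. by rewrite /leafperm shape_idf block_perm_one. Qed.

(* The morphisms f pi of F^V, with pi : 'S_l acting on the l leaves of f. *)
Definition vforest (r l : nat) : Type := (forest r l * 'S_l)%type.

HB.instance Definition _ r l := Choice.on (vforest r l).

(* (f, a) o (g, b) = (f o g^a, a^g o b); the product of 'S_m applies its left
   factor first. *)
Definition vcomp r l m (x : vforest r l) (y : vforest l m) : vforest r m :=
  (comp x.1 (permf x.2 y.1), (y.2 * leafperm x.2 y.1)%g).

Definition forestV r l (f : forest r l) : vforest r l := (f, 1%g).

Lemma vcompA r l m n (x : vforest r l) (y : vforest l m) (z : vforest m n) :
  vcomp (vcomp x y) z = vcomp x (vcomp y z).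
Proof.
rewrite /vcomp /= permf_comp permfM compA leafpermM leafperm_comp.
by rewrite mulgA.
Qed.

Lemma forestV_comp r l m (f : forest r l) (g : forest l m) :
  forestV (comp f g) = vcomp (forestV f) (forestV g).
Proof. by rewrite /vcomp /= permf1 leafperm1 mulg1. Qed.

Lemma vcomp_perm r l (f : forest r l) (a b : 'S_l) :
  vcomp (f, a) (idf l, b) = (f, (b * a)%g).
Proof. by rewrite /vcomp /= permf_idf compf1 leafperm_idf. Qed.

Lemma vcompf1 r l (x : vforest r l) : vcomp x (forestV (idf l)) = x.
Proof. by case: x => f a; rewrite vcomp_perm mul1g. Qed.

Definition left_cancellative :=
  forall r l m (f : forest r l) (g h : forest l m), 0 < r ->
    comp f g = comp f h -> g = h.

Definition common_right_multiples :=
  forall r l l' (f : forest r l) (g : forest r l'), 0 < r ->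
    exists m (h : forest l m) (k : forest l' m), comp f h = comp g k.

Definition ore := left_cancellative /\ common_right_multiples.

Definition vfrac : Type := {l : nat & (vforest 1 l * vforest 1 l)%type}.

HB.instance Definition _ := Choice.on vfrac.

(* The pair (x, y), of class [x, y]. *)
Definition mkfrac l (x y : vforest 1 l) : vfrac := existT _ l (x, y).

Inductive frac_step : vfrac -> vfrac -> Prop :=
| FracStep l m (x y : vforest 1 l) (p : vforest l m) :
    frac_step (mkfrac x y) (mkfrac (vcomp x p) (vcomp y p)).

Definition frac_rel : rel vfrac :=
  fun u v => `[< clos_refl_sym_trans vfrac frac_step u v >].

Fact frac_rel_refl : reflexive frac_rel.
Proof. by move=> u; apply/asboolP; exact: rst_refl. Qed.
Fact frac_rel_sym : symmetric frac_rel.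
Proof. by move=> u v; apply/asboolP/asboolP; exact: rst_sym. Qed.
Fact frac_rel_trans : transitive frac_rel.
Proof.
by move=> v u w /asboolP uv /asboolP vw; apply/asboolP; exact: rst_trans vw.
Qed.

Canonical frac_equiv :=
  EquivRel frac_rel frac_rel_refl frac_rel_sym frac_rel_trans.

(* The carrier of G^V.  The Ore condition is a parameter because the group
   structure below depends on it. *)
Definition FSgroupV (oreF : ore) : Type := {eq_quot frac_rel}.

HB.instance Definition _ oreF := Choice.on (FSgroupV oreF).
HB.instance Definition _ oreF := EqQuotient.on (FSgroupV oreF).

Section Fractions.
Variable oreF : ore.
Local Notation GV := (FSgroupV oreF).

Lemma compI r l m (f : forest r l) (g h : forest l m) : 0 < r ->
  comp f g = comp f h -> g = h.
Proof. exact: (proj1 oreF). Qed.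

Definition straight l m (a : 'S_l) (h : forest l m) : vforest l m :=
  (permf a^-1 h, ((leafperm a (permf a^-1 h))^-1)%g).

Lemma vcomp_straight r l m (f : forest r l) (a : 'S_l) (h : forest l m) :
  vcomp (f, a) (straight a h) = forestV (comp f h).
Proof. by rewrite /vcomp /= -permfM mulVg permf1 mulVg. Qed.

Lemma vcompI r l m (x : vforest r l) (p q : vforest l m) : 0 < r ->
  vcomp x p = vcomp x q -> p = q.
Proof.
case: x p q => [f a] [g b] [h c] r_gt0 [/(compI r_gt0) Egh].
have {Egh} -> : g = h.
  by rewrite -[g]permf1 -[h]permf1 -(mulgV a) !permfM Egh.
by move/mulIg => ->.
Qed.

Lemma vcomp_multiples l l' (x : vforest 1 l) (y : vforest 1 l') :
  exists m (p : vforest l m) (q : vforest l' m), vcomp x p = vcomp y q.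
Proof.
case: x y => [f a] [g b].
have [m [h [k Ehk]]] := proj2 oreF 1 _ _ f g isT.
by exists m, (straight a h), (straight b k); rewrite !vcomp_straight Ehk.
Qed.

Definition frac_sim (u v : vfrac) : Prop :=
  exists m (p : vforest (tag u) m) (q : vforest (tag v) m),
    vcomp (tagged u).1 p = vcomp (tagged v).1 q /\
    vcomp (tagged u).2 p = vcomp (tagged v).2 q.

Lemma frac_simP u v : clos_refl_sym_trans vfrac frac_step u v <-> frac_sim u v.
Proof.
split.
  elim=> {u v}.
  - move=> _ _ [l m x y p]; exists m, p, (forestV (idf m)).
    by rewrite /= !vcompf1.
  - by move=> [l [x y]]; exists l, (forestV (idf l)), (forestV (idf l)).
  - by move=> u v _ [m [p [q [E1 E2]]]]; exists m, q, p.
  - move=> [l [x y]] [l' [x' y']] [l'' [x'' y'']] _ [m [p [q /= [E1 E2]]]] _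
      [m' [p' [q' /= [E1' E2']]]].
    have [n [a [b Eab]]] := vcomp_multiples (vcomp x' q) (vcomp x' p').
    have Eqp : vcomp q a = vcomp p' b by apply: (@vcompI 1 _ _ x') => //; rewrite -!vcompA.
    exists n, (vcomp p a), (vcomp q' b) => /=; split.
      by rewrite -!vcompA E1 -E1' !vcompA Eqp.
    by rewrite -!vcompA E2 -E2' !vcompA Eqp.
case: u v => [l [x y]] [l' [x' y']] [m [p [q /= [E1 E2]]]].
apply: (@rst_trans _ _ _ (mkfrac (vcomp x p) (vcomp y p))).
  exact/rst_step/FracStep.
by rewrite E1 E2; exact/rst_sym/rst_step/FracStep.
Qed.

Definition frac l (x y : vforest 1 l) : GV := \pi_(GV) (mkfrac x y).

Lemma fracP l l' (x y : vforest 1 l) (x' y' : vforest 1 l') :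
  frac x y = frac x' y' <-> exists m (p : vforest l m) (q : vforest l' m),
    vcomp x p = vcomp x' q /\ vcomp y p = vcomp y' q.
Proof.
split=> [/eqquotP/asboolP/frac_simP //|E].
by apply/eqquotP/asboolP/frac_simP.
Qed.

Lemma frac_comp l m (x y : vforest 1 l) (p : vforest l m) :
  frac (vcomp x p) (vcomp y p) = frac x y.
Proof. by apply/eqquotP/asboolP/rst_sym/rst_step/FracStep. Qed.

Lemma fracW (g : GV) : exists l (x y : vforest 1 l), g = frac x y.
Proof.
rewrite -[g]reprK; case: (repr g) => [l [x y]]; exists l, x, y.
by [].
Qed.

Lemma frac_mul_ex (u v : GV) : exists w, exists l (x y z : vforest 1 l),
  [/\ u = frac x y, v = frac y z & w = frac x z].
Proof.
have [l [x [y ->]]] := fracW u; have [l' [y' [z ->]]] := fracW v.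
have [m [p [q Epq]]] := vcomp_multiples y y'.
exists (frac (vcomp x p) (vcomp z q)), m, (vcomp x p), (vcomp y p), (vcomp z q).
by rewrite frac_comp Epq frac_comp.
Qed.

(* The product determined by [x, y] [y, z] = [x, z], see frac_mulE. *)
Definition frac_mul (u v : GV) : GV := sval (cid (frac_mul_ex u v)).

Lemma frac_mulE l (x y z : vforest 1 l) : frac_mul (frac x y) (frac y z) = frac x z.
Proof.
rewrite /frac_mul; case: cid => w /= [l' [x' [y' [z' [E1 E2 ->]]]]].
have [m [p [q [E1x E1y]]]] := (fracP _ _ _ _).1 E1.
have [m' [r [s [E2y E2z]]]] := (fracP _ _ _ _).1 E2.
have [n [a [b Eab]]] := vcomp_multiples (vcomp y p) (vcomp y r).
have Epr : vcomp p a = vcomp r b by apply: (@vcompI 1 _ _ y) => //; rewrite -!vcompA.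
have Eqs : vcomp q a = vcomp s b.
  by apply: (@vcompI 1 _ _ y') => //; rewrite -!vcompA -E1y -E2y.
apply/fracP; exists n, (vcomp q a), (vcomp p a).
by rewrite -2!vcompA E1x Eqs Epr -!vcompA E2z.
Qed.

Definition frac_one : GV := frac (forestV (idf 1)) (forestV (idf 1)).

Lemma frac_oneE l (x : vforest 1 l) : frac x x = frac_one.
Proof.
have [m [p [q Epq]]] := vcomp_multiples x (forestV (idf 1)).
by apply/fracP; exists m, p, q.
Qed.

Fact frac_inv_ex (u : GV) : exists v, exists l (x y : vforest 1 l),
  u = frac x y /\ v = frac y x.
Proof. by have [l [x [y ->]]] := fracW u; exists (frac y x), l, x, y. Qed.

Definition frac_inv (u : GV) : GV := sval (cid (frac_inv_ex u)).

Lemma frac_invE l (x y : vforest 1 l) : frac_inv (frac x y) = frac y x.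
Proof.
rewrite /frac_inv; case: cid => v /= [l' [x' [y' [E ->]]]].
have [m [p [q [Ex Ey]]]] := (fracP _ _ _ _).1 E.
by apply/fracP; exists m, q, p.
Qed.

Fact frac_mulA : associative frac_mul.
Proof.
move=> u v w.
have [l [x [y ->]]] := fracW u.
have [vw [l' [y' [z' [t' [-> -> _]]]]]] := frac_mul_ex v w.
have [m [p [q Epq]]] := vcomp_multiples y y'.
rewrite -(frac_comp x y p) -(frac_comp y' z' q) -(frac_comp z' t' q) Epq.
by rewrite !frac_mulE.
Qed.

Fact frac_mul1 : left_id frac_one frac_mul.
Proof.
by move=> u; have [l [x [y ->]]] := fracW u; rewrite -(frac_oneE x) frac_mulE.
Qed.

Fact frac_mulr1 : right_id frac_one frac_mul.
Proof.
by move=> u; have [l [x [y ->]]] := fracW u; rewrite -(frac_oneE y) frac_mulE.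
Qed.

Fact frac_mulV : left_inverse frac_one frac_inv frac_mul.
Proof.
move=> u; have [l [x [y ->]]] := fracW u.
by rewrite frac_invE frac_mulE frac_oneE.
Qed.

Fact frac_mulrV : right_inverse frac_one frac_inv frac_mul.
Proof.
move=> u; have [l [x [y ->]]] := fracW u.
by rewrite frac_invE frac_mulE frac_oneE.
Qed.

HB.instance Definition _ := isGroup.Build GV
  frac_mulA frac_mul1 frac_mulr1 frac_mulV frac_mulrV.

End Fractions.
End Forests.

Section LimitSpace.
Variable F : fs_category.
Local Notation forest := (forest F).

Definition fs_tree : Type := {l : nat & forest 1 l}.

Definition mktree l (t : forest 1 l) : fs_tree := existT _ l t.

(* The tree tf. *)
Definition extend (t : fs_tree) m (f : forest (tag t) m) : fs_tree :=
  mktree (comp (tagged t) f).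

Definition tree_le (t t' : fs_tree) : Prop :=
  exists m (f : forest (tag t) m), t' = extend f.

(* Leaf(t) is 'I_l for a tree t with l leaves. *)
Definition leaf_families :=
  prod_topology (fun t : fs_tree => discrete_topology 'I_(tag t)).

Definition coherent : set leaf_families :=
  [set x | forall (t : fs_tree) m (f : forest (tag t) m),
             leafroot f (x (extend f)) = x t].

(* The inverse limit of the sets of leaves, a subspace of the product of these
   finite discrete spaces. *)
Definition limit_space := set_type coherent.

HB.instance Definition _ := Topological.on limit_space.

Definition coord (x : limit_space) (t : fs_tree) : 'I_(tag t) := set_val x t.

Definition limit_le (x y : limit_space) : Prop :=
  exists t0, forall t, tree_le t0 t -> coord x t <= coord y t.

Lemma coordP (x : limit_space) (t : fs_tree) m (f : forest (tag t) m) :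
  leafroot f (coord x (extend f)) = coord x t.
Proof. by have /set_mem := valP x; apply. Qed.

Lemma limit_ext (x y : limit_space) : (forall t, coord x t = coord y t) -> x = y.
Proof. by move=> Exy; apply/val_inj/functional_extensionality_dep. Qed.

Lemma coherentP (x : forall t : fs_tree, 'I_(tag t)) :
  (forall (t : fs_tree) m (f : forest (tag t) m),
     leafroot f (x (extend f)) = x t) ->
  exists y, forall t, coord y t = x t.
Proof. by move=> cx; exists (exist (fun y => y \in coherent) x (mem_set cx)). Qed.

Lemma shape_gt0 r l (f : forest r l) j : j < r -> 0 < nth 0 (shape f) j.
Proof.
by move=> ltj; rewrite (nth_map Leaf) ?size_rforest //; exact: leaves_gt0.
Qed.

Lemma tree_gt0 (t : fs_tree) : 0 < tag t.
Proof.
case: t => l f /=; rewrite -(sumn_shp (shape f)).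
have := shape_gt0 f (ltn0Sn 0); have := size_shp (shape f).
by case: (shp_seq (shape f)) => [|n []] //= _; rewrite addn0.
Qed.

(* The leafroot map is nondecreasing and onto. *)
Lemma leafroot_homo r l (f : forest r l) (i i' : 'I_l) :
  i <= i' -> leafroot f i <= leafroot f i'.
Proof.
move=> leii; have [j [c [ltc Ei]]] := blockP (shape f) i.
have [j' [c' [ltc' Ei']]] := blockP (shape f) i'.
rewrite /leafroot (block_rootE ltc Ei) (block_rootE ltc' Ei').
rewrite leqNgt; apply/negP => ltj; move: leii; rewrite Ei Ei' leqNgt => /negP[].
apply: leq_trans (leq_trans _ (leq_addr c _)); last exact: (le_sumn_take _ ltj).
by rewrite sumn_takeS ltn_add2l.
Qed.

Lemma leafroot_onto r l (f : forest r l) (j : 'I_r) : exists i, leafroot f i = j.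
Proof.
have ltc := shape_gt0 f (ltn_ord j).
by exists (Ordinal (lt_block ltc)); exact: (block_rootE ltc).
Qed.

Fact limit_min_ex : exists a : limit_space, forall x, limit_le a x.
Proof.
pose a (t : fs_tree) : 'I_(tag t) := Ordinal (tree_gt0 t).
have [t m f|y Ey] := @coherentP a.
  have [i Ei] := leafroot_onto f (a t).
  have le0 : leafroot f (a (extend f)) <= a t by rewrite -Ei leafroot_homo.
  by apply/val_inj/eqP; rewrite -leqn0.
exists y => x; exists (mktree (idf F 1)) => t _.
by rewrite Ey.
Qed.

Fact limit_max_ex : exists a : limit_space, forall x, limit_le x a.
Proof.
have lt_pred (t : fs_tree) : (tag t).-1 < tag t by rewrite prednK ?tree_gt0.
pose a (t : fs_tree) : 'I_(tag t) := Ordinal (lt_pred t).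
have le_a t (i : 'I_(tag t)) : i <= a t by rewrite /= -ltnS prednK ?tree_gt0.
have [t m f|y Ey] := @coherentP a.
  have [i Ei] := leafroot_onto f (a t).
  have le_t : a t <= leafroot f (a (extend f)).
    by rewrite -Ei; apply: leafroot_homo; exact: (le_a (extend f)).
  by apply/val_inj/eqP; rewrite eqn_leq le_a.
exists y => x; exists (mktree (idf F 1)) => t _.
by rewrite Ey le_a.
Qed.

Definition limit_min : limit_space := sval (cid limit_min_ex).
Definition limit_max : limit_space := sval (cid limit_max_ex).

Lemma limit_minP x : limit_le limit_min x.
Proof. exact: (svalP (cid limit_min_ex)). Qed.

Lemma limit_maxP x : limit_le x limit_max.
Proof. exact: (svalP (cid limit_max_ex)). Qed.

Variable oreF : ore F.
Local Notation GV := (FSgroupV oreF).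

Lemma tree_directed (t t' : fs_tree) : exists u, tree_le t u /\ tree_le t' u.
Proof.
have [m [f [f' E]]] := proj2 oreF 1 _ _ (tagged t) (tagged t') isT.
exists (extend f); split; first by exists m, f.
by exists m, f'; rewrite /extend E.
Qed.

Lemma tree_le_trans (t u v : fs_tree) : tree_le t u -> tree_le u v -> tree_le t v.
Proof.
move=> [m [f ->]] [n [g ->]]; exists n, (comp f g).
by rewrite /extend /= compA.
Qed.

Lemma limit_le_anti x y : limit_le x y -> limit_le y x -> x = y.
Proof.
move=> [t0 le_xy] [t1 le_yx]; apply: limit_ext => t.
have [u [le0u le1u]] := tree_directed t0 t1.
have [v [[m [f ->]] leuv]] := tree_directed t u.
rewrite -(coordP x f) -(coordP y f); congr leafroot.
apply: val_inj; apply/eqP; rewrite eqn_leq /=.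
by rewrite le_xy ?le_yx //; apply: tree_le_trans leuv.
Qed.

Fact frac_rep (g : GV) l (t : forest 1 l) :
  exists m (k : forest l m) (a : 'S_m) (s : forest 1 m),
    g = frac oreF (comp t k, a) (forestV s).
Proof.
have [n [[f b] [[f' b'] ->]]] := fracW g.
have [m [h [k Ehk]]] := proj2 oreF 1 _ _ f t isT.
rewrite -(frac_comp oreF _ _ (straight b h)) vcomp_straight Ehk.
case: (vcomp _ (straight b h)) => s c.
exists m, k, c^-1%g, s.
by rewrite -(frac_comp oreF _ _ (idf F m, c^-1%g)) !vcomp_perm mulVg mulg1.
Qed.

Fact act_uniq l (t : forest 1 l) m (k : forest l m) (a : 'S_m) (s : forest 1 m)
    m' (k' : forest l m') (a' : 'S_m') (s' : forest 1 m') (x : limit_space) :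
  frac oreF (comp t k, a) (forestV s) = frac oreF (comp t k', a') (forestV s') ->
  leafroot k (a (coord x (mktree s))) = leafroot k' (a' (coord x (mktree s'))).
Proof.
move=> /fracP[n [[p b] [[q b'] []]]].
rewrite /vcomp /= !permf1 !leafperm1 !mulg1 => -[E1 E2] [E3 E4].
move: E1 E2; rewrite !compA E4 => /(compI oreF (ltn0Sn 0)) Ek /mulgI Ea.
rewrite -(@coordP x (mktree s) n p) -(@coordP x (mktree s') n q) /extend /= E3.
rewrite -!leafroot_permf -!leafroot_comp Ek.
by rewrite Ea.
Qed.

Fact act_ex (g : GV) (x : limit_space) : exists y : limit_space,
  forall l (t s : forest 1 l) (a : 'S_l), g = frac oreF (t, a) (forestV s) ->
    coord y (mktree t) = a (coord x (mktree s)).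
Proof.
have ex_j (t : fs_tree) : exists j : 'I_(tag t),
    forall m (k : forest (tag t) m) (a : 'S_m) (s : forest 1 m),
      g = frac oreF (comp (tagged t) k, a) (forestV s) ->
      j = leafroot k (a (coord x (mktree s))).
  have [m [k [a [s Eg]]]] := frac_rep g (tagged t).
  exists (leafroot k (a (coord x (mktree s)))) => m' k' a' s'; rewrite Eg.
  exact: act_uniq.
pose y t := sval (cid (ex_j t)).
have Ey (t : fs_tree) m (k : forest (tag t) m) (a : 'S_m) (s : forest 1 m) :
    g = frac oreF (comp (tagged t) k, a) (forestV s) ->
    y t = leafroot k (a (coord x (mktree s))).
  exact: (svalP (cid (ex_j t))).
have [t m f|z Ez] := @coherentP y.
  have [n [k [a [s Eg]]]] := frac_rep g (tagged (extend f)).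
  rewrite (Ey (extend f) n k a s Eg).
  by rewrite (Ey t n (comp f k) a s) ?leafroot_comp // -compA.
exists z => l t s a Eg; rewrite Ez (Ey (mktree t) l (idf F l) a s).
  exact: leafroot_idf.
by rewrite compf1.
Qed.

(* The action of G^V, characterised by actE. *)
Definition act (g : GV) (x : limit_space) : limit_space := sval (cid (act_ex g x)).

Lemma actE l (t s : forest 1 l) (a : 'S_l) (x : limit_space) :
  coord (act (frac oreF (t, a) (forestV s)) x) (mktree t) = a (coord x (mktree s)).
Proof. exact: (svalP (cid (act_ex _ x))). Qed.

(* The cycle (1 2 ... l). *)
Definition cycle_perm l : 'S_l := perm (@ordS_inj l).

(* G^T and G are identified with their images in G^V. *)
Definition FSgroupT : set GV := [set g | exists l (x y : vforest F 1 l),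
  [/\ x.2 \in <[cycle_perm l]>%g, y.2 \in <[cycle_perm l]>%g & g = frac oreF x y]].

Definition FSgroup : set GV := [set g | exists l (t s : forest 1 l),
  g = frac oreF (forestV t) (forestV s)].

(* The elements of G acting trivially on a neighbourhood of a. *)
Definition germ_kernel (a : limit_space) : set GV :=
  [set g | FSgroup g /\ \forall x \near a, act g x = x].

Definition group_Ko := germ_kernel limit_min.
Definition group_Komega := germ_kernel limit_max.
Definition group_K := group_Ko `&` group_Komega.

End LimitSpace.

Arguments FSgroupT {F} oreF _.
Arguments FSgroup {F} oreF _.
Arguments group_Ko {F} oreF _.
Arguments group_Komega {F} oreF _.
Arguments group_K {F} oreF _.

Section GroupNotions.
Variable Gam : groupType.
Implicit Types (A B G H N : set Gam).
Local Open Scope group_scope.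

Definition is_subgroup H : Prop :=
  [/\ H 1, (forall x y, H x -> H y -> H (x * y)) & (forall x, H x -> H x^-1)].

Definition derived_subgroup H : set Gam :=
  smallest is_subgroup [set [~ x, y] | x in H & y in H].

Definition normal_in N H : Prop :=
  [/\ is_subgroup N, N `<=` H & forall n h, N n -> H h -> N (n ^ h)].

Definition simple_group H : Prop :=
  [/\ is_subgroup H, H <> [set 1] &
      forall N, normal_in N H -> N = [set 1] \/ N = H].

Definition left_coset h H : set Gam := [set h * x | x in H].

Definition left_cosets G H : set (set Gam) := [set left_coset h H | h in G].

(* The action of G on A / H by left multiplication is faithful. *)
Definition faithful_on_cosets G A H : Prop :=
  forall g, G g ->
    (forall C, left_cosets A H C -> left_coset g C = C) -> g = 1.

(* The product of two cosets of a normal subgroup is their setwise product. *)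
Definition quotient_abelian G H : Prop :=
  forall A B, left_cosets G H A -> left_cosets G H B ->
    [set a * b | a in A & b in B] = [set b * a | b in B & a in A].

End GroupNotions.

(* Main.v *)
(** The proof is dynamical.  The orbit of [o] under [G^T] is dense in the limit space
    and its point stabiliser is [G], and elements of [G^V] acting trivially on the
    limit space lie in [G] since the permutation they involve is monotone; so (1) says
    that [G^V] acts faithfully on the limit space.

    The elements of [K] can carry any interior piece of the space into any interior
    cone.  When the action is faithful, Higman's double commutator argument therefore
    shows that a nontrivial subgroup normalised by [[L, L]], with [L] a group of
    elements trivial near [o] and [omega] containing [K], contains [[L, L]].  For
    [G^T] and [G^V] one then uses that every element is the product of an element of
    [K] and of one fixing a cone.  When the germ groups are abelian, [[G, G] <= K], and
    any [c] in [[G, G]] is conjugate in [K] to a copy of [c] living in an interior cone;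
    this copy is a product of commutators of copies of elements of [G], and copies
    belong to [K], so [[G, G] = [K, K]].

    When the action is not faithful, its kernel is a normal subgroup contained in [K]
    and meeting [[K, K]] in a proper nontrivial subgroup. *)
Require Import Defs.
From mathcomp Require Import all_boot fingroup perm generic_quotient.
From mathcomp Require Import all_classical topology.
From mathcomp Require Import zify.

Set Implicit Arguments.
Unset Strict Implicit.
Unset Printing Implicit Defensive.

Local Open Scope classical_set_scope.
Local Open Scope quotient_scope.

(** * Gluing trees, and coordinates of points *)

Section PlainTrees.
Variable S : Type.
Local Notation T := (ctree S).
Implicit Types (t w : T) (h k : seq T).

(** Points are handled through raw trees and natural numbers: [x] is known from the numbers
    [pos x t], and below the leaf [i] of [v] it is again a point [zoom v i x] of the same space. Two
    points agree once they share one position and the zoom there, so equalities of actions become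
    local computations. An element of [G] needs only two trees with equally many leaves, whatever
    their colours; prescribing it on some leaves amounts to balancing leaf counts with filler trees.
    Skein relations matter near the ends, where the element must be the identity and the two trees
    are compared through a common refinement. Hence the two leaves that [band_map] keeps free on
    each side: one for the end, one for a filler. The main obstacle is that a normal subgroup of a
    derived group is only normalised by that derived group, so conjugating by elements of [K] is not
    allowed; they are first corrected into commutators by factors supported far away. In the
    unfaithful case supports say nothing, and triviality is tested on trees by left cancellation. *)

Definition insert n i w : seq T := nseq i Leaf ++ w :: nseq (n - i.+1) Leaf.

Lemma rleaves_seq1 w : rleaves [:: w] = leaves w.
Proof. by rewrite /rleaves /= addn0. Qed.

Lemma size_insert n i w : i < n -> size (insert n i w) = n.
Proof. by move=> lt_in; rewrite size_cat /= !size_nseq; lia. Qed.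

Lemma nth_insert n i w : nth Leaf (insert n i w) i = w.
Proof. by rewrite nth_cat size_nseq ltnn subnn. Qed.

Lemma rleaves_insert n i w : i < n -> rleaves (insert n i w) = n.-1 + leaves w.
Proof. by move=> lt_in; rewrite rleaves_cat rleaves_cons !rleaves_nseq; lia. Qed.

Lemma take_insert n i w : take i (insert n i w) = nseq i Leaf.
Proof. by rewrite take_size_cat ?size_nseq. Qed.

Lemma rleaves_take_insert n i w : rleaves (take i (insert n i w)) = i.
Proof. by rewrite take_insert rleaves_nseq. Qed.

Lemma rleavesE i h : i < size h ->
  rleaves h = rleaves (take i h) + leaves (nth Leaf h i) + rleaves (drop i.+1 h).
Proof.
move=> lt_i; rewrite -{1}(cat_take_drop i h) rleaves_cat.
by rewrite (drop_nth Leaf) // rleaves_cons addnA.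
Qed.

Lemma rleaves_takeS i h : i < size h ->
  rleaves (take i.+1 h) = rleaves (take i h) + leaves (nth Leaf h i).
Proof.
by move=> lt_i; rewrite (take_nth Leaf) // -cats1 rleaves_cat rleaves_seq1.
Qed.

Lemma rleaves_take_le i j h : i <= j -> rleaves (take i h) <= rleaves (take j h).
Proof. by move=> le_ij; rewrite /rleaves /tshape !map_take le_sumn_take. Qed.

Lemma rcomp_insert h i w : i < size h ->
  rcomp (insert (size h) i w)
        (take i h ++ nseq (leaves w) Leaf ++ drop i.+1 h)
  = take i h ++ w :: drop i.+1 h.
Proof.
move=> lt_i; rewrite rcomp_cat rleaves_nseq.
have szt : size (take i h) = i by rewrite size_takel // ltnW.
rewrite take_size_cat // drop_size_cat //= take_size_cat ?size_nseq //.
rewrite drop_size_cat ?size_nseq // graft_id.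
have -> : size h - i.+1 = size (drop i.+1 h) by rewrite size_drop.
by rewrite rcomp1f -{1}szt rcomp1f.
Qed.

Lemma size_rcomp_insert h i w : i < size h ->
  size (take i h ++ nseq (leaves w) Leaf ++ drop i.+1 h)
    = rleaves (insert (size h) i w).
Proof.
move=> lt_i; rewrite !size_cat size_takel 1?ltnW // size_nseq size_drop.
by rewrite rleaves_insert //; lia.
Qed.

Lemma graft_insert t h i w : size h = leaves t -> i < leaves t -> nth Leaf h i = w ->
  graft t h = graft (graft t (insert (leaves t) i w))
                    (take i h ++ nseq (leaves w) Leaf ++ drop i.+1 h).
Proof.
move=> szh lt_i Ew; rewrite graftA ?size_insert //; last first.
  by rewrite -szh size_rcomp_insert // szh.
by rewrite -szh rcomp_insert ?szh // -Ew -drop_nth ?szh // cat_take_drop.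
Qed.

Lemma graft_graft_insert t i w k : i < leaves t -> size k = leaves w ->
  graft (graft t (insert (leaves t) i w))
        (nseq i Leaf ++ k ++ nseq (leaves t - i.+1) Leaf)
  = graft t (insert (leaves t) i (graft w k)).
Proof.
move=> lt_i szk; rewrite graftA ?size_insert //; last first.
  by rewrite rleaves_insert // !size_cat !size_nseq szk; lia.
have rcompLL n : rcomp (nseq n (@Leaf S)) (nseq n Leaf) = nseq n Leaf.
  by rewrite -{1}[n](size_nseq n (@Leaf S)) rcomp1f.
congr (graft t _); rewrite rcomp_cat rleaves_nseq.
rewrite take_size_cat ?size_nseq // drop_size_cat ?size_nseq //=.
by rewrite take_size_cat // drop_size_cat // !rcompLL.
Qed.

Lemma rleaves_take_pad i q h m : q <= size h ->
  rleaves (take (i + q) (nseq i Leaf ++ h ++ nseq m (@Leaf S)))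
    = i + rleaves (take q h).
Proof.
move=> leq; rewrite takeD take_size_cat ?size_nseq // drop_size_cat ?size_nseq //.
by rewrite rleaves_cat rleaves_nseq takel_cat.
Qed.

End PlainTrees.

Section Points.
Variables (F : fs_category) (oreF : ore F).
Local Notation T := (ctree (colour F)).
Local Notation GV := (FSgroupV oreF).
Local Notation C := (limit_space F).
Implicit Types (t s u v w : T) (h k f : seq T) (x y z : C) (i j c : nat).

Definition tree_eq t s := @skein_cong F [:: t] [:: s].

Lemma tree_eq_leaves t s : tree_eq t s -> leaves t = leaves s.
Proof. by move=> /skein_cong_shape [->]. Qed.

Lemma tree_eq_refl t : tree_eq t t. Proof. exact: skein_refl. Qed.
Lemma tree_eq_sym t s : tree_eq t s -> tree_eq s t.
Proof. exact: skein_sym. Qed.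
Lemma rcomp1 t h : size h = leaves t -> rcomp [:: t] h = [:: graft t h].
Proof. by move=> szh; rewrite /= take_oversize ?szh. Qed.

Lemma graft_eq t s h k : size h = leaves t ->
  tree_eq t s -> @skein_cong F h k -> tree_eq (graft t h) (graft s k).
Proof.
move=> szh Ets Ehk.
have szk : size k = leaves s by rewrite -(skein_cong_size Ehk) szh (tree_eq_leaves Ets).
rewrite /tree_eq -!rcomp1 //.
by apply: skein_comp => //; rewrite rleaves_seq1.
Qed.

Lemma graft_eql t s h : size h = leaves t -> tree_eq t s ->
  tree_eq (graft t h) (graft s h).
Proof. by move=> szh Ets; apply: graft_eq => //; exact: skein_refl. Qed.

Fact cls_sub r l h (E : size h = r /\ rleaves h = l) :
  (size h == r) && (rleaves h == l).
Proof. by case: E => -> ->; rewrite !eqxx. Qed.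

Definition cls r l h (E : size h = r /\ rleaves h = l) : forest F r l :=
  \pi_(forest F r l) (RForest (cls_sub E)).

Lemma cls_eq r l h k (Eh : size h = r /\ rleaves h = l)
    (Ek : size k = r /\ rleaves k = l) :
  cls Eh = cls Ek <-> @skein_cong F h k.
Proof. exact: forest_eqP. Qed.

Lemma clsW r l (f : forest F r l) : exists h (E : size h = r /\ rleaves h = l), f = cls E.
Proof.
case: (forestP f) => [[h E]] ->; have /andP[/eqP E1 /eqP E2] := E.
by exists h, (conj E1 E2); apply/forest_eqP; exact: skein_refl.
Qed.

Fact tr_sub l t : leaves t = l -> size [:: t] = 1 /\ rleaves [:: t] = l.
Proof. by rewrite rleaves_seq1. Qed.

(** The leaf count [l] is a free index tied to [t] by [E], so that trees with provably equal leaf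
    counts share one type without casts. *)
Definition tr l t (E : leaves t = l) : forest F 1 l := cls (tr_sub E).

Lemma tr_eq l t s (Et : leaves t = l) (Es : leaves s = l) :
  tr Et = tr Es <-> tree_eq t s.
Proof. exact: cls_eq. Qed.

Lemma trW l (f : forest F 1 l) : exists t (E : leaves t = l), f = tr E.
Proof.
have [h [[Es El] ->]] := clsW f; case: h Es El => [//|t [|//]] Es El.
have E : leaves t = l by rewrite -El rleaves_seq1.
by exists t, E; apply/cls_eq; exact: skein_refl.
Qed.

Lemma comp_cls r l m h k (Eh : size h = r /\ rleaves h = l)
   (Ek : size k = l /\ rleaves k = m) (Ehk : size (rcomp h k) = r /\ rleaves (rcomp h k) = m) :
  Defs.comp (cls Eh) (cls Ek) = cls Ehk.
Proof. by rewrite comp_pi; apply/forest_eqP; exact: skein_refl. Qed.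

Lemma comp_tr l m t h (Et : leaves t = l) (Eh : size h = l /\ rleaves h = m)
    (E : leaves (graft t h) = m) : Defs.comp (tr Et) (cls Eh) = tr E.
Proof.
have Eth : size h = leaves t by rewrite Et; case: Eh.
have E' : size (rcomp [:: t] h) = 1 /\ rleaves (rcomp [:: t] h) = m.
  by rewrite rcomp1 // rleaves_seq1.
rewrite /tr (comp_cls (tr_sub Et) Eh E'); apply/cls_eq.
by rewrite rcomp1 //; exact: skein_refl.
Qed.

Lemma shape_cls r l h (E : size h = r /\ rleaves h = l) : Defs.shape (cls E) = tshape h :> seq nat.
Proof. exact: shape_pi. Qed.

Lemma leafroot_cls r l h (E : size h = r /\ rleaves h = l) (i : 'I_l) :
  leafroot (cls E) i = reshape_index (tshape h) i :> nat.
Proof. by rewrite -(shape_cls E). Qed.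

Lemma tree_directed2 t s : exists h k, [/\ size h = leaves t, size k = leaves s &
  tree_eq (graft t h) (graft s k)].
Proof.
have [m [f [g]]] := proj2 oreF 1 _ _ (tr (erefl (leaves t))) (tr (erefl (leaves s))) isT.
have [h [Eh ->]] := clsW f; have [k [Ek ->]] := clsW g => E.
have [szh Elh] := Eh; have [szk Elk] := Ek.
have Et : leaves (graft t h) = m by rewrite leaves_graft.
have Es : leaves (graft s k) = m by rewrite leaves_graft.
move: E; rewrite (comp_tr _ _ Et) (comp_tr _ _ Es) => /tr_eq E.
by exists h, k.
Qed.

Lemma graft_cancel t h k : size h = leaves t -> size k = leaves t ->
  tree_eq (graft t h) (graft t k) -> @skein_cong F h k.
Proof.
move=> szh szk E; have := tree_eq_leaves E; rewrite !leaves_graft // => Ehk.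
have /cls_eq : cls (conj szh erefl) = cls (conj szk (esym Ehk)).
  apply: (compI oreF (f := tr (erefl (leaves t)))) => //.
  have Eh : leaves (graft t h) = rleaves h by rewrite leaves_graft.
  have Ek : leaves (graft t k) = rleaves h by rewrite leaves_graft.
  by rewrite (comp_tr _ _ Eh) (comp_tr _ _ Ek); apply/tr_eq.
by [].
Qed.

(** A number and not an ordinal: positions in skein-equal trees, or in trees rewritten into each
    other, are compared without transport. *)
Definition pos x t : nat := coord x (mktree (tr (erefl (leaves t)))).

Lemma posE x l t (E : leaves t = l) : coord x (mktree (tr E)) = pos x t :> nat.
Proof. by case: l / E. Qed.

Lemma pos_lt x t : pos x t < leaves t.
Proof. exact: ltn_ord. Qed.

Lemma pos_eq x t s : tree_eq t s -> pos x t = pos x s.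
Proof.
move=> E; rewrite -(posE x (tree_eq_leaves E)) /pos.
by rewrite (tr_eq (tree_eq_leaves E) erefl).2.
Qed.

Lemma pos_ext x y : (forall t, pos x t = pos y t) -> x = y.
Proof.
move=> Exy; apply: limit_ext => -[l f]; have [t [E ->]] := trW f.
by apply: val_inj; rewrite /= -/(mktree (tr E)) !posE.
Qed.

Lemma pos_block x t h : size h = leaves t ->
  rleaves (take (pos x t) h) <= pos x (graft t h) < rleaves (take (pos x t).+1 h).
Proof.
move=> szh; pose E : size h = leaves t /\ rleaves h = rleaves h := conj szh erefl.
have Et : leaves (graft t h) = rleaves h by rewrite leaves_graft.
have := coordP x (t := mktree (tr (erefl (leaves t)))) (cls E).
move=> /(congr1 (@nat_of_ord _)); rewrite leafroot_cls -[X in _ = X]/(pos x t).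
rewrite /extend /tagged (comp_tr _ _ Et) posE => <-.
set p := pos x (graft t h).
have ltp : p < sumn (tshape h) by rewrite -[sumn _]Et pos_lt.
have := reshape_indexP ltp; have := reshape_offsetP ltp.
have := reshape_indexK (tshape h) p; rewrite /flatten_index.
set j := reshape_index _ _ => Ep lto ltj.
rewrite /rleaves /tshape !map_take sumn_takeS; rewrite -/(tshape h); lia.
Qed.

Lemma pos_uniq x t h i : size h = leaves t -> 
  rleaves (take i h) <= pos x (graft t h) < rleaves (take i.+1 h) -> pos x t = i.
Proof.
move=> szh Hi; have Hp := pos_block x szh.
have [lti|lti|//] := ltngtP (pos x t) i.
  by have := rleaves_take_le h lti; lia.
by have := rleaves_take_le h lti; lia.
Qed.

Lemma pos_uniq2 x y t h : size h = leaves t ->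
  pos x (graft t h) = pos y (graft t h) -> pos x t = pos y t.
Proof. by move=> szh E; apply: (pos_uniq szh); rewrite E pos_block. Qed.

Lemma pos_insert x t i w : pos x t = i ->
  i <= pos x (graft t (insert (leaves t) i w)) < i + leaves w.
Proof.
move=> Ei; have lti : i < leaves t by rewrite -Ei pos_lt.
have := pos_block x (size_insert w lti).
by rewrite Ei rleaves_takeS ?size_insert // rleaves_take_insert nth_insert.
Qed.

(** Grafting each [w] at the leaf [i] alone reads off the coordinates of [x] below this leaf. They
    are coherent because refining [w] by [h] before or after grafting gives the same tree
    ([graft_graft_insert]). *)
Fact zoom_ex v i x : pos x v = i -> exists z,
  forall w, i + pos z w = pos x (graft v (insert (leaves v) i w)).
Proof.
move=> Ei; have lti : i < leaves v by rewrite -Ei pos_lt.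
(* [a] is a class of trees, so the number has to be right for every representative [w]. *)
pose Q (a : fs_tree F) (n : nat) := forall w (E : leaves w = tag a), tagged a = tr E ->
   i + n = pos x (graft v (insert (leaves v) i w)).
have ex a : exists n : 'I_(tag a), Q a n.
  case: a => l f /=; have [w [E ->]] := trW f.
  have := pos_insert w Ei; set p := pos _ _ => Hp.
  have ltp : p - i < l by rewrite -E; lia.
  exists (Ordinal ltp) => w' E' /tr_eq Eww' /=.
  rewrite subnKC; last by lia.
  rewrite /p; apply: pos_eq; apply: graft_eq; rewrite ?size_insert //.
    exact: tree_eq_refl.
  apply: skein_tensor; first exact: skein_refl.
  by apply: (@skein_tensor _ [:: w] [:: w']) => //; exact: skein_refl.
pose n a := sval (cid (ex a)).
have En a : Q a (n a) by exact: (svalP (cid (ex a))).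
have [a m f|z Ez] := @coherentP F n; last first.
  exists z => w; rewrite /pos Ez; exact: (En (mktree (tr (erefl (leaves w)))) w erefl).
case: a f => l g; have [w [E ->]] := trW g; rewrite /= => f.
have [h [Eh ->]] := clsW f; have [szh Elh] := Eh.
have Ewh : leaves (graft w h) = m by rewrite leaves_graft ?szh // -Elh.
have := En (existT _ l (tr E)) _ _ erefl.
have := En (extend (t := existT _ l (tr E)) (cls Eh)) (graft w h) Ewh.
rewrite /= (comp_tr _ _ Ewh) => /(_ erefl).
set n1 := n _; set n2 := n _.
suff : forall (p : 'I_m) (q : 'I_l),
    i + p = pos x (graft v (insert (leaves v) i (graft w h))) ->
    i + q = pos x (graft v (insert (leaves v) i w)) -> leafroot (cls Eh) p = q.
  exact.
move=> {n1 n2} p q E1 E2.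
have szk : size (nseq i Leaf ++ h ++ nseq (leaves v - i.+1) Leaf) =
    leaves (graft v (insert (leaves v) i w)).
  by rewrite leaves_graft ?size_insert // rleaves_insert // !size_cat !size_nseq szh E; lia.
have := pos_block x szk; rewrite graft_graft_insert ?szh ?E // -E1 -E2.
have ltq : q < size h by rewrite szh.
rewrite -(addnS i q) !rleaves_take_pad ?(ltnW ltq) // rleaves_takeS // => Hp.
apply: (@block_rootE _ _ _ _ _ (p - rleaves (take q h))).
  rewrite shape_cls (nth_map Leaf) //; move: Hp; clear.
  lia.
rewrite /flatten_index shape_cls /tshape -map_take.
rewrite -[sumn _]/(rleaves (take q h)); move: Hp; clear; lia.
Qed.
End Points.

(** * Neighbourhoods of a point as cones *)

Section Near.
Variables (F : fs_category) (oreF : ore F).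
Local Notation T := (ctree (colour F)).
Local Notation GV := (FSgroupV oreF).
Local Notation C := (limit_space F).
Implicit Types (t s u v w : T) (h k f : seq T) (x y z : C) (i j c : nat).

Lemma near_cone_open a t : \forall x \near a, pos x t = pos a t.
Proof.
pose i : fs_tree F := mktree (tr (erefl (leaves t))).
have : \forall x \near a, coord x i = coord a i.
  apply: (@initial_continuous _ _ (set_val : C -> leaf_families F) a
    [set f : leaf_families F | f i = coord a i]).
  have /cvg_sup : nbhs (set_val a : leaf_families F) --> (set_val a : leaf_families F).
    by move=> ?.
  move=> /(_ i); apply; rewrite /= (@nbhsE (initial_topology (fun f : leaf_families F => f i))).
  exists [set f : leaf_families F | f i = coord a i] => //; split=> //.
  exists [set coord a i] => //; exact: discrete_open.
by apply: filterS => x; rewrite /pos => ->.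
Qed.

(** Two trees have a common refinement, so the sets containing a cone around [a] form a filter; it
    converges to [a] in each coordinate, hence in the product topology. *)
Lemma near_cone a (P : set C) :
  (\forall x \near a, P x) <-> exists t, forall x, pos x t = pos a t -> P x.
Proof.
split=> [|[t tP]]; last by apply: filterS (near_cone_open a t).
pose G : set_system (leaf_families F) :=
  [set B | exists t, forall x, pos x t = pos a t -> B (set_val x)].
have FG : Filter G.
  split; first by exists Leaf.
  - move=> A B [t tA] [s sB].
    have [h [k [szh szk E]]] := tree_directed2 oreF t s.
    exists (graft t h) => x Ex; split; [apply: tA|apply: sB].
      exact: (pos_uniq2 szh).
    by apply: (pos_uniq2 szk); rewrite -!(pos_eq _ E).
  - by move=> A B AB [t tA]; exists t => x /tA /AB.
have cvgG : G --> (set_val a : leaf_families F).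
  apply/cvg_sup => i B; rewrite nbhsE => -[_ [[A oA <-] Aa] AB].
  case: i A oA Aa AB => l g A oA Aa AB; have [t [E Eg]] := trW g; subst l g.
  exists t => x Ex; apply: AB => /=.
  have E' : coord x (mktree (tr (erefl (leaves t)))) = coord a (mktree (tr erefl)).
    exact: val_inj.
  change (A (coord x (mktree (tr (erefl (leaves t)))))); rewrite E'; exact: Aa.
move=> [B [[A oA <-] Aa] BP].
have [t tA] : G A by apply: cvgG; apply: open_nbhs_nbhs.
by exists t => x /tA; exact: BP.
Qed.
End Near.

(** * Zooming into a cone *)

Section Zoom.
Variables (F : fs_category) (oreF : ore F).
Local Notation T := (ctree (colour F)).
Local Notation GV := (FSgroupV oreF).
Local Notation C := (limit_space F).
Implicit Types (t s u v w : T) (h k f : seq T) (x y z : C) (i j c : nat).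

(* The cone of the leaf i of v is a copy of the whole space: for x in it, zoom v i x
   is the corresponding point.  Junk value x if pos x v <> i. *)
Definition zoom v i x : C :=
  if pselect (exists z, forall w,
       i + pos z w = pos x (graft v (insert (leaves v) i w)))
  is left H then sval (cid H) else x.

Lemma pos_zoom v i x w : pos x v = i ->
  i + pos (zoom v i x) w = pos x (graft v (insert (leaves v) i w)).
Proof.
move=> Ei; rewrite /zoom; case: pselect => [H|[]]; last exact: zoom_ex.
exact: (svalP (cid H)).
Qed.

(** By [graft_insert] the tree of index [i] can be glued first; the trees glued afterwards at other
    leaves only shift the position. *)
Lemma pos_graft v i x h : pos x v = i -> size h = leaves v ->
  pos x (graft v h) = rleaves (take i h) + pos (zoom v i x) (nth Leaf h i).
Proof.
move=> Ei szh; have lti : i < leaves v by rewrite -Ei pos_lt.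
set w := nth _ _ _; have Ew : nth Leaf h i = w by [].
rewrite (graft_insert szh lti Ew).
set h' := _ ++ _; have := pos_zoom w Ei; set v' := graft v (insert _ _ _) => Ep.
have szh' : size h' = leaves v'.
  rewrite /v' leaves_graft ?size_insert // /h' size_rcomp_insert ?szh //.
have := pos_block x szh'; rewrite -Ep -addnS.
have ltc := pos_lt (zoom v i x) w.
have Etake c : c <= leaves w -> rleaves (take (i + c) h') = rleaves (take i h) + c.
  have szt : size (take i h) = i by rewrite size_takel // szh ltnW.
  move=> lec; rewrite takeD /h' take_size_cat // drop_size_cat // rleaves_cat.
  by rewrite takel_cat ?size_nseq // take_nseq // rleaves_nseq.
rewrite !Etake ?(ltnW ltc) //; lia.
Qed.

(** Any tree has a common refinement with [v], and there [pos_graft] computes the position from the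
    zoom. *)
Lemma zoom_inj v i x y : pos x v = i -> pos y v = i ->
  zoom v i x = zoom v i y -> x = y.
Proof.
move=> Ex Ey Exy; apply: pos_ext => t.
have [h [k [szh szk E]]] := tree_directed2 oreF v t.
apply: (@pos_uniq2 F _ _ _ k) => //.
by rewrite -!(pos_eq _ E) (pos_graft Ex szh) (pos_graft Ey szh) Exy.
Qed.

Lemma zoom_eq v v' i x : pos x v = i -> tree_eq v v' -> zoom v i x = zoom v' i x.
Proof.
move=> Ei Ev; have Ei' : pos x v' = i by rewrite -(pos_eq x Ev).
have lti : i < leaves v by rewrite -Ei pos_lt.
apply: pos_ext => w; apply: (@addnI i); rewrite !pos_zoom //.
rewrite -(tree_eq_leaves Ev); apply: pos_eq; apply: graft_eql => //.
exact: size_insert.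
Qed.

Lemma zoom_Leaf x : zoom Leaf 0 x = x.
Proof.
have E : pos x Leaf = 0 by have := pos_lt x (@Leaf (colour F)); case: (pos _ _).
by apply: pos_ext => w; have := pos_zoom w E.
Qed.

Lemma pos_graftP v x h i c : size h = leaves v -> i < leaves v ->
  c < leaves (nth Leaf h i) -> 
  pos x (graft v h) = rleaves (take i h) + c <->
  pos x v = i /\ pos (zoom v i x) (nth Leaf h i) = c.
Proof.
move=> szh lti ltc; split=> [E|[Ei Ec]]; last by rewrite (pos_graft Ei) // Ec.
have Ei : pos x v = i.
  apply: (pos_uniq szh); rewrite rleaves_takeS ?szh // E; lia.
by split=> //; move: E; rewrite (pos_graft Ei) // => /addnI.
Qed.

Lemma rleaves_rcomp_take f g : rleaves f <= size g ->
  rleaves (rcomp f g) = @rleaves (colour F) (take (rleaves f) g).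
Proof. by move=> le; rewrite -rcomp_take rleaves_rcomp // size_takel. Qed.

Lemma zoom_graft v x h i c : size h = leaves v -> pos x v = i ->
  pos (zoom v i x) (nth Leaf h i) = c ->
  zoom (graft v h) (rleaves (take i h) + c) x = zoom (nth Leaf h i) c (zoom v i x).
Proof.
move=> szh Ei Ec; have lti : i < leaves v by rewrite -Ei pos_lt.
have ltc : c < leaves (nth Leaf h i) by rewrite -Ec pos_lt.
set n := rleaves (take i h).
have Ex : pos x (graft v h) = n + c by rewrite (pos_graft Ei) // Ec.
have ltn : n + c < rleaves h by rewrite -(leaves_graft szh) -Ex pos_lt.
apply: pos_ext => w; apply: (@addnI (n + c)); rewrite pos_zoom // leaves_graft //.
set I := insert _ _ _.
have szI : size I = rleaves h by exact: size_insert.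
have Enth : nth Leaf (rcomp h I) i
    = graft (nth Leaf h i) (insert (leaves (nth Leaf h i)) c w).
  rewrite nth_rcomp ?szh // -/n; congr graft.
  rewrite /I /insert nseqD -catA drop_size_cat ?size_nseq //.
  have := rleavesE (h := h) (i := i); rewrite szh -/n => /(_ lti) Eh.
  rewrite take_cat size_nseq ifN -?leqNgt 1?ltnW //; congr (_ ++ _).
  have -> : leaves (nth Leaf h i) - c = (leaves (nth Leaf h i) - c.+1).+1 by lia.
  by rewrite /= take_nseq //; lia.
have Etake : rleaves (take i (rcomp h I)) = n.
  rewrite take_rcomp rleaves_rcomp_take -/n ?szI; last by lia.
  rewrite /I /insert nseqD -catA take_size_cat ?size_nseq //.
  exact: rleaves_nseq.
rewrite graftA // (pos_graft Ei) ?size_rcomp // Enth Etake -addnA; congr (_ + _).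
by rewrite -pos_zoom.
Qed.

Section Action.
Local Open Scope group_scope.
Implicit Types g : GV.

Lemma act_mul g g' x : act (g * g') x = act g (act g' x).
Proof.
apply: limit_ext => -[l t].
have [m [k [a [s Eg]]]] := frac_rep g t.
have [m' [k' [b [u Eg']]]] := frac_rep g' s.
(* Two forms of [g]: in [Eg2] the second entry is the first entry of [g'], as the product requires;
   in [Eg3] it carries no permutation, as [actE] requires. *)
have Eg2 : g = frac oreF (Defs.comp (Defs.comp t k) (permf a k'), b * leafperm a k')
                         (Defs.comp s k', b).
  rewrite Eg -(frac_comp oreF _ _ (k', b)) /vcomp /=.
  by rewrite permf1 leafperm1 mulg1.
have Eg3 : g = frac oreF (Defs.comp (Defs.comp t k) (permf a k'), leafperm a k')
                         (forestV (Defs.comp s k')).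
  rewrite Eg -(frac_comp oreF _ _ (forestV k')) /vcomp /forestV /=.
  by rewrite permf1 leafperm1 !mulg1 mul1g.
have Egg : g * g' = frac oreF (Defs.comp (Defs.comp t k) (permf a k'), b * leafperm a k')
                             (forestV u).
  by rewrite Eg2 Eg'; exact: frac_mulE.
have := @coordP _ (act (g * g') x) (mktree t) _ (Defs.comp k (permf a k')).
have := @coordP _ (act g (act g' x)) (mktree t) _ (Defs.comp k (permf a k')).
rewrite /extend /= -Defs.compA => <- <-; congr leafroot.
rewrite [in LHS]Egg actE {1}Eg3 actE permM; congr (leafperm _ _ _).
by rewrite Eg' actE.
Qed.

Lemma act1 x : act (1 : GV) x = x.
Proof.
apply: limit_ext => -[l t].
have -> : (1 : GV) = frac oreF (t, 1) (forestV t).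
  by rewrite -[RHS]/(frac oreF (forestV t) (forestV t)) frac_oneE.
by rewrite actE perm1.
Qed.

Lemma actK g : cancel (act g) (act g^-1).
Proof. by move=> x; rewrite -act_mul mulVg act1. Qed.

Lemma actVK g : cancel (act g^-1) (act g).
Proof. by move=> x; rewrite -act_mul mulgV act1. Qed.

Lemma act_inj g : injective (act g).
Proof. exact: can_inj (actK g). Qed.

Lemma permf_cls l m h h' (a : 'S_l) (E : size h = l /\ rleaves h = m)
    (E' : size h' = l /\ rleaves h' = m) :
  (forall i : 'I_l, nth Leaf h' (a i) = nth Leaf h i) -> permf a (@cls F _ _ h E) = cls E'.
Proof.
move=> Eh; rewrite permf_pi; apply/forest_eqP => /=.
case: E => szh _; case: E' => szh' _.
suff -> : perm_seq Leaf a h = h' by exact: skein_refl.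
apply: (@eq_from_nth_ord _ Leaf l); rewrite ?size_perm_seq // => i.
by rewrite -(permKV a i) nth_perm_seqV // Eh.
Qed.

Lemma act_pos l t s (Et : leaves t = l) (Es : leaves s = l) (a : 'S_l) x (j : 'I_l) :
  pos x s = j -> pos (act (frac oreF (tr Et, a) (forestV (tr Es))) x) t = a j.
Proof.
move=> Ej; rewrite -(posE _ Et) actE; congr (nat_of_ord (a _)).
by apply: val_inj; rewrite /= posE.
Qed.

(** Grafting the same [w] at the leaf [j] of [s] and at the leaf [a j] of [t] does not change the
    element, and the induced permutation keeps the order inside this block. *)
Lemma act_zoom l t s (Et : leaves t = l) (Es : leaves s = l) (a : 'S_l) x (j : 'I_l) :
  pos x s = j ->
  zoom t (a j) (act (frac oreF (tr Et, a) (forestV (tr Es))) x) = zoom s j x.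
Proof.
move=> Ej; have Eaj := act_pos Et Es a Ej; move: Eaj; set g := frac _ _ _ => Eaj.
apply: pos_ext => w; apply: (@addnI (a j)); rewrite pos_zoom //.
pose m := rleaves (insert l j w).
have Em i : i < l -> rleaves (insert l i w) = m by move=> lti; rewrite /m !rleaves_insert.
pose Ef := conj (size_insert w (ltn_ord j)) (erefl m).
pose Ef' := conj (size_insert w (ltn_ord (a j))) (Em _ (ltn_ord (a j))).
have Eperm : permf a (@cls F _ _ _ Ef) = cls Ef'.
  apply: permf_cls => i; have [->|neq] := eqVneq i j; first by rewrite !nth_insert.
  have nthL (i' k : 'I_l) : i' != k -> nth Leaf (insert l k w) i' = Leaf.
    rewrite -val_eqE /= /insert nth_cat size_nseq nth_nseq => nik.
    case: ltnP => [lt|le]; first by rewrite ?lt.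
    have -> : i' - k = (i' - k.+1).+1 by lia.
    by rewrite /= nth_nseq; case: ifP.
  by rewrite !nthL // (inj_eq perm_inj).
have lE1 : leaves (graft t (insert l (a j) w)) = m.
  by rewrite leaves_graft ?Em // size_insert.
have lE2 : leaves (graft s (insert l j w)) = m by rewrite leaves_graft ?size_insert.
have Eg : g = frac oreF (tr lE1, leafperm a (cls Ef)) (forestV (tr lE2)).
  rewrite /g -(frac_comp oreF _ _ (forestV (cls Ef))) /vcomp /forestV /=.
  rewrite permf1 leafperm1 !mulg1 mul1g Eperm.
  by rewrite (comp_tr Et Ef' lE1) (comp_tr Es Ef lE2).
have Ep := pos_zoom w Ej.
rewrite Et -(posE _ lE1) Eg actE.
have ltc : pos (zoom s j x) w < nth 0 (Defs.shape (@cls F _ _ _ Ef)) j.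
  by rewrite shape_cls (nth_map Leaf) ?size_insert // nth_insert pos_lt.
have Eflat (i : 'I_l) (E : size (insert l i w) = l /\ rleaves (insert l i w) = m) c :
    flatten_index (Defs.shape (@cls F _ _ _ E)) i c = i + c.
  by rewrite /flatten_index shape_cls /tshape -map_take
     -/(tshape _) -/(rleaves _) rleaves_take_insert.
rewrite (@block_permE _ _ _ _ _ j (pos (zoom s j x) w)) //.
  by rewrite -shape_permf Eperm Eflat.
by rewrite Eflat Ep Es -(posE x lE2).
Qed.

End Action.
End Zoom.

(** * The group G and the ends of the space *)

Section GroupG.
Variables (F : fs_category) (oreF : ore F).
Local Notation T := (ctree (colour F)).
Local Notation GV := (FSgroupV oreF).
Local Notation C := (limit_space F).
Local Open Scope group_scope.
Implicit Types (t s u v w : T) (h k f : seq T) (x y z : C) (i j c : nat) (g : GV).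

Definition gam t s : GV :=
  if @eqP _ (leaves t) (leaves s) is ReflectT E
  then frac oreF (forestV (tr E)) (forestV (tr erefl)) else 1.

Lemma gamE l t s (Et : leaves t = l) (Es : leaves s = l) :
  gam t s = frac oreF (forestV (tr Et)) (forestV (tr Es)).
Proof.
case: l / Es Et => Et; rewrite /gam; case: eqP => // E.
by rewrite (eq_irrelevance E Et).
Qed.

Lemma gam_pos t s x : leaves t = leaves s -> pos (act (gam t s) x) t = pos x s.
Proof.
move=> E; rewrite (gamE E erefl).
have Ej : pos x s = Ordinal (pos_lt x s) by [].
by rewrite (act_pos oreF E erefl 1 Ej) perm1.
Qed.

Lemma gam_zoom t s x i : leaves t = leaves s -> pos x s = i ->
  zoom t i (act (gam t s) x) = zoom s i x.
Proof.
move=> E Ei; rewrite (gamE E erefl).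
have Ej : pos x s = Ordinal (pos_lt x s) by [].
by have := act_zoom oreF E erefl 1%g Ej; rewrite perm1 /= Ei.
Qed.

Lemma gam_eq t t' s s' : leaves t = leaves s -> tree_eq t t' -> tree_eq s s' ->
  gam t s = gam t' s'.
Proof.
move=> E Et Es.
have E' : leaves t' = leaves s by rewrite -(tree_eq_leaves Et).
have E2 : leaves s' = leaves s by rewrite -(tree_eq_leaves Es).
rewrite (gamE E erefl) (gamE E' E2); congr frac; congr forestV; exact/tr_eq.
Qed.

Lemma gam_mul t s u : leaves t = leaves s -> leaves s = leaves u ->
  gam t s * gam s u = gam t u.
Proof.
move=> E E'; rewrite (gamE E erefl) (gamE erefl (esym E')) (gamE E (esym E')).
exact: frac_mulE.
Qed.

Lemma gam1 t : gam t t = 1.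
Proof. by rewrite (gamE erefl erefl) frac_oneE. Qed.

Lemma gam_inv t s : leaves t = leaves s -> (gam t s)^-1 = gam s t.
Proof.
move=> E; apply: (mulgI (gam t s)).
by rewrite mulgV gam_mul // gam1.
Qed.

Lemma gam_graft t s h : leaves t = leaves s -> size h = leaves t ->
  gam (graft t h) (graft s h) = gam t s.
Proof.
move=> E szh; have szh' : size h = leaves s by rewrite szh.
have El := leaves_graft szh; have El' := leaves_graft szh'.
rewrite (gamE E erefl) (gamE El El').
rewrite -(frac_comp oreF _ _ (forestV (cls (conj szh' (erefl (rleaves h)))))).
by rewrite -!forestV_comp (comp_tr E _ El) (comp_tr erefl _ El').
Qed.

Lemma FSgroupP g :
  FSgroup oreF g <-> exists t s, leaves t = leaves s /\ g = gam t s.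
Proof.
split=> [[l [f [f' ->]]]|[t [s [E ->]]]]; last first.
  by exists _, (tr E), (tr erefl); rewrite (gamE E erefl).
have [t [Et ->]] := trW f; have [s [Es ->]] := trW f'.
by exists t, s; rewrite (gamE Et Es) Et Es.
Qed.

Lemma FSgroup_subgroup : is_subgroup (FSgroup oreF).
Proof.
split.
- by apply/FSgroupP; exists Leaf, Leaf; rewrite gam1.
- move=> g g' /FSgroupP[t [s [E ->]]] /FSgroupP[t' [s' [E' ->]]].
  have [h [k [szh szk Ehk]]] := tree_directed2 oreF s t'.
  apply/FSgroupP; exists (graft t h), (graft s' k).
  have L1 : leaves (graft t h) = leaves (graft s h) by rewrite !leaves_graft ?E.
  have L2 : leaves (graft t' k) = leaves (graft s' k) by rewrite !leaves_graft -?E'.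
  have L3 := tree_eq_leaves Ehk.
  split; first by rewrite L1 L3.
  rewrite -(gam_graft E (h := h)) ?E // -(gam_graft E' (h := k)) //.
  by rewrite (gam_eq L1 (tree_eq_refl _) Ehk) gam_mul // L1.
- move=> g /FSgroupP[t [s [E ->]]]; apply/FSgroupP; exists s, t.
  by rewrite gam_inv.
Qed.

(** The tool for all explicit elements of [G]: only the number of leaves to the left decides which
    leaf goes where, and zooms are carried along unchanged. *)
Lemma gam_blocks t s h k x i j c d :
  leaves (graft t k) = leaves (graft s h) ->
  size h = leaves s -> size k = leaves t -> pos x s = j ->
  pos (zoom s j x) (nth Leaf h j) = c ->
  i < leaves t -> d < leaves (nth Leaf k i) ->
  rleaves (take i k) + d = rleaves (take j h) + c ->
  let y := act (gam (graft t k) (graft s h)) x in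
  [/\ pos y t = i, pos (zoom t i y) (nth Leaf k i) = d
    & zoom (nth Leaf k i) d (zoom t i y) = zoom (nth Leaf h j) c (zoom s j x)].
Proof.
move=> E szh szk Ej Ec lti ltd Eoff y.
have Ex : pos x (graft s h) = rleaves (take j h) + c by rewrite (pos_graft Ej) // Ec.
have Ey : pos y (graft t k) = rleaves (take i k) + d by rewrite gam_pos // Ex.
have [Ei Ed] := (pos_graftP y szk lti ltd).1 Ey.
split => //; rewrite -(zoom_graft szk Ei Ed) -(zoom_graft szh Ej Ec).
by rewrite Eoff; apply: gam_zoom.
Qed.

Definition fixes_ends g t :=
  forall x, pos x t = 0 \/ pos x t = (leaves t).-1 -> act g x = x.

Lemma pos_graft0 x t h : size h = leaves t -> pos x (graft t h) = 0 ->
  pos x t = 0.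
Proof.
move=> szh; rewrite (pos_graft erefl) //; have := pos_lt x t.
case: (pos x t) => // p ltp.
have lt0 : 0 < size h by lia.
have := rleaves_take_le h (ltn0Sn p).
rewrite rleaves_takeS // take0; have := leaves_gt0 (nth Leaf h 0).
rewrite /rleaves /=; lia.
Qed.

Lemma pos_graft_last x t h : size h = leaves t ->
  pos x (graft t h) = (leaves (graft t h)).-1 -> pos x t = (leaves t).-1.
Proof.
move=> szh; rewrite (pos_graft erefl) // leaves_graft //.
set p := pos x t; set w := nth _ _ _.
have ltp : p < leaves t := pos_lt x t; have ltw := pos_lt (zoom t p x) w.
rewrite (rleavesE (h := h) (i := p)) ?szh // -/w => E.
have : rleaves (drop p.+1 h) = 0 by lia.
case: (ltnP p.+1 (leaves t)) => [lt|]; last by lia.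
rewrite (drop_nth Leaf) ?szh // rleaves_cons.
by have := leaves_gt0 (nth Leaf h p.+1); lia.
Qed.

Lemma fixes_ends_graft g t h : size h = leaves t ->
  fixes_ends g t -> fixes_ends g (graft t h).
Proof.
move=> szh gt x [E|E]; apply: gt; [left; exact: pos_graft0 E|right].
exact: pos_graft_last E.
Qed.

Lemma fixes_ends_eq g t s : tree_eq t s -> fixes_ends g t -> fixes_ends g s.
Proof.
by move=> E gt x Ex; apply: gt; rewrite (pos_eq x E) (tree_eq_leaves E).
Qed.

Lemma pos_min t : pos (limit_min F) t = 0.
Proof.
(* [limit_min] comes from a choice, so its coordinates are not known. The family of leftmost leaves
   is rebuilt and compared with it on a large tree above [t]. *)
pose a (v : fs_tree F) : 'I_(tag v) := Ordinal (tree_gt0 v).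
have [v m f|y Ey] := @coherentP F a.
  have [i Ei] := leafroot_onto f (a v).
  have le0 : leafroot f (a (extend f)) <= a v by rewrite -Ei leafroot_homo.
  by apply/val_inj/eqP; rewrite -leqn0.
have [t0 le0] := limit_minP y.
have [v [/le0 + [m [f Ev]]]] := tree_directed oreF t0 (mktree (tr (erefl (leaves t)))).
subst v; rewrite Ey /= leqn0 => /eqP E0.
have [h [[szh Eh] Ef]] := clsW f; have El : leaves (graft t h) = m by rewrite leaves_graft.
apply: (@pos_graft0 _ _ h) => //; rewrite -(posE _ El) -[RHS]E0.
by rewrite Ef /extend /= (comp_tr _ _ El).
Qed.

Lemma pos_max t : pos (limit_max F) t = (leaves t).-1.
Proof.
have lt_pred (v : fs_tree F) : (tag v).-1 < tag v by rewrite prednK ?tree_gt0.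
pose a (v : fs_tree F) : 'I_(tag v) := Ordinal (lt_pred v).
have le_a (v : fs_tree F) (i : 'I_(tag v)) : i <= a v by rewrite /= -ltnS prednK ?tree_gt0.
have [v m f|y Ey] := @coherentP F a.
  have [i Ei] := leafroot_onto f (a v).
  have le_t : a v <= leafroot f (a (extend f)).
    by rewrite -Ei; apply: leafroot_homo; exact: (le_a (extend f)).
  by apply/val_inj/eqP; rewrite eqn_leq le_a.
have [t0 le0] := limit_maxP y.
have [v [/le0 + [m [f Ev]]]] := tree_directed oreF t0 (mktree (tr (erefl (leaves t)))).
subst v; rewrite Ey /= => leE.
have [h [[szh Eh] Ef]] := clsW f; have El : leaves (graft t h) = m by rewrite leaves_graft.
apply: (@pos_graft_last _ _ h) => //.
apply/eqP; rewrite eqn_leq; apply/andP; split.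
  by have := pos_lt (limit_max F) (graft t h); lia.
rewrite -(posE _ El) El; move: leE.
by rewrite Ef /extend /= (comp_tr _ _ El).
Qed.

Lemma group_KoP g : group_Ko oreF g <->
  FSgroup oreF g /\ exists t, forall x, pos x t = 0 -> act g x = x.
Proof.
split=> -[gG] H; split=> //.
  by have [t tP] := (near_cone oreF _ _).1 H; exists t => x; rewrite -(pos_min t); apply: tP.
by apply/(near_cone oreF); have [t tP] := H; exists t => x; rewrite pos_min; apply: tP.
Qed.

Lemma group_KomegaP g : group_Komega oreF g <->
  FSgroup oreF g /\ exists t, forall x, pos x t = (leaves t).-1 -> act g x = x.
Proof.
split=> -[gG] H; split=> //.
  by have [t tP] := (near_cone oreF _ _).1 H; exists t => x; rewrite -(pos_max t); apply: tP.
by apply/(near_cone oreF); have [t tP] := H; exists t => x; rewrite pos_max; apply: tP.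
Qed.

Lemma group_KP g : group_K oreF g <-> FSgroup oreF g /\ exists t, fixes_ends g t.
Proof.
split=> [[/group_KoP[gG [t tP]] /group_KomegaP[_ [s sP]]]|[gG [t tP]]]; last first.
  by split; [apply/group_KoP|apply/group_KomegaP]; split => //; exists t => x Ex;
     apply: tP; [left|right].
split=> //; have [h [k [szh szk E]]] := tree_directed2 oreF t s.
exists (graft t h) => x [Ex|Ex]; first by apply: tP; exact: pos_graft0 Ex.
apply: sP; apply: (@pos_graft_last _ _ k) => //.
by rewrite -(pos_eq _ E) -(tree_eq_leaves E).
Qed.

End GroupG.

(** * Compression by elements of K *)

Section Compress.
Variables (F : fs_category) (oreF : ore F).
Local Notation T := (ctree (colour F)).
Local Notation GV := (FSgroupV oreF).
Local Notation C := (limit_space F).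
Local Open Scope group_scope.
Implicit Types (t s u v w : T) (h k f : seq T) (x y z : C) (i j c : nat) (g : GV).

Lemma tree_of_size n : exists w : T, leaves w = n.+1.
Proof.
have [e] := colour_inhabited F.
elim: n => [|n [w Ew]]; first by exists Leaf.
by exists (Node e w Leaf); rewrite /= Ew addn1.
Qed.

(** This shows that an element built from different trees [s] and [t] is the identity near an end,
    by comparing both in a common refinement. *)
Lemma same_point s t f h x y i j c d :
  size f = leaves s -> size h = leaves t -> tree_eq (graft s f) (graft t h) ->
  pos x s = j -> pos (zoom s j x) (nth Leaf f j) = c ->
  pos y t = i -> pos (zoom t i y) (nth Leaf h i) = d ->
  rleaves (take i h) + d = rleaves (take j f) + c ->
  zoom (nth Leaf h i) d (zoom t i y) = zoom (nth Leaf f j) c (zoom s j x) ->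
  y = x.
Proof.
move=> szf szh E Ej Ec Ei Ed Eoff Ezoom.
have Ex : pos x (graft s f) = rleaves (take j f) + c by rewrite (pos_graft Ej) ?Ec.
have Ey : pos y (graft t h) = rleaves (take i h) + d by rewrite (pos_graft Ei) ?Ed.
apply: (zoom_inj oreF (v := graft t h) Ey).
  by rewrite -(pos_eq x E) Ex Eoff.
rewrite (zoom_graft szh Ei Ed) Ezoom -(zoom_graft szf Ej Ec) Eoff.
exact: zoom_eq.
Qed.

(* An element of K carrying the d consecutive leaves of s from j on, by zooming, to the
   d leaves of the copy of w hanging at the leaf i of t. *)
Lemma band_map s t i w j d :
  leaves w = d -> 1 < j -> j + d + 2 <= leaves s -> 1 < i -> i + 3 <= leaves t ->
  exists2 g, group_K oreF g & forall x c, c < d ->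
    (pos x s = j + c <->
       pos (act g x) t = i /\ pos (zoom t i (act g x)) w = c) /\
    (pos x s = j + c ->
       zoom w c (zoom t i (act g x)) = zoom s (j + c) x).
Proof.
(* From here on [j] and [i] are the original indices minus 2; the two leaves on their left receive
   the end tree and a filler. *)
case: j => [|[|j]] //; case: i => [|[|i]] // Ew _ les _ let_.
have [f [h [szf szh E]]] := tree_directed2 oreF s t.
(* The end trees are those of the common refinement: the extreme leaves of the two glued trees are
   then the same cones, on which the element is the identity. *)
pose f0 := nth Leaf f 0; pose fl := nth Leaf f (leaves s).-1.
pose h0 := nth Leaf h 0; pose hl := nth Leaf h (leaves t).-1.
pose p := leaves s - 4; pose q := leaves t - i - 5.
(* Only the leaf counts of the fillers matter: [A1] and [B1] balance what lies to the left of the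
   band, [A2] and [B2] what lies to its right. *)
have [A1 EA1] := tree_of_size (leaves h0 + i).
have [B1 EB1] := tree_of_size (leaves f0 + j).
have [A2 EA2] := tree_of_size (leaves hl + q).
have [B2 EB2] := tree_of_size (leaves fl + (leaves s - j - d - 4)).
pose A0 := f0 :: A1 :: nseq p Leaf ++ [:: A2].
pose B0 := h0 :: B1 :: nseq i Leaf ++ w :: nseq q Leaf ++ [:: B2].
pose A := rcons A0 fl; pose B := rcons B0 hl.
have szA0 : size A0 = (leaves s).-1.
  by rewrite /A0 /= size_cat /= size_nseq /p; lia.
have szB0 : size B0 = (leaves t).-1.
  by rewrite /B0 /= size_cat /= size_cat /= !size_nseq /q; lia.
have szA : size A = leaves s by rewrite size_rcons szA0; lia.
have szB : size B = leaves t by rewrite size_rcons szB0; lia.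
have rlA0 : rleaves A0 = leaves f0 + leaves A1 + p + leaves A2.
  by rewrite /A0 !rleaves_cons rleaves_cat rleaves_nseq rleaves_seq1; lia.
have rlB0 : rleaves B0 = leaves h0 + leaves B1 + i + d + q + leaves B2.
  rewrite /B0 !rleaves_cons rleaves_cat rleaves_cons rleaves_cat !rleaves_nseq.
  by rewrite rleaves_seq1 Ew; lia.
have rlA : rleaves A = rleaves A0 + leaves fl.
  by rewrite /A -cats1 rleaves_cat rleaves_seq1.
have rlB : rleaves B = rleaves B0 + leaves hl.
  by rewrite /B -cats1 rleaves_cat rleaves_seq1.
have Etot : rleaves B0 + leaves hl = rleaves A0 + leaves fl.
  by rewrite rlA0 rlB0 EA1 EA2 EB1 EB2 /p /q; lia.
have EAB : leaves (graft t B) = leaves (graft s A).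
  by rewrite !leaves_graft // rlA rlB.
pose g := gam oreF (graft t B) (graft s A).
exists g.
  apply/group_KP; split.
    by apply/FSgroupP; exists (graft t B), (graft s A).
  exists (graft s f) => x [Ex|Ex].
    have Es : pos x s = 0 by exact: pos_graft0 Ex.
    have Ef0 : pos (zoom s 0 x) f0 = 0.
      by move: Ex; rewrite (pos_graft Es) // take0.
    have [Ei Ed Ez] := gam_blocks oreF EAB szA szB Es Ef0
      (i := 0) (d := 0) ltac:(lia) (leaves_gt0 h0) erefl.
    by apply: (same_point szf szh E Es Ef0 Ei Ed); rewrite ?take0.
  have Es : pos x s = (leaves s).-1 by exact: pos_graft_last Ex.
  have rlf : rleaves f = rleaves (take (leaves s).-1 f) + leaves fl.
    rewrite (rleavesE (i := (leaves s).-1)) ?szf; last by lia.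
    by rewrite drop_oversize ?szf ?addn0 //; lia.
  have rlh : rleaves h = rleaves (take (leaves t).-1 h) + leaves hl.
    rewrite (rleavesE (i := (leaves t).-1)) ?szh; last by lia.
    by rewrite drop_oversize ?szh ?addn0 //; lia.
  have Efh : rleaves f = rleaves h.
    by rewrite -(leaves_graft szf) -(leaves_graft szh) (tree_eq_leaves E).
  have gt0fl := leaves_gt0 fl; have gt0hl := leaves_gt0 hl.
  have EAl : nth Leaf A (leaves s).-1 = fl by rewrite /A nth_rcons szA0 ltnn eqxx.
  have EBl : nth Leaf B (leaves t).-1 = hl by rewrite /B nth_rcons szB0 ltnn eqxx.
  have Efl : pos (zoom s (leaves s).-1 x) fl = (leaves fl).-1.
    by move: Ex; rewrite (pos_graft Es) // leaves_graft // -/fl rlf; lia.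
  have EtA : take (leaves s).-1 A = A0 by rewrite /A -cats1 take_size_cat.
  have EtB : take (leaves t).-1 B = B0 by rewrite /B -cats1 take_size_cat.
  have := gam_blocks oreF EAB szA szB Es (i := (leaves t).-1) (d := (leaves hl).-1).
  rewrite EAl EBl EtA EtB => /(_ _ Efl) [|||Ei Ed Ez]; try lia.
  apply: (same_point szf szh E Es Efl Ei Ed) => //; move: Efh; rewrite rlf rlh; lia.
move=> x c ltc.
have EAj : nth Leaf A (j.+2 + c) = Leaf.
  rewrite /A nth_rcons szA0; case: ifP => [_|]; last by lia.
  by rewrite /A0 addSn /= nth_cat size_nseq ifT ?nth_nseq ?if_same // /p; lia.
have EBi : nth Leaf B i.+2 = w.
  rewrite /B nth_rcons szB0; case: ifP => [_|]; last by lia.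
  by rewrite /B0 /= nth_cat size_nseq ltnn subnn.
have EtA : rleaves (take (j.+2 + c) A) = leaves f0 + leaves A1 + j + c.
  rewrite /A -cats1 takel_cat ?szA0; last by lia.
  rewrite /A0 addSn /= !rleaves_cons takel_cat ?size_nseq /p; last by lia.
  by rewrite take_nseq ?rleaves_nseq; lia.
have EtB : rleaves (take i.+2 B) = leaves h0 + leaves B1 + i.
  rewrite /B -cats1 takel_cat ?szB0; last by lia.
  rewrite /B0 /= !rleaves_cons takel_cat ?size_nseq //.
  by rewrite take_nseq ?rleaves_nseq; lia.
have ltj : j.+2 + c < leaves s by lia.
have lti : i.+2 < leaves t by lia.
have dir : pos x s = j.+2 + c -> [/\ pos (act g x) t = i.+2,
   pos (zoom t i.+2 (act g x)) w = c & zoom w c (zoom t i.+2 (act g x)) = zoom s (j.+2 + c) x].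
  move=> Ej.
  have E0 : pos (zoom s (j.+2 + c) x) Leaf = 0.
    by have := pos_lt (zoom s (j.+2 + c) x) (@Leaf (colour F)); rewrite /=; lia.
  have := gam_blocks oreF EAB szA szB Ej (c := 0) (i := i.+2) (d := c).
  rewrite EAj EBi EtA EtB Ew zoom_Leaf => /(_ E0) [|||Ei Ed Ez] //.
  by rewrite EA1 EB1; lia.
split; last by move=> /dir[].
split=> [/dir[]//|[Ei Ec]].
have Ey : pos (act g x) (graft t B) = rleaves (take i.+2 B) + c.
  by rewrite (pos_graft Ei) // EBi Ec.
move: Ey; rewrite gam_pos // => Ex.
have := (@pos_graftP _ s x A (j.+2 + c) 0 szA ltj).
rewrite EAj EtA => /(_ isT) [+ _]; case=> //.
by rewrite Ex EtB EA1 EB1; lia.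
Qed.

Definition band t x : Prop := 0 < pos x t < (leaves t).-1.

Lemma fixes_endsE g t : fixes_ends g t <-> forall x, ~ band t x -> act g x = x.
Proof.
split=> gt x Ex; apply: gt; last by rewrite /band; case: Ex => ->; lia.
by move/negP: Ex; have := pos_lt x t; rewrite /band; lia.
Qed.

Lemma band_graft t h x : size h = leaves t -> band t x -> band (graft t h) x.
Proof.
move=> szh bx; have ltp := pos_lt x (graft t h).
have n0 : pos x (graft t h) <> 0.
  by move=> /(pos_graft0 szh) E; move: bx; rewrite /band E.
have nl : pos x (graft t h) <> (leaves (graft t h)).-1.
  by move=> /(pos_graft_last szh) E; move: bx; rewrite /band E ltnn andbF.
by rewrite /band; lia.
Qed.

Lemma band_eq t s x : tree_eq t s -> band t x -> band s x.
Proof. by move=> E; rewrite /band (pos_eq x E) (tree_eq_leaves E). Qed.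

(* Refining the first and the last leaf of t leaves room on both sides of band t. *)
Lemma band_room t n : exists s (e : nat), [/\ n <= e, n + leaves t + e <= leaves s &
  forall x c, 0 < c < (leaves t).-1 ->
    (pos x t = c <-> pos x s = e + c) /\ (pos x t = c -> zoom t c x = zoom s (e + c) x)].
Proof.
have [w Ew] := tree_of_size n.
(* A tree with one leaf has an empty band, and any large [s] will do. *)
have [one|two] := leqP (leaves t) 1.
  have [s Es] := tree_of_size (n + leaves t + n).
  exists s, n; split; [by []|by lia|move=> x c; lia].
pose h := w :: rcons (nseq (leaves t - 2) Leaf) w.
have szh : size h = leaves t by rewrite /= size_rcons size_nseq; lia.
have Eh : rleaves h = leaves t + n + n.
  by rewrite rleaves_cons -cats1 rleaves_cat rleaves_nseq rleaves_seq1; lia.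
exists (graft t h), n; split => //; first by rewrite leaves_graft // Eh; lia.
move=> x c Hc; have ltc : c < leaves t by lia.
have Enth : nth Leaf h c = Leaf.
  case: c Hc ltc => // c Hc _; rewrite /= nth_rcons size_nseq nth_nseq.
  by rewrite !ifT //; lia.
have Etake : rleaves (take c h) = n + c.
  case: c Hc ltc {Enth} => // c Hc _; rewrite /= rleaves_cons -cats1.
  by rewrite takel_cat ?size_nseq ?take_nseq ?rleaves_nseq; lia.
have E0 z : pos z Leaf = 0.
  by have := pos_lt z (@Leaf (colour F)); rewrite /=; lia.
split=> [|Ec].
  have := @pos_graftP F t x h c 0 szh ltc; rewrite Enth Etake addn0 => /(_ isT) ->.
  by split=> [->|[]].
have := zoom_graft szh Ec; rewrite Enth => /(_ _ (E0 _)).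
by rewrite Etake addn0 zoom_Leaf.
Qed.

(** The tree hung at the leaf [i] of [u] is [t] itself, which has exactly the leaves needed to
    receive its own band. *)
Lemma compress t u i : 1 < i -> i + 3 <= leaves u ->
  exists2 g, group_K oreF g & forall x, band t x -> pos (act g x) u = i.
Proof.
move=> i1 i3; have [s [e [le_e le_s Hs]]] := band_room t 2.
have [g Kg gP] := band_map (s := s) (t := u) (i := i) (w := t) (j := e) erefl
  le_e ltac:(lia) i1 i3.
exists g => // x bx; have [Ex _] := Hs x (pos x t) bx.
have ltp := pos_lt x t.
by have [[/(_ (Ex.1 erefl)) []]] := gP x (pos x t) ltp.
Qed.

End Compress.

(** * The group G^T and faithfulness *)

Section Cyclic.
Local Open Scope group_scope.

Lemma cycle_permX l n (i : 'I_l) : (cycle_perm l ^+ n) i = (i + n) %% l :> nat.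
Proof.
elim: n => [|n IHn]; first by rewrite expg0 perm1 addn0 modn_small.
by rewrite expgSr permM permE /= IHn -addn1 modnDml addn1 addnS.
Qed.

(** Rotating the blocks by one brings the last block to the front, so every leaf is shifted by the
    size of that block. Hence cyclic permutations stay cyclic under refinement, and [FSgroupT] is
    closed under products. *)
Lemma block_perm_cycle l m (s : shp l m) :
  block_perm (cycle_perm l) s = cycle_perm m ^+ nth 0 s l.-1.
Proof.
apply/permP => i; apply: val_inj => /=.
have [j [c [ltc Ei]]] := blockP s i.
rewrite (block_permE _ ltc Ei) cycle_permX.
have Eperm : exists s' e, s = rcons s' e :> seq nat /\
    perm_shp (cycle_perm l) s = e :: s' :> seq nat.
  have := size_shp s; case/lastP Es: (shp_seq s) => [|s' e] szs.
    by have := leq_trans (ltn_ord j) (eq_leq (esym szs)).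
  exists s', e; split => //; rewrite size_rcons in szs.
  apply: (@eq_from_nth_ord _ 0 l) => [||k]; [exact: size_shp|by []|].
  rewrite -(permKV (cycle_perm l) k) nth_perm_shp Es.
  move: (_ k) => {}k; rewrite permE /= nth_rcons.
  move: (nat_of_ord k) (ltn_ord k) => {}k; rewrite -[X in k < X]szs ltnS leq_eqVlt => /orP[/eqP Ek|ltk].
    by rewrite Ek ltnn eqxx -szs modnn.
  by rewrite ltk modn_small // -szs.
have [s' [e [Es Es']]] := Eperm.
have sz : (size s').+1 = l by rewrite -(size_shp s) Es size_rcons.
have sm : sumn s' + e = m by rewrite -(sumn_shp s) Es sumn_rcons.
have -> : nth 0 s l.-1 = e by rewrite Es nth_rcons -sz /= ltnn eqxx.
rewrite Ei /flatten_index Es' permE /= Es.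
move: (nat_of_ord j) (ltn_ord j) ltc => {Ei}j ltj ltc; move: ltj.
rewrite -[X in j < X]sz ltnS leq_eqVlt => /orP[/eqP Ej|ltj].
  rewrite Ej -sz modnn /= -cats1 take_size_cat //.
  have -> : sumn s' + c + e = c + m by lia.
  rewrite modnDr modn_small //; move: ltc; rewrite Es Ej nth_rcons ltnn eqxx; lia.
rewrite modn_small -?sz //= -cats1 takel_cat ?(ltnW ltj) //.
have lt : sumn (take j s') + c < sumn s'.
  rewrite -{2}(cat_take_drop j s') sumn_cat ltn_add2l.
  rewrite (drop_nth 0) //=; move: ltc; rewrite Es nth_rcons ltj; lia.
rewrite modn_small; lia.
Qed.

Section GroupT.
Variables (F : fs_category) (oreF : ore F).
Local Notation GV := (FSgroupV oreF).

Lemma leafperm_cyclic l m (a : 'S_l) (f : forest F l m) :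
  a \in <[cycle_perm l]> -> leafperm a f \in <[cycle_perm m]>.
Proof.
move=> /cycleP[n ->]; elim: n f => [|n IHn] f.
  by rewrite expg0 leafperm1 group1.
rewrite expgSr leafpermM groupM // /leafperm block_perm_cycle.
exact: mem_cycle.
Qed.

Lemma FSgroupT_rep (g : GV) : FSgroupT oreF g ->
  exists l (t s : forest F 1 l) (a : 'S_l),
    a \in <[cycle_perm l]> /\ g = frac oreF (t, a) (forestV s).
Proof.
move=> [l [[t a] [[s b] [/= ca cb ->]]]]; exists l, t, s, (b^-1 * a).
split; first by rewrite groupM ?groupV.
by rewrite -(frac_comp oreF _ _ (idf F l, b^-1)) !vcomp_perm mulVg.
Qed.

Lemma FSgroupTP (g : GV) : FSgroupT oreF g <->
  exists l (t s : forest F 1 l) (a : 'S_l),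
    a \in <[cycle_perm l]> /\ g = frac oreF (t, a) (forestV s).
Proof.
split=> [|[l [t [s [a [ca ->]]]]]]; first exact: FSgroupT_rep.
by exists l, (t, a), (forestV s); split => //=; rewrite group1.
Qed.

Lemma FSgroupT_subgroup : is_subgroup (FSgroupT oreF).
Proof.
split.
- exists 1%N, (forestV (idf F 1)), (forestV (idf F 1)).
  by rewrite /= group1.
- move=> g g' /FSgroupTP[l [t [s [a [ca ->]]]]] /FSgroupTP[l' [t' [s' [a' [ca' ->]]]]].
  have [m [h [k E]]] := proj2 oreF 1%N _ _ s t' isT.
  rewrite -(frac_comp oreF _ (forestV s) (forestV h)).
  rewrite -(frac_comp oreF _ (forestV s') (straight a' k)) vcomp_straight.
  rewrite -forestV_comp E.
  exists m, (vcomp (t, a) (forestV h)), (vcomp (forestV s') (straight a' k)).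
  split; last exact: frac_mulE.
    by rewrite /= mul1g; exact: leafperm_cyclic.
  by rewrite /= leafperm1 mulg1 groupV; apply: leafperm_cyclic.
- move=> g [l [x [y [cx cy ->]]]]; exists l, y, x; split => //.
  exact: frac_invE.
Qed.

Lemma FSgroup_sub_T (g : GV) : FSgroup oreF g -> FSgroupT oreF g.
Proof.
by move=> [l [t [s ->]]]; exists l, (forestV t), (forestV s); rewrite /= !group1.
Qed.

End GroupT.
End Cyclic.

(** * Continuity, density of the orbit of the minimum, and faithfulness *)

Section Dynamics.
Variables (F : fs_category) (oreF : ore F).
Local Notation T := (ctree (colour F)).
Local Notation GV := (FSgroupV oreF).
Local Notation C := (limit_space F).
Local Open Scope group_scope.
Implicit Types (t s u v w : T) (h k f : seq T) (x y z : C) (i j c : nat) (g : GV).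

Lemma act_rep g : exists l t s (Et : leaves t = l) (Es : leaves s = l) (a : 'S_l),
  g = frac oreF (tr Et, a) (forestV (tr Es)).
Proof.
have [m [k [a [s ->]]]] := frac_rep g (idf F 1).
have [t [Et ->]] := trW (Defs.comp (idf F 1) k); have [u [Eu ->]] := trW s.
by exists m, t, u, Et, Eu, a.
Qed.

Lemma act_rep_refine g v : exists l h s (szh : size h = leaves v)
    (Et : leaves (graft v h) = l) (Es : leaves s = l) (a : 'S_l),
  g = frac oreF (tr Et, a) (forestV (tr Es)).
Proof.
have [m [k [a [s ->]]]] := frac_rep g (tr (erefl (leaves v))).
have [h [[szh Eh] ->]] := clsW k; have [u [Eu ->]] := trW s.
have Et : leaves (graft v h) = m by rewrite leaves_graft.
by exists m, h, u, szh, Et, Eu, a; rewrite (comp_tr _ _ Et).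
Qed.

(** Write [g] with a first tree refining [u]; its second tree serves as [v]. *)
Lemma act_cont g u : exists v, forall x y, pos x v = pos y v ->
  pos (act g x) u = pos (act g y) u.
Proof.
have [l [h [s [szh [Et [Es [a ->]]]]]]] := act_rep_refine g u.
exists s => x y Exy; apply: (pos_uniq2 szh).
have ltx : pos x s < l by rewrite -Es pos_lt.
have Ex : pos x s = Ordinal ltx by [].
have Ey : pos y s = Ordinal ltx by rewrite -Exy.
by rewrite (act_pos oreF Et Es a Ex) (act_pos oreF Et Es a Ey).
Qed.

Lemma rotation t i : i < leaves t -> exists g, FSgroupT oreF g /\
  forall x, pos (act g x) t = (pos x t + i) %% leaves t.
Proof.
move=> lti; exists (frac oreF (tr (erefl (leaves t)), cycle_perm _ ^+ i)
                             (forestV (tr (erefl (leaves t))))).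
split; first by apply/FSgroupTP; do 4 eexists; split; last by []; exact: mem_cycle.
move=> x; have Ex : pos x t = Ordinal (pos_lt x t) by [].
by rewrite (act_pos oreF _ _ _ Ex) cycle_permX.
Qed.

Lemma cone_point t i : i < leaves t -> exists g, FSgroupT oreF g /\
  pos (act g (limit_min F)) t = i.
Proof.
move=> /[dup] lti /rotation[g [Tg gP]]; exists g; split => //.
by rewrite gP pos_min // modn_small.
Qed.

Lemma separation x y : x <> y -> exists t, pos x t <> pos y t.
Proof.
move=> neq; apply: contrapT => H; apply: neq; apply: pos_ext => t.
by apply: contrapT => nE; apply: H; exists t.
Qed.

(** The cone is so small that its image stays at the leaf of [act g x] in a tree separating
    [act g x] from [x]. *)
Lemma moved_cone g x : act g x <> x -> exists v, forall y z,
  pos y v = pos x v -> pos z v = pos x v -> act g y <> z.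
Proof.
move=> /separation[u nE]; have [v vP] := act_cont g u.
have [h [k [szh szk E]]] := tree_directed2 oreF u v.
exists (graft u h) => y z Ey Ez Eyz; apply: nE.
have Eyv : pos y v = pos x v.
  by apply: (pos_uniq2 szk); rewrite -!(pos_eq _ E).
by rewrite -(vP _ _ Eyv) Eyz; exact: (pos_uniq2 szh).
Qed.

Lemma kernel_sub_G g : (forall x, act g x = x) -> FSgroup oreF g.
Proof.
have [l [t [s [Et [Es [a ->]]]]]] := act_rep g => triv.
suff -> : a = 1 by exists l, (tr Et), (tr Es).
(* Every leaf contains a point. As nothing moves, a point at the leaf [i] of [s] is at the leaf
   [a i] of [t], and a common refinement lists the blocks of both trees in the same order. *)
have mono (i j : 'I_l) : i < j -> a i < a j.
  move=> lt_ij; have [lti ltj] : i < leaves s /\ j < leaves s by rewrite Es.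
  have [gi [_ Ei]] := cone_point lti; have [gj [_ Ej]] := cone_point ltj.
  set x := act gi _ in Ei; set y := act gj _ in Ej.
  have Eai := act_pos oreF Et Es a Ei; have Eaj := act_pos oreF Et Es a Ej.
  rewrite triv in Eai; rewrite triv in Eaj.
  have [h [k [szh szk E]]] := tree_directed2 oreF s t.
  have := pos_block x szh; have := pos_block y szh.
  have := pos_block x szk; have := pos_block y szk.
  rewrite -!(pos_eq _ E) Eai Eaj Ei Ej.
  have := rleaves_take_le h lt_ij.
  case: (ltngtP (a i) (a j)) => // [lt|/val_inj/perm_inj eq_ij]; last first.
    by rewrite eq_ij ltnn in lt_ij.
  have := rleaves_take_le k lt; lia.
have ge n (i : 'I_l) : i = n :> nat -> n <= a i.
  elim: n i => [//|n IHn] i Ei.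
  have ltn : n < l by rewrite ltnW // -Ei.
  by apply: leq_ltn_trans (IHn (Ordinal ltn) erefl) _; apply: mono; rewrite /= Ei.
have le n (i : 'I_l) : l - i.+1 = n -> a i <= i.
  elim: n i => [|n IHn] i Ei; first by have := ltn_ord (a i); have := ltn_ord i; lia.
  have lti : i.+1 < l by lia.
  have := IHn (Ordinal lti); rewrite /= => /(_ ltac:(lia)).
  by move=> le1; rewrite -ltnS; exact: leq_trans (mono i (Ordinal lti) (ltnSn i)) le1.
apply/permP => i; apply: val_inj; rewrite perm1; apply/eqP.
by rewrite eqn_leq (le _ _ erefl) (ge _ _ erefl).
Qed.

Definition effective := forall g, (forall x, act g x = x) -> g = 1.

Lemma G_fixes_min g : FSgroup oreF g -> act g (limit_min F) = limit_min F.
Proof.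
move=> /FSgroupP[t [s [E ->]]]; apply: (zoom_inj oreF (v := t) (i := 0)).
- by rewrite gam_pos // pos_min.
- by rewrite pos_min.
rewrite gam_zoom ?pos_min //; apply: pos_ext => w; apply: (@addnI 0).
by rewrite !pos_zoom ?pos_min.
Qed.

Lemma G_fixes_max g : FSgroup oreF g -> act g (limit_max F) = limit_max F.
Proof.
move=> /FSgroupP[t [s [E ->]]]; have Et := pos_max oreF t; have Es := pos_max oreF s.
have lti : (leaves t).-1 < leaves t by rewrite prednK ?leaves_gt0.
apply: (zoom_inj oreF (v := t) _ Et); first by rewrite gam_pos // Es E.
rewrite gam_zoom ?Es ?E //; apply: pos_ext => w; apply: (@addnI (leaves s).-1).
by rewrite !pos_zoom ?Es -?E // !pos_max // E !leaves_graft ?size_insert -?E.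
Qed.

Lemma faithfulP :
  faithful_on_cosets (FSgroup oreF) (FSgroupT oreF) (FSgroup oreF) <-> effective.
Proof.
have [G1 GM GV_] := FSgroup_subgroup oreF.
split=> [faith g triv|eff g Gg gP].
  apply: faith; first exact: kernel_sub_G.
  move=> A [h Th <-]; apply/seteqP; split.
    (* The conjugate of [g] by [h] acts trivially too, so it lies in [G] and is absorbed by the
       coset of [h]. *)
    move=> _ [_ [b Gb <-] <-]; exists (h^-1 * (g * h) * b).
      apply: GM => //; apply: kernel_sub_G => x.
      by rewrite !act_mul triv actK.
    by rewrite !mulgA mulgV mul1g.
  move=> _ [b Gb <-]; exists (g^-1 * (h * b)); last by rewrite mulgA mulgV mul1g.
  exists (h^-1 * (g^-1 * (h * b))); last by rewrite !mulgA mulgV mul1g.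
  rewrite !mulgA; apply: GM => //; apply: kernel_sub_G => x.
  by rewrite !act_mul -{1}(triv (act h x)) !actK.
(* With [h] bringing the minimum into a displaced cone, a fixed coset would give [g * h = h * b]
   with [b] in [G]; since [b] fixes the minimum, [g] would fix a point of that cone. *)
apply: eff => x; apply: contrapT => /moved_cone[v vP].
have [h [Th Eh]] := cone_point (pos_lt x v).
apply: (vP _ (act h (limit_min F)) Eh Eh).
have Ch : left_cosets (FSgroupT oreF) (FSgroup oreF) (left_coset h (FSgroup oreF)).
  by exists h.
have : left_coset g (left_coset h (FSgroup oreF)) (g * h).
  by exists h => //; exists 1; rewrite ?mulg1.
rewrite gP // => -[b Gb E].
by rewrite -act_mul -E act_mul G_fixes_min.
Qed.

End Dynamics.

(** * Derived subgroups *)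

Section Derived.
Variable Gam : groupType.
Local Open Scope group_scope.
Implicit Types (H N : set Gam) (x y z : Gam).

Definition conj_closed N H := forall n h, N n -> H h -> N (n ^ h).

Lemma derived_is_subgroup H : is_subgroup (derived_subgroup H).
Proof.
split=> [|x y Hx Hy|x Hx] N [sN cN]; have [N1 NM NV] := sN => //.
  by apply: NM; [apply: Hx|apply: Hy].
by apply: NV; apply: Hx.
Qed.

Lemma derived_comm H x y : H x -> H y -> derived_subgroup H [~ x, y].
Proof. by move=> Hx Hy N [_]; apply; exists x => //; exists y. Qed.

Lemma derived_sub H N : is_subgroup N ->
  (forall x y, H x -> H y -> N [~ x, y]) -> derived_subgroup H `<=` N.
Proof. by move=> sN cN x; apply; split => // _ [y Hy [z Hz <-]]; apply: cN. Qed.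

Lemma derived_mono H N : H `<=` N -> derived_subgroup H `<=` derived_subgroup N.
Proof.
move=> HN; apply: derived_sub; first exact: derived_is_subgroup.
by move=> x y /HN Nx /HN; apply: derived_comm.
Qed.

Lemma subgroup_comm H x y : is_subgroup H -> H x -> H y -> H [~ x, y].
Proof.
case=> _ HM HV Hx Hy; exact: (HM _ _ (HV _ Hx) (HM _ _ (HV _ Hy) (HM _ _ Hx Hy))).
Qed.

Lemma derived_le H : is_subgroup H -> derived_subgroup H `<=` H.
Proof. by move=> sH; apply: derived_sub => // x y; exact: subgroup_comm. Qed.

Lemma subgroup_conj H x y : is_subgroup H -> H x -> H y -> H (x ^ y).
Proof. by case=> _ HM HV Hx Hy; exact: (HM _ _ (HV _ Hy) (HM _ _ Hx Hy)). Qed.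

Lemma conj_subgroup H x : is_subgroup H -> is_subgroup [set y | H (y ^ x)].
Proof.
case=> H1 HM HV; split=> /= [|y z Hy Hz|y Hy]; first by rewrite conj1g.
  by rewrite conjMg; apply: HM.
by rewrite conjVg; apply: HV.
Qed.

Lemma derived_normalised H N : conj_closed H N -> conj_closed (derived_subgroup H) N.
Proof.
move=> nHN x h + Nh; have sD := derived_is_subgroup H.
apply: (derived_sub (conj_subgroup h sD)) => y z Hy Hz /=.
by rewrite conjRg; apply: derived_comm; apply: nHN.
Qed.

Lemma commg_normalised N H x n : is_subgroup N -> conj_closed N H ->
  H x -> N n -> N [~ x, n] /\ N [~ n, x].
Proof.
move=> [N1 NM NV] nNH Hx Nn; split; last by apply: NM; [apply: NV|apply: nNH].
have -> : [~ x, n] = (n^-1) ^ x * n by rewrite /commg /conjg !mulgA.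
by apply: NM => //; apply: nNH => //; apply: NV.
Qed.

Lemma commMl x y z : [~ x * y, z] = [~ x, z] ^ y * [~ y, z].
Proof. by rewrite /commg /conjg !invMg !mulgA !mulgK. Qed.

Lemma commMr x y z : [~ x, y * z] = [~ x, z] * [~ x, y] ^ z.
Proof. by rewrite /commg /conjg !invMg !mulgA !mulgK. Qed.

(** Meant for a factor [e] supported away from [x] and [y]: corrections made far away do not affect
    a commutator. *)
Lemma comm_absorbl x y e : commute e x -> commute e y -> [~ x * e, y] = [~ x, y].
Proof.
move=> ex ey; rewrite commMl.
have -> : [~ e, y] = 1 by apply/eqP/commgP.
have xe : commute x e by exact: commute_sym.
have /eqP Exe := introT commgP xe; have ye : commute y e by exact: commute_sym.
have /eqP/conjg_fixP : [~ x, e] = 1 := Exe; have /commgP/conjg_fixP Ey := ye.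
by move/eqP/conjg_fixP: Exe => Ex _; rewrite mulg1 conjRg Ex Ey.
Qed.

Lemma comm_absorbr x y e : commute e x -> commute e y -> [~ x, y * e] = [~ x, y].
Proof. by move=> ex ey; rewrite -invgR comm_absorbl // invgR. Qed.

End Derived.

(** * The double commutator argument *)

Section Supports.
Variables (F : fs_category) (oreF : ore F).
Local Notation T := (ctree (colour F)).
Local Notation GV := (FSgroupV oreF).
Local Notation C := (limit_space F).
Local Open Scope group_scope.
Implicit Types (t s u v w : T) (h k f : seq T) (x y z : C) (i j c : nat).
Implicit Types (a b g : GV) (X Y : set C) (N L : set GV).
Local Notation K := (group_K oreF).
Local Notation K' := (derived_subgroup K).

Lemma fixes_ends_subgroup (H : set GV) : is_subgroup H ->
  is_subgroup [set a | H a /\ exists t, fixes_ends a t].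
Proof.
case=> H1 HM HV; split.
- by split => //; exists Leaf => x _; exact: act1.
- move=> a b [Ha [t ta]] [Hb [s sb]]; split; first exact: HM.
  have [h [k [szh szk E]]] := tree_directed2 oreF t s.
  exists (graft t h) => x Ex; rewrite act_mul.
  rewrite (fixes_ends_eq (tree_eq_sym E) (fixes_ends_graft szk sb)) //.
  exact: (fixes_ends_graft szh ta).
- move=> a [Ha [t ta]]; split; first exact: HV.
  by exists t => x Ex; rewrite -{1}(ta x Ex) actK.
Qed.

Lemma K_subgroup : is_subgroup K.
Proof.
have -> : K = [set a | FSgroup oreF a /\ exists t, fixes_ends a t].
  by apply/predeqP => a; exact: group_KP.
exact/fixes_ends_subgroup/FSgroup_subgroup.
Qed.

Lemma K_sub_G : K `<=` FSgroup oreF.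
Proof. by move=> g /group_KP[]. Qed.

Definition supported a X := forall x, ~ X x -> act a x = x.

Lemma supported_sub a X Y : X `<=` Y -> supported a X -> supported a Y.
Proof. by move=> XY aX x nY; apply: aX => /XY. Qed.

Lemma supportedV a X : supported a X -> supported a^-1 X.
Proof. by move=> aX x nX; rewrite -{1}(aX x nX) actK. Qed.

Lemma supportedM a b X : supported a X -> supported b X -> supported (a * b) X.
Proof. by move=> aX bX x nX; rewrite act_mul bX // aX. Qed.

Lemma supportedJ a g X : supported a X -> supported (a ^ g) [set x | X (act g x)].
Proof. by move=> aX x nX; rewrite /conjg !act_mul aX // actK. Qed.

Lemma supported_stable a X x : supported a X -> X x -> X (act a x).
Proof.
move=> aX Xx; apply: contrapT => nX; have := aX _ nX.
by move/act_inj => E; rewrite E in nX.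
Qed.

Lemma supported_ends a t : fixes_ends a t -> supported a (band t).
Proof. by move/fixes_endsE. Qed.

(** The bounds are those that [compress] requires of each of the [n] leaves; [w] has two leaves in
    front of them and three behind. *)
Lemma subcone v i0 n : i0 < leaves v -> exists u i,
  [/\ 1 < i, i + n + 2 <= leaves u &
      forall x c, c < n -> pos x u = i + c -> pos x v = i0].
Proof.
move=> lti; have [w Ew] := tree_of_size F (n + 4).
exists (graft v (insert (leaves v) i0 w)), (i0 + 2).
have szi := size_insert w lti.
have El : leaves (graft v (insert (leaves v) i0 w)) = (leaves v).-1 + leaves w.
  by rewrite leaves_graft // rleaves_insert.
split; [lia|rewrite El Ew; lia|move=> x c ltc Ex].
apply: (pos_uniq szi); rewrite rleaves_takeS ?szi // rleaves_take_insert.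
by rewrite nth_insert Ex Ew; lia.
Qed.

Lemma common_refinement t s : exists u,
  [/\ band t `<=` band u, band s `<=` band u &
      forall x, pos x u = 0 -> pos x t = 0].
Proof.
have [h [k [szh szk E]]] := tree_directed2 oreF t s.
exists (graft t h); split => [x|x bx|x]; first exact: band_graft.
  by apply: (band_eq (tree_eq_sym E)); exact: band_graft.
exact: pos_graft0.
Qed.

Lemma band_interior t i x : 1 < i -> i + 2 <= leaves t -> pos x t = i -> band t x.
Proof. by rewrite /band => ? ? ->; lia. Qed.

(** The commutator is [g0] times a conjugate of [g0^-1] supported in the first cone of [r]. This
    cone avoids [band t], where the commutator therefore agrees with the compressing element
    [g0]. *)
Lemma compress_derived t u i : 1 < i -> i + 3 <= leaves u ->
  exists2 g, K' g & forall x, band t x -> pos (act g x) u = i.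
Proof.
move=> i1 i3; have [g0 Kg0 g0P] := compress oreF t i1 i3.
have [_ [s sg0]] := (group_KP _).1 Kg0.
have [r [tr sr r0]] := common_refinement t s.
have [v [j [j1 j3 vP]]] := @subcone r 0 1 (leaves_gt0 r).
have [c Kc cP] := compress oreF r (u := v) j1 ltac:(lia).
have [K1 KM KV] := K_subgroup.
exists [~ g0^-1, c^-1]; first by apply: derived_comm; apply: KV.
move=> x bx; rewrite commgEl invgK act_mul.
rewrite (supportedJ (X := band r)) ?g0P //.
  by apply: supportedV; apply: supported_sub (supported_ends sg0).
move=> /= bcx; have := cP _ bcx; rewrite actVK => Ex.
have := vP x 0 isT; rewrite addn0 => /(_ Ex) E0.
by have := tr _ bx; rewrite /band E0.
Qed.

(** Proved without effectiveness, since it also has to separate [K'] from a nontrivial kernel of the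
    action. *)
Lemma derived_K_moves : exists2 g, K' g & exists x, act g x <> x.
Proof.
have [t Et] := tree_of_size F 2.
have [v [j [j1 j3 vP]]] := @subcone t 0 1 (leaves_gt0 t).
have [g Kg gP] := compress_derived t (u := v) j1 ltac:(lia).
exists g => //; have lt1 : (1 < leaves t)%N by rewrite Et.
have [h [_ Eh]] := cone_point oreF lt1.
exists (act h (limit_min F)) => E.
have b : band t (act h (limit_min F)) by rewrite /band Eh Et.
have := gP _ b; rewrite E => Ej.
by have := vP _ 0 isT; rewrite addn0 => /(_ _ Ej); rewrite Eh.
Qed.

Section Effective.
Hypothesis eff : effective oreF.

Lemma act_ext a b : (forall x, act a x = act b x) -> a = b.
Proof.
move=> E; apply: (mulgI b^-1); rewrite mulVg; apply: eff => x.
by rewrite act_mul E actK.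
Qed.

Lemma disjoint_commute a b X Y : supported a X -> supported b Y ->
  (forall x, X x -> Y x -> False) -> commute a b.
Proof.
move=> aX bY dXY; apply: act_ext => x; rewrite !act_mul.
have [Xx|nX] := EM (X x).
  rewrite (bY x) ?(bY (act a x)) // => Yx; apply: dXY Yx => //.
  exact: supported_stable.
rewrite (aX x nX); have [Yx|nY] := EM (Y x); last by rewrite bY // aX.
by rewrite aX // => Xb; apply: dXY Xb _; exact: supported_stable.
Qed.

(* Double commutator argument: if g moves a cone U off itself and a, b are supported in
   U, then [[a^-1, g], b] = [a, b]; compression brings any two elements of L into U,
   after multiplying them by far away conjugates to turn them into commutators. *)
Lemma derived_sub_normalised L N g : is_subgroup L -> K `<=` L ->
  (forall a, L a -> exists t, fixes_ends a t) ->
  is_subgroup N -> conj_closed N (derived_subgroup L) -> N g -> g <> 1 ->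
  derived_subgroup L `<=` N.
Proof.
move=> sL KL Lends sN nN Ng g1; have [N1 NM NV] := sN; have [L1 LM LV] := sL.
apply: derived_sub => // a b La Lb.
have [x0 x0P] : exists x, act g x <> x.
  by apply: contrapT => H; apply: g1; apply: eff => x; apply: contrapT => nE; apply: H; exists x.
have [v vP] := moved_cone x0P.
have [u [i [i1 i3 uP]]] := subcone 1 (pos_lt x0 v).
pose U := [set x | pos x u = i].
have Uv x : U x -> pos x v = pos x0 v.
  by move=> Ux; apply: (uP x 0) => //; rewrite addn0.
have [ta Eta] := Lends a La; have [tb Etb] := Lends b Lb.
have [r [ar br _]] := common_refinement ta tb.
(* Two leaves, [j] for the conjugate of [a^-1] and [j.+1] for that of [b^-1], so that the two
   corrections commute with each other. *)
have [q [j [j1 j3 qP]]] := subcone 2 (leaves_gt0 r).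
have [r1 [rr1 qr1 _]] := common_refinement r q.
have [c Kc cP] := compress oreF r (u := q) j1 ltac:(lia).
have [d Kd dP] := @compress _ oreF r q j.+1 ltac:(lia) ltac:(lia).
have [h K'h hP] := compress_derived r1 (u := u) i1 ltac:(lia).
have sa : supported a (band r) by apply: supported_sub (supported_ends Eta).
have sb : supported b (band r) by apply: supported_sub (supported_ends Etb).
pose ea := (a^-1) ^ c^-1; pose eb := (b^-1) ^ d^-1.
have sea : supported ea [set x | pos x q = j].
  apply: (supported_sub (X := [set x | band r (act c^-1 x)])); last first.
    by apply: supportedJ; exact: supportedV.
  move=> x /= bx.
  by have := cP _ bx; rewrite actVK.
have seb : supported eb [set x | pos x q = j.+1].
  apply: (supported_sub (X := [set x | band r (act d^-1 x)])); last first.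
    by apply: supportedJ; exact: supportedV.
  move=> x /= bx.
  by have := dP _ bx; rewrite actVK.
have dj x : band r x -> pos x q = j -> False.
  move=> bx Ex; have := qP x 0 isT; rewrite addn0 => /(_ Ex) E.
  by rewrite /band E in bx.
have dj1 x : band r x -> pos x q = j.+1 -> False.
  move=> bx Ex; have := qP x 1%N isT; rewrite addn1 => /(_ Ex) E.
  by rewrite /band E in bx.
pose A := a * ea; pose B := b * eb.
(* [N] is only normalised by the derived subgroup of [L], so [A], [B] and the compressing [h] must
   all lie in it. *)
have L'A : derived_subgroup L A.
  rewrite /A -[a]invgK -commgEl; apply: derived_comm; first by apply: LV.
  by apply: LV; apply: KL.
have L'B : derived_subgroup L B.
  rewrite /B -[b]invgK -commgEl; apply: derived_comm; first by apply: LV.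
  by apply: LV; apply: KL.
have cea : commute ea a by apply: (disjoint_commute sea sa) => x /= H1 /dj; apply.
have ceb : commute ea b by apply: (disjoint_commute sea sb) => x /= H1 /dj; apply.
have ceaeb : commute ea eb.
  by apply: (disjoint_commute sea seb) => x /= ->; lia.
have cba : commute eb a by apply: (disjoint_commute seb sa) => x /= H1 /dj1; apply.
have cbb : commute eb b by apply: (disjoint_commute seb sb) => x /= H1 /dj1; apply.
have EAB : [~ A, B] = [~ a, b].
  have ceB : commute ea B by apply: commuteM.
  by rewrite /A comm_absorbl // /B comm_absorbr.
have sA : supported A (band r1).
  apply: supportedM; first exact: supported_sub sa.
  apply: supported_sub sea => x /= Ex; apply: qr1.
  by apply: band_interior Ex; lia.
have sB : supported B (band r1).
  apply: supportedM; first exact: supported_sub sb.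
  apply: supported_sub seb => x /= Ex; apply: qr1.
  by apply: band_interior Ex; lia.
have L'h : derived_subgroup L h by exact: (derived_mono KL K'h).
have sL' := derived_is_subgroup L.
have L'hV : derived_subgroup L h^-1 by have [_ _] := sL'; apply.
pose a2 := A ^ h^-1; pose b2 := B ^ h^-1.
have L'a2 : derived_subgroup L a2 by exact: (subgroup_conj sL' L'A L'hV).
have L'b2 : derived_subgroup L b2 by exact: (subgroup_conj sL' L'B L'hV).
have sa2 : supported a2 U.
  apply: (supported_sub (X := [set x | band r1 (act h^-1 x)])); last exact: supportedJ.
  move=> x /= bx.
  by have := hP _ bx; rewrite actVK.
have sb2 : supported b2 U.
  apply: (supported_sub (X := [set x | band r1 (act h^-1 x)])); last exact: supportedJ.
  move=> x /= bx.
  by have := hP _ bx; rewrite actVK.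
pose e := (a2^-1) ^ g.
have se : supported e [set x | U (act g x)] by apply: supportedJ; apply: supportedV.
have dU x : U (act g x) -> U x -> False.
  by move=> /Uv E1 /Uv E2; exact: (vP x (act g x)).
have ea2 : commute e a2 by exact: (disjoint_commute se sa2 dU).
have eb2 : commute e b2 by exact: (disjoint_commute se sb2 dU).
have Nab2 : N [~ a2, b2].
  rewrite -(comm_absorbl ea2 eb2).
  have -> : a2 * e = [~ a2^-1, g] by rewrite commgEl invgK.
  have [_ NVa2] : True /\ derived_subgroup L a2^-1 by split => //; have [_ _] := sL'; apply.
  have [Nag _] := commg_normalised sN nN NVa2 Ng.
  by have [_] := commg_normalised sN nN L'b2 Nag.
have := nN _ _ Nab2 L'h.
by rewrite conjRg /a2 /b2 -!conjgM mulVg !conjg1 EAB.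
Qed.

End Effective.
End Supports.

(** * The groups G^T and G^V *)

Section BigGroups.
Variables (F : fs_category) (oreF : ore F).
Local Notation T := (ctree (colour F)).
Local Notation GV := (FSgroupV oreF).
Local Notation C := (limit_space F).
Local Open Scope group_scope.
Implicit Types (t s u v w : T) (k f : seq T) (x y z : C) (i j c : nat).
Implicit Types (a b g : GV) (X Y : set C) (N L : set GV).
Local Notation K := (group_K oreF).
Local Notation K' := (derived_subgroup K).

Lemma pos_Leaf x : pos x (@Leaf (colour F)) = 0.
Proof. by have := pos_lt x (@Leaf (colour F)); rewrite /=; lia. Qed.

(** Every element carries some cone onto a cone by zooming, and inside it, away from the ends,
    [band_map] does the same with an element of [K]. *)
Lemma agrees_with_K g : exists2 b, K b & exists v i, (i < leaves v)%N /\
  forall x, pos x v = i -> act b x = act g x.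
Proof.
have [l [t [s [Et [Es [a ->]]]]]] := act_rep g.
(* Five leaves give the leaf 2 of [w] the margins needed by [band_map], even when [j] or [a j] is an
   extreme leaf. *)
have [w Ew] := tree_of_size F 4.
have lt0l : (0 < l)%N by rewrite -Et leaves_gt0.
pose j := Ordinal lt0l.
have ltj : (j < leaves s)%N by rewrite Es.
have ltaj : (a j < leaves t)%N by rewrite Et.
pose s' := graft s (insert (leaves s) j w).
pose t' := graft t (insert (leaves t) (a j) w).
have szs := size_insert w ltj; have szt := size_insert w ltaj.
have Els : leaves s' = l.-1 + 5 by rewrite leaves_graft // rleaves_insert // Ew Es.
have Elt : leaves t' = l.-1 + 5 by rewrite leaves_graft // rleaves_insert // Ew Et.
have ltjl := ltn_ord j; have ltajl := ltn_ord (a j).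
have [b Kb bP] := @band_map _ oreF s' t' (a j + 2) Leaf (j + 2) 1 erefl
  ltac:(lia) ltac:(lia) ltac:(lia) ltac:(lia).
exists b => //; exists s', (j + 2); split=> [|x Ex]; first by lia.
have [E1 E2] := bP x 0 isT; move: E1 E2; rewrite addn0 => E1 E2.
have {E1} [E1 _] := E1.1 Ex; have {}E2 := E2 Ex; rewrite zoom_Leaf in E2.
have lt2 : (2 < leaves w)%N by rewrite Ew.
have := (@pos_graftP _ s x _ j 2 szs ltj).
rewrite nth_insert rleaves_take_insert => /(_ lt2) [/(_ Ex) [Exj Ex2] _].
set y := act (frac _ _ _) x.
have Ey := act_pos oreF Et Es a Exj; have Zy := act_zoom oreF Et Es a Exj.
rewrite -/y in Ey Zy.
have Ey2 : pos (zoom t (a j) y) w = 2 by rewrite Zy.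
have := (@pos_graftP _ t y _ (a j) 2 szt ltaj).
rewrite nth_insert rleaves_take_insert => /(_ lt2) [_ /(_ (conj Ey Ey2)) Eyt'].
apply: (zoom_inj oreF E1 Eyt'); rewrite E2.
have := @zoom_graft _ s x _ j 2 szs Exj.
rewrite nth_insert rleaves_take_insert => /(_ Ex2) ->.
have := @zoom_graft _ t y _ (a j) 2 szt Ey.
rewrite nth_insert rleaves_take_insert => /(_ Ey2) ->.
by rewrite Zy.
Qed.

Definition fixes_cone a := exists v i, (i < leaves v)%N /\
  forall x, pos x v = i -> act a x = x.

Lemma K_fixes_cone a : K a -> fixes_cone a.
Proof.
move=> /group_KP[_ [t ta]]; exists t, 0; split; first exact: leaves_gt0.
by move=> x E; apply: ta; left.
Qed.

Lemma factor_fixes_cone g : exists a b, [/\ K a, fixes_cone b & g = a * b].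
Proof.
have [a Ka [v [i [lti aP]]]] := agrees_with_K g.
exists a, (a^-1 * g); split => //; last by rewrite mulgA mulgV mul1g.
by exists v, i; split => // x Ex; rewrite act_mul -aP // actK.
Qed.

Lemma same_pos_meet u v x : exists r, forall y, pos y r = pos x r ->
  pos y u = pos x u /\ pos y v = pos x v.
Proof.
have [h [k [szh szk E]]] := tree_directed2 oreF u v.
exists (graft u h) => y Ey; split; first exact: (pos_uniq2 szh).
by apply: (pos_uniq2 szk); rewrite -!(pos_eq _ E).
Qed.

Section LargeGroup.
Hypothesis eff : effective oreF.
Variable H : set GV.
Hypothesis sH : is_subgroup H.
Hypothesis TH : FSgroupT oreF `<=` H.

Let L : set GV := [set a | H a /\ exists t, fixes_ends a t].

Lemma K_sub_large : K `<=` H.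
Proof. by move=> a /K_sub_G/FSgroup_sub_T/TH. Qed.

Lemma derived_ends_sub N g : is_subgroup N -> conj_closed N (derived_subgroup H) ->
  N g -> g <> 1 -> derived_subgroup L `<=` N.
Proof.
move=> sN nN; apply: (derived_sub_normalised eff (fixes_ends_subgroup sH) _ _ sN).
- by move=> a Ka; split; [exact: K_sub_large | have [_] := (group_KP a).1 Ka].
- by move=> a [].
- move=> n h Nn Lh; apply: nN Nn _; apply: derived_mono Lh; by move=> a [].
Qed.

Section Normal.
Variable M : set GV.
Hypotheses (sM : is_subgroup M) (nM : conj_closed M H) (LM : derived_subgroup L `<=` M).

(** A rotation in [FSgroupT] takes both ends of the space into the common cone; conjugation by it
    brings [a] and [b] into [L]. *)
Lemma common_cone_comm a b v i : H a -> H b -> (i < leaves v)%N ->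
  (forall x, pos x v = i -> act a x = x) ->
  (forall x, pos x v = i -> act b x = x) -> M [~ a, b].
Proof.
move=> Ha Hb lti aP bP; have [w Ew] := tree_of_size F 1.
have szi := size_insert w lti; set t := graft v (insert (leaves v) i w).
have Et : leaves t = (leaves v).-1 + 2 by rewrite leaves_graft // rleaves_insert // Ew.
have tv x : (i <= pos x t < i + 2)%N -> pos x v = i.
  move=> Hx; apply: (pos_uniq szi); rewrite rleaves_takeS ?szi //.
  by rewrite rleaves_take_insert nth_insert Ew.
(* The rotation by [i.+1] sends the last leaf of [t] to [i] and the first to [i.+1], the two leaves
   of the cone. *)
have [r [Tr rP]] := @rotation _ oreF t i.+1 ltac:(lia).
have rends x : pos x t = 0 \/ pos x t = (leaves t).-1 -> pos (act r x) v = i.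
  move=> Ex; apply: tv; rewrite rP; case: Ex => ->.
    by rewrite modn_small; lia.
  have -> : (leaves t).-1 + i.+1 = i + leaves t by lia.
  by rewrite modnDr modn_small; lia.
have Lr (e : GV) : H e -> (forall x, pos x v = i -> act e x = x) -> L (e ^ r).
  move=> He eP; split; first exact: subgroup_conj sH He (TH Tr).
  by exists t => x /rends Ex; rewrite /conjg !act_mul eP // actK.
have [_ _ HV] := sH.
have := nM (LM (derived_comm (Lr _ Ha aP) (Lr _ Hb bP))) (HV _ (TH Tr)).
by rewrite conjRg -!conjgM mulgV !conjg1.
Qed.

(** The two fixed cones may be disjoint. Conjugating [b] by an element [d] of [K'], hence of [M],
    makes them overlap and changes [b] only by an element of [M]. *)
Lemma fixes_cone_comm a b : H a -> H b -> fixes_cone a -> fixes_cone b -> M [~ a, b].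
Proof.
move=> Ha Hb [s [i [lti aP]]] [t [j [ltj bP]]].
have [s1 [i1 [i1P s1P sP]]] := subcone 1 lti.
have [t1 [j1 [j1P t1P tP]]] := subcone 1 ltj.
have [d K'd dP] := @compress_derived _ oreF t1 s1 i1 i1P ltac:(lia).
have ltj1 : (j1 < leaves t1)%N by lia.
have [p [_ Ep]] := cone_point oreF ltj1.
(* [x0] lies in the cone fixed by [b], and [d] sends it into the one fixed by [a]; a small cone
   around [y0] is then fixed by [a] and by the conjugate of [b]. *)
set x0 := act p _ in Ep; pose y0 := act d x0.
have [v vP] := act_cont d^-1 t1.
have [r rP] := same_pos_meet s1 v y0.
have bx0 : band t1 x0 by apply: band_interior Ep; lia.
have Ey0 : pos y0 s1 = i1 by apply: dP.
have [sM1 MM MV] := sM; have [H1 HM HV] := sH.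
have LK : K `<=` L by move=> c Kc; split; [exact: K_sub_large | have [_] := (group_KP c).1 Kc].
have Md : M d by apply: LM; apply: derived_mono K'd.
have Hd : H d by apply: K_sub_large; apply: derived_le K'd; exact: K_subgroup.
pose b' := b ^ d^-1.
have Hb' : H b' by apply: subgroup_conj => //; apply: HV.
have Mab' : M [~ a, b'].
  apply: (@common_cone_comm _ _ r (pos y0 r)) => //; first exact: pos_lt.
    move=> y /rP[Ey _]; apply: aP; apply: (sP y 0) => //.
    by rewrite addn0 Ey.
  move=> y /rP[_ Ey]; rewrite /b' /conjg invgK !act_mul bP ?actVK //.
  apply: (tP _ 0) => //; rewrite addn0 -[RHS]Ep.
  by rewrite (vP _ _ Ey) /y0 actK.
have Eb : b = b' * [~ b', d] by rewrite commgEl mulgA mulgV mul1g /b' -conjgM mulVg conjg1.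
rewrite Eb commMr; apply: MM.
  have [Mc _] := commg_normalised sM nM Hb' Md.
  by have [] := commg_normalised sM nM Ha Mc.
apply: nM => //.
exact: subgroup_comm.
Qed.

Lemma derived_large_sub : derived_subgroup H `<=` M.
Proof.
apply: derived_sub => // a b Ha Hb; have [sM1 MM MV] := sM; have [H1 HM HV] := sH.
have split g : H g -> exists p q, [/\ H p, H q, fixes_cone p, fixes_cone q & g = p * q].
  move=> Hg; have [p [q [Kp fq Eg]]] := factor_fixes_cone g.
  have Hp := K_sub_large Kp; exists p, q; split => //; last exact: K_fixes_cone.
  have -> : q = p^-1 * g by rewrite Eg mulgA mulVg mul1g.
  by apply: HM => //; apply: HV.
have [p [q [Hp Hq fp fq ->]]] := split a Ha.
have [p' [q' [Hp' Hq' fp' fq' ->]]] := split b Hb.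
rewrite commMl !commMr; apply: (MM).
  apply: nM => //; apply: (MM); first exact: fixes_cone_comm.
  by apply: nM => //; exact: fixes_cone_comm.
apply: MM; first exact: fixes_cone_comm.
by apply: nM => //; exact: fixes_cone_comm.
Qed.

End Normal.

(* The normal core of N in H still contains [L, L]. *)
Lemma derived_large_min N g : is_subgroup N -> conj_closed N (derived_subgroup H) ->
  N g -> g <> 1 -> derived_subgroup H `<=` N.
Proof.
move=> sN nN Ng g1; have [H1 HM HV] := sH.
pose M : set GV := [set a | forall h, H h -> N (a ^ h)].
have sM : is_subgroup M.
  have [N1 NM NV] := sN; split=> [h _|a b Ma Mb h Hh|a Ma h Hh]; first by rewrite conj1g.
    by rewrite conjMg; apply: NM; [apply: Ma|apply: Mb].
  by rewrite conjVg; apply: NV; apply: Ma.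
have nM : conj_closed M H.
  by move=> a h Ma Hh h' Hh'; rewrite -conjgM; apply: Ma; apply: HM.
have nH' : conj_closed (derived_subgroup H) H.
  by apply: derived_normalised => a b Ha Hb; exact: subgroup_conj.
have LM : derived_subgroup L `<=` M.
  move=> a La h Hh.
  (* Each conjugate of [N] under [H] is again normalised by the derived subgroup of [H], because the
     latter is normal in [H]. *)
  apply: (derived_ends_sub (N := [set c | N (c ^ h)]) (g := g ^ h^-1)) La => /=.
  - exact: conj_subgroup.
  - by move=> n d Nn H'd; rewrite /= conjJg; apply: nN => //; apply: nH'.
  - by rewrite -conjgM mulVg conjg1.
  - by move/(congr1 (conjg^~ h)); rewrite -conjgM mulVg conjg1 conj1g.
move=> a /(derived_large_sub sM nM LM) /(_ 1 H1).
by rewrite conjg1.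
Qed.

End LargeGroup.
End BigGroups.

(** * The group G with abelian germs *)

Section Quotients.
Variable Gam : groupType.
Local Open Scope group_scope.
Implicit Types (G H D N : set Gam).

Lemma quotient_abelianP G H : is_subgroup G -> is_subgroup H -> H `<=` G ->
  conj_closed H G ->
  quotient_abelian G H <-> forall a b, G a -> G b -> H [~ a, b].
Proof.
move=> sG sH HG nH; have [G1 GM GI] := sG; have [H1 HM HI] := sH.
have comE (a b : Gam) : a * b = b * a * [~ a, b].
  by rewrite /commg /conjg !mulgA mulgK mulgV mul1g.
split=> [ab a b Ga Gb|ab].
  have Ca g : G g -> left_cosets G H (left_coset g H) by move=> Gg; exists g.
  have : [set x * y | x in left_coset a H & y in left_coset b H] (a * b).
    by exists a; [exists 1; rewrite ?mulg1|exists b => //; exists 1; rewrite ?mulg1].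
  rewrite (ab _ _ (Ca _ Ga) (Ca _ Gb)) => -[_ [h Hh <-] [_ [k Hk <-] E]].
  have -> : [~ a, b] = h ^ a * k.
    apply: (mulgI (b * a)); rewrite -comE -E /conjg !mulgA; congr (_ * _).
    by rewrite -!mulgA mulKVg !mulgA.
  by apply: HM => //; apply: nH.
have sub (A B : set Gam) : left_cosets G H A -> left_cosets G H B ->
    [set x * y | x in A & y in B] `<=` [set y * x | y in B & x in A].
  move=> [a Ga <-] [b Gb <-] _ [_ [h Hh <-] [_ [k Hk <-] <-]].
  exists b; first by exists 1; rewrite ?mulg1.
  exists (a * ([~ a, b] * (h ^ b * k))).
    exists ([~ a, b] * (h ^ b * k)) => //.
    exact: (HM _ _ (ab _ _ Ga Gb) (HM _ _ (nH _ _ Hh Gb) Hk)).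
  by rewrite /conjg !mulgA !mulgK mulgV mul1g.
move=> A B CA CB; apply/seteqP; split; first exact: sub.
by move=> x [y By [z Az <-]]; apply: (sub B A CB CA); exists y => //; exists z.
Qed.

Lemma simple_of_minimal D : is_subgroup D -> (exists2 g, D g & g <> 1) ->
  (forall N g, is_subgroup N -> conj_closed N D -> N g -> g <> 1 -> D `<=` N) ->
  simple_group D.
Proof.
move=> sD [g Dg g1] Dmin; split => //.
  by move=> E; apply: g1; rewrite E in Dg.
move=> N [sN ND nN]; have [N1|] := EM (N `<=` [set 1]).
  left; apply/seteqP; split => // _ ->.
  by case: sN.
move=> /existsNP[h /not_implyP[Nh h1]]; right; apply/seteqP; split => //.
exact: Dmin Nh h1.
Qed.

End Quotients.

Section Copies.
Variables (F : fs_category) (oreF : ore F).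
Local Notation T := (ctree (colour F)).
Local Notation GV := (FSgroupV oreF).
Local Notation C := (limit_space F).
Local Open Scope group_scope.
Implicit Types (t s u v w : T) (k f : seq T) (x y z : C) (i j : nat).
Implicit Types (a b c g h : GV).
Local Notation K := (group_K oreF).
Local Notation K' := (derived_subgroup K).
Local Notation G := (FSgroup oreF).

Lemma gam_fix u f k i x : size f = leaves u -> size k = leaves u ->
  rleaves f = rleaves k -> pos x u = i ->
  nth Leaf f i = Leaf -> nth Leaf k i = Leaf ->
  rleaves (take i f) = rleaves (take i k) ->
  act (gam oreF (graft u f) (graft u k)) x = x.
Proof.
move=> szf szk Efk Ei Ef Ek Eoff.
have E : leaves (graft u f) = leaves (graft u k) by rewrite !leaves_graft.
have lti : (i < leaves u)%N by rewrite -Ei pos_lt.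
have := gam_blocks oreF E szk szf Ei (c := 0) (i := i) (d := 0).
rewrite Ef Ek Eoff pos_Leaf !zoom_Leaf => /(_ erefl lti isT erefl) [Ey _ Ez].
by rewrite zoom_Leaf in Ez; exact: (zoom_inj oreF Ey Ei Ez).
Qed.

Lemma gam_insert u i t s (g := gam oreF t s)
    (g' := gam oreF (graft u (insert (leaves u) i t)) (graft u (insert (leaves u) i s))) :
  (i < leaves u)%N -> leaves t = leaves s ->
  (forall x, pos x u <> i -> act g' x = x) /\
  (forall x, pos x u = i ->
     pos (act g' x) u = i /\ zoom u i (act g' x) = act g (zoom u i x)).
Proof.
move=> lti E.
have szt := size_insert t lti; have szs := size_insert s lti.
have Ets : rleaves (insert (leaves u) i t) = rleaves (insert (leaves u) i s).
  by rewrite !rleaves_insert // E.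
have El : leaves (graft u (insert (leaves u) i t)) = leaves (graft u (insert (leaves u) i s)).
  by rewrite !leaves_graft.
split=> x Ex.
  have nthL w : nth Leaf (insert (leaves u) i w) (pos x u) = Leaf.
    rewrite /insert nth_cat size_nseq nth_nseq if_same; case: ltnP => // le.
    have -> : (pos x u - i = (pos x u - i.+1).+1)%N by lia.
    by rewrite /= nth_nseq if_same.
  apply: (gam_fix szt szs Ets erefl) => //.
  have [lt|le] := ltnP (pos x u) i.+1.
    by rewrite !takel_cat // size_nseq; lia.
  have Ep : pos x u = (i + (pos x u - i.+1).+1)%N by lia.
  rewrite Ep !takeD !take_insert !rleaves_cat !drop_size_cat ?size_nseq //=.
  by rewrite !rleaves_cons E.
have := gam_blocks oreF El szs szt Ex (i := i) (d := pos (zoom u i x) s).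
rewrite !nth_insert !rleaves_take_insert E => /(_ _ erefl lti (pos_lt _ _) erefl).
move=> [Ey Ep Ez]; split => //.
apply: (zoom_inj oreF (v := t) Ep); first exact: gam_pos.
by rewrite Ez gam_zoom.
Qed.

Section Effective.
Hypothesis eff : effective oreF.
Variable u : T.
Hypothesis u5 : leaves u = 5.

(** A relation read on the action, so that products and inverses of copies are copies whatever trees
    represent them. Five leaves are what [band_map] needs around the leaf 2. *)
Definition copy g g' := [/\ G g', (forall x, pos x u <> 2 -> act g' x = x) &
  forall x, pos x u = 2 ->
    pos (act g' x) u = 2 /\ zoom u 2 (act g' x) = act g (zoom u 2 x)].

Lemma copy_ex g : G g -> exists g', copy g g'.
Proof.
move=> /FSgroupP[t [s [E ->]]].
have lt2 : (2 < leaves u)%N by rewrite u5.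
have [P1 P2] := gam_insert lt2 E; eexists; split; [|exact: P1|exact: P2].
apply/FSgroupP; do 2 eexists; split; last by [].
by rewrite !leaves_graft ?size_insert // !rleaves_insert // E.
Qed.

Lemma copyM a a' b b' : copy a a' -> copy b b' -> copy (a * b) (a' * b').
Proof.
move=> [Ga a1 a2] [Gb b1 b2]; have [_ GM _] := FSgroup_subgroup oreF.
split=> [|x Ex|x Ex]; first exact: GM; first by rewrite act_mul b1 // a1.
have [Ey Zy] := b2 x Ex; have [Ez Zz] := a2 _ Ey.
by rewrite !act_mul Ez Zz Zy.
Qed.

Lemma copyV a a' : copy a a' -> copy a^-1 a'^-1.
Proof.
move=> [Ga a1 a2]; have [_ _ GI] := FSgroup_subgroup oreF.
split=> [|x Ex|x Ex]; first exact: GI; first by rewrite -{1}(a1 x Ex) actK.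
have [Ey|nE] := EM (pos (act a'^-1 x) u = 2); last first.
  by case: (nE); have := a1 _ nE; rewrite actVK => <-.
split => //; have [_] := a2 _ Ey.
by rewrite actVK => ->; rewrite actK.
Qed.

Lemma copyR a a' b b' : copy a a' -> copy b b' -> copy [~ a, b] [~ a', b'].
Proof.
by move=> ca cb; do !(apply: copyM); try exact: copyV.
Qed.

Lemma copy_K g g' : copy g g' -> K g'.
Proof.
move=> [Gg P _]; apply/group_KP; split => //; exists u => x Ex.
by apply: P; case: Ex => ->; rewrite ?u5.
Qed.

(** On a band supporting [g], the element [h] inverts the zoom into the leaf 2 of [u], so it
    intertwines [g] with its copy. *)
Lemma copy_conj g g' : K g -> copy g g' -> exists2 h, K h & g = g' ^ h.
Proof.
move=> Kg [_ P1 P2]; have [_ [r rg]] := (group_KP g).1 Kg.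
have sg := supported_ends rg.
have [s [e [le_e le_s Hs]]] := band_room r 2.
have [h Kh hP] := @band_map _ oreF s u 2 r e _ erefl
  le_e ltac:(lia) isT ltac:(by rewrite u5).
exists h => //.
suff E x : act g' (act h x) = act h (act g x).
  by apply: (act_ext eff) => x; rewrite /conjg !act_mul E actK.
have zoom_h x' : band r x' -> pos (act h x') u = 2 /\ zoom u 2 (act h x') = x'.
  move=> bx; have ltp := pos_lt x' r.
  have [Ex Zx] := Hs x' _ bx.
  have [D1 D2] := hP x' _ ltp.
  have [E1 E2] := D1.1 (Ex.1 erefl); split => //.
  apply: (zoom_inj oreF E2 erefl).
  by rewrite D2 ?(Zx erefl) //; exact: Ex.1.
have [bx|nbx] := EM (band r x).
  have [E1 Z1] := zoom_h _ bx.
  have [E2 Z2] := zoom_h _ (supported_stable sg bx).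
  have [E3 Z3] := P2 _ E1.
  by apply: (zoom_inj oreF E3 E2); rewrite Z3 Z2 Z1.
(* Outside the band [g] is trivial, and [g'] must be trivial at [act h x]: a point of the cone whose
   zoom lies in the band comes from the band. This uses the converse direction of the equivalence in
   [band_map]. *)
rewrite (sg x nbx); have [E1|] := EM (pos (act h x) u = 2); last exact: P1.
have [E3 Z3] := P2 _ E1; apply: (zoom_inj oreF E3 E1); rewrite Z3.
apply: sg => bz; apply: nbx.
have ltp := pos_lt (zoom u 2 (act h x)) r.
have [D1 _] := hP x _ ltp.
have [Ex _] := Hs x _ bz.
have Exr := Ex.2 (D1.2 (conj E1 erefl)).
by rewrite /band Exr.
Qed.

(* [a, b] is conjugate in K to its copy, the commutator of the copies of a and b, which
   lie in K. *)
Lemma comm_derived_K a b : G a -> G b -> K [~ a, b] -> K' [~ a, b].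
Proof.
move=> Ga Gb Kab; have [a' ca] := copy_ex Ga; have [b' cb] := copy_ex Gb.
have [h Kh ->] := copy_conj Kab (copyR ca cb).
have nK' : conj_closed K' K.
  by apply: derived_normalised => x y Kx Ky; exact: subgroup_conj (K_subgroup oreF) Kx Ky.
by apply: nK' => //; apply: derived_comm; apply: copy_K; eassumption.
Qed.

End Effective.
End Copies.

(** * The kernel of the action *)

Section Kernel.
Variables (F : fs_category) (oreF : ore F).
Local Notation T := (ctree (colour F)).
Local Notation GV := (FSgroupV oreF).
Local Notation C := (limit_space F).
Local Open Scope group_scope.
Implicit Types (t s u v w : T) (k f : seq T) (x y z : C) (i j : nat).
Implicit Types (a b c g h : GV).
Local Notation K := (group_K oreF).
Local Notation K' := (derived_subgroup K).
Local Notation G := (FSgroup oreF).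

Lemma gam_eq1 t s : leaves t = leaves s -> gam oreF t s = 1 ->
  exists2 f, size f = leaves t & tree_eq (graft t f) (graft s f).
Proof.
move=> E; rewrite -(gam1 oreF s) (gamE oreF E erefl) (gamE oreF erefl erefl).
move=> /fracP[m [p [q [Ep Eq]]]].
have {}Eq : p = q by exact: (vcompI oreF _ Eq).
subst q; have {Ep} := congr1 fst Ep; rewrite /= !permf1 => Ep.
have [f [[szf Ef] Efp]] := clsW p.1; exists f; first by rewrite szf E.
have Lt : leaves (graft t f) = m by rewrite leaves_graft ?szf.
have Ls : leaves (graft s f) = m by rewrite leaves_graft ?szf.
by move: Ep; rewrite Efp (comp_tr E _ Lt) (comp_tr erefl _ Ls) => /tr_eq.
Qed.

(** Left cancellation removes [u], and skein equality of forests holds tree by tree; equal shapes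
    make a refinement cut both forests into the same blocks. *)
Lemma gam_graft_eq1 u f k i : size f = leaves u -> tshape f = tshape k ->
  (i < leaves u)%N ->
  gam oreF (graft u f) (graft u k) = 1 -> gam oreF (nth Leaf f i) (nth Leaf k i) = 1.
Proof.
move=> szf Efk lti.
have szk : size k = leaves u by have := congr1 size Efk; rewrite !size_map szf => <-.
have El : rleaves f = rleaves k by rewrite /rleaves Efk.
have Ei : leaves (nth Leaf f i) = leaves (nth Leaf k i).
  by rewrite -(nth_map Leaf 0%N (@leaves _)) ?szf // -(nth_map Leaf 0%N (@leaves _)) ?szk //
    -/(tshape f) Efk.
move=> /gam_eq1[|p szp]; first by rewrite !leaves_graft.
rewrite leaves_graft // in szp.
rewrite !graftA -?El ?szp // => /(graft_cancel oreF).
rewrite !size_rcomp => /(_ szf szk) /(skein_cong_nth i).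
rewrite !nth_rcomp ?szf ?szk //.
have -> : rleaves (take i k) = rleaves (take i f).
  by rewrite /rleaves /tshape !map_take -/(tshape f) Efk.
rewrite -Ei; set q := take _ _ => E.
have szq : size q = leaves (nth Leaf f i).
  rewrite size_takel // size_drop szp (rleavesE (h := f) (i := i)) ?szf //; lia.
rewrite -(gam_graft oreF Ei szq) (gam_eq _ _ E (tree_eq_refl _)) ?gam1 //.
by rewrite !leaves_graft // -Ei.
Qed.

Lemma graft_fill u (f1 f2 : seq T) w : size (f1 ++ Leaf :: f2) = leaves u ->
  graft (graft u (f1 ++ Leaf :: f2))
        (nseq (rleaves f1) Leaf ++ w :: nseq (rleaves f2) Leaf)
  = graft u (f1 ++ w :: f2).
Proof.
move=> sz; rewrite graftA //; last first.
  by rewrite rleaves_cat rleaves_cons size_cat /= !size_nseq.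
rewrite rcomp_cat take_size_cat ?size_nseq // drop_size_cat ?size_nseq //=.
by rewrite drop0 !rcompf1.
Qed.

Lemma gam_fill u (f1 f2 k1 k2 : seq T) w :
  size (f1 ++ Leaf :: f2) = leaves u -> size (k1 ++ Leaf :: k2) = leaves u ->
  rleaves f1 = rleaves k1 -> rleaves f2 = rleaves k2 ->
  gam oreF (graft u (f1 ++ Leaf :: f2)) (graft u (k1 ++ Leaf :: k2))
    = gam oreF (graft u (f1 ++ w :: f2)) (graft u (k1 ++ w :: k2)).
Proof.
move=> szf szk E1 E2; have El : rleaves (f1 ++ Leaf :: f2) = rleaves (k1 ++ Leaf :: k2).
  by rewrite !rleaves_cat !rleaves_cons E1 E2.
rewrite -(graft_fill w szf) -(graft_fill w szk) -E1 -E2 gam_graft //.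
  by rewrite !leaves_graft.
by rewrite leaves_graft // rleaves_cat rleaves_cons size_cat /= !size_nseq.
Qed.

(* A copy n1 of a nontrivial element acting trivially has a different conjugate n2 under
   K, placed in a disjoint cone; hence [n1, K] is not trivial. *)
Lemma kernel_meets_derived_K : ~ effective oreF ->
  exists2 n, K' n & n <> 1 /\ forall x, act n x = x.
Proof.
move=> /existsNP[n0 /not_implyP[triv0 n0_1]].
have /FSgroupP[t [s [E En0]]] := kernel_sub_G triv0.
have [u Eu] := tree_of_size F 5; have [e] := colour_inhabited F.
pose Y := Node e Leaf Leaf.
(* The caret sits at the leaf 2 of [u] in [U] and at the leaf 3 in [V]. So the leaf 3 is the right
   leaf of the caret in [U] and the left one in [V]: the two cones are disjoint. *)
pose fU : seq T := [:: Leaf; Leaf; Y; Leaf; Leaf; Leaf].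
pose fV : seq T := [:: Leaf; Leaf; Leaf; Y; Leaf; Leaf].
pose U := graft u fU; pose V := graft u fV.
have LU : leaves U = 7 by rewrite leaves_graft.
have LV : leaves V = 7 by rewrite leaves_graft.
pose kk := gam oreF U V.
have Kk : K kk.
  apply/group_KP; split; first by apply/FSgroupP; exists U, V; rewrite LU LV.
  by exists u => x Ex; case: Ex => Ex; rewrite ?Eu /= in Ex;
    apply: (@gam_fix _ oreF u fU fV _ x _ _ _ Ex).
have lt3 : (3 < leaves V)%N by rewrite LV.
pose n1 := gam oreF (graft V (insert (leaves V) 3 t)) (graft V (insert (leaves V) 3 s)).
have n1_triv x : act n1 x = x.
  have [P1 P2] := gam_insert oreF lt3 E.
  have [Ex|] := EM (pos x V = 3); last exact: P1.
  have [Ey Zy] := P2 x Ex; apply: (zoom_inj oreF Ey Ex).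
  by rewrite Zy -En0 triv0.
have [G1 GM GI] := FSgroup_subgroup oreF.
have Kn1 : K n1.
  by apply/group_KP; split; [exact: kernel_sub_G | exists Leaf => x _; exact: n1_triv].
pose n2 := gam oreF (graft U (insert (leaves U) 3 t)) (graft U (insert (leaves U) 3 s)).
have szV w : size (insert 7 3 w) = leaves V by rewrite LV.
have szU w : size (insert 7 3 w) = leaves U by rewrite LU.
have En2 : n2 = n1 ^ kk^-1.
  rewrite /conjg invgK /n2 /n1 LU LV mulgA.
  have Ek w : kk = gam oreF (graft U (insert 7 3 w)) (graft V (insert 7 3 w)).
    by rewrite gam_graft ?szU // LU LV.
  have lUV w : leaves (graft U (insert 7 3 w)) = leaves (graft V (insert 7 3 w)).
    by rewrite !leaves_graft ?szV ?szU.
  have lts : leaves (graft V (insert 7 3 t)) = leaves (graft V (insert 7 3 s)).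
    by rewrite !leaves_graft ?szV ?szU // !rleaves_insert // E.
  rewrite {1}(Ek t) gam_mul // (Ek s) gam_inv // gam_mul //.
  by rewrite lUV lts.
exists [~ n1, kk^-1].
  by apply: derived_comm => //; have [_ _] := K_subgroup oreF; apply.
split; last first.
  have n1V_triv x : act n1^-1 x = x by rewrite -{1}(n1_triv x) actK.
  by move=> x; rewrite commgEl -En2 act_mul n1V_triv En2 /conjg invgK !act_mul
      n1_triv actVK.
rewrite commgEl -En2 => E12.
have {}E12 : n1 = n2 by apply: (mulgI n1^-1); rewrite E12 mulVg.
(* Both elements act trivially, so they are told apart on trees: over a common second tree,
   [n1 = n2] would force [gam oreF t s = 1]. *)
have En1' : n1 = gam oreF (graft u [:: Leaf; Leaf; Node e Leaf s; Node e t Leaf; Leaf; Leaf])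
                          (graft u [:: Leaf; Leaf; Node e Leaf s; Node e s Leaf; Leaf; Leaf]).
  rewrite -(@gam_fill u [:: Leaf; Leaf] [:: Node e t Leaf; Leaf; Leaf]
               [:: Leaf; Leaf] [:: Node e s Leaf; Leaf; Leaf]) //; last first.
    by rewrite !rleaves_cons /= E.
  by rewrite /n1 LV /V !graftA.
have En2' : n2 = gam oreF (graft u [:: Leaf; Leaf; Node e Leaf t; Node e s Leaf; Leaf; Leaf])
                          (graft u [:: Leaf; Leaf; Node e Leaf s; Node e s Leaf; Leaf; Leaf]).
  rewrite -(@gam_fill u [:: Leaf; Leaf; Node e Leaf t] [:: Leaf; Leaf]
               [:: Leaf; Leaf; Node e Leaf s] [:: Leaf; Leaf]) //; last first.
    by rewrite !rleaves_cons /= E.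
  by rewrite /n2 LU /U !graftA.
have lg (w1 w2 w3 w4 : T) : leaves w1 + leaves w2 = leaves w3 + leaves w4 ->
    leaves (graft u [:: Leaf; Leaf; Node e Leaf w1; Node e w2 Leaf; Leaf; Leaf])
    = leaves (graft u [:: Leaf; Leaf; Node e Leaf w3; Node e w4 Leaf; Leaf; Leaf]).
  by move=> H; rewrite !leaves_graft // !rleaves_cons /=; lia.
have : gam oreF (graft u [:: Leaf; Leaf; Node e Leaf s; Node e t Leaf; Leaf; Leaf])
                (graft u [:: Leaf; Leaf; Node e Leaf t; Node e s Leaf; Leaf; Leaf]) = 1.
  rewrite -(@gam_mul _ oreF _ (graft u [:: Leaf; Leaf; Node e Leaf s; Node e s Leaf; Leaf; Leaf])).
  - by rewrite -En1' E12 En2' gam_mul ?gam1 //; apply: lg; rewrite E.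
  - by apply: lg; rewrite E.
  - by apply: lg; rewrite E.
move=> P1; have P2 : gam oreF (Node e t Leaf) (Node e s Leaf) = 1.
  by apply: (gam_graft_eq1 (i := 3) _ _ _ P1); rewrite /tshape /= ?E ?Eu.
apply: n0_1; rewrite En0.
by apply: (@gam_graft_eq1 Y [:: t; Leaf] [:: s; Leaf] 0 _ _ _ P2); rewrite /tshape /= ?E.
Qed.

Lemma derived_not_simple (H : set GV) : K `<=` H -> ~ effective oreF ->
  ~ simple_group (derived_subgroup H).
Proof.
move=> KH neff [sD D1 Dsimple].
have [n K'n [n1 ntriv]] := kernel_meets_derived_K neff.
have [g K'g [x gx]] := derived_K_moves oreF.
pose N := [set a | derived_subgroup H a /\ forall x, act a x = x].
have [D_1 DM DV] := sD.
have [|E|E] := Dsimple N.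
- split=> [|a []//|a b [Da a1] Db].
    split=> [|a b [Da a1] [Db b1]|a [Da a1]].
    + by split => // y; exact: act1.
    + by split=> [|y]; [exact: DM | rewrite act_mul b1 a1].
    + by split=> [|y]; [exact: DV | rewrite -{1}(a1 y) actK].
  split=> [|y]; first exact: (subgroup_conj sD Da Db).
  by rewrite /conjg !act_mul a1 actK.
- have : N n by split => //; exact: derived_mono K'n.
  by rewrite E.
- have : N g by rewrite E; exact: derived_mono K'g.
  by case=> _ /(_ x).
Qed.

(** * Germs at a point fixed by [G] *)

Section Germs.
Variable p : C.
Hypothesis Gp : forall g, G g -> act g p = p.

Lemma germ_kernelP g : germ_kernel (oreF := oreF) p g <->
  G g /\ exists t, forall x, pos x t = pos p t -> act g x = x.
Proof. by split=> -[Gg] /(near_cone oreF). Qed.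

Lemma germ_subgroup : is_subgroup (germ_kernel (oreF := oreF) p).
Proof.
have [G1 GM GI] := FSgroup_subgroup oreF; split.
- by apply/germ_kernelP; split => //; exists Leaf => x _; exact: act1.
- move=> a b /germ_kernelP[Ga [t ta]] /germ_kernelP[Gb [s sb]]; apply/germ_kernelP.
  split; first exact: GM; have [r rP] := same_pos_meet oreF t s p.
  by exists r => x /rP[E1 E2]; rewrite act_mul sb // ta.
- move=> a /germ_kernelP[Ga [t ta]]; apply/germ_kernelP; split; first exact: GI.
  by exists t => x E; rewrite -{1}(ta x E) actK.
Qed.

(** As [g] fixes [p], continuity gives a cone around [p] that [g] sends into the one where [a] is
    trivial. *)
Lemma germ_conj_closed : conj_closed (germ_kernel (oreF := oreF) p) G.
Proof.
move=> a g /germ_kernelP[Ga [t ta]] Gg; apply/germ_kernelP; split.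
  exact: subgroup_conj (FSgroup_subgroup oreF) Ga Gg.
have [v vP] := act_cont g t; exists v => x Ex.
by rewrite /conjg !act_mul ta ?actK // (vP _ _ Ex) Gp.
Qed.

Lemma germ_abelianP : quotient_abelian G (germ_kernel (oreF := oreF) p) <->
  forall a b, G a -> G b -> germ_kernel (oreF := oreF) p [~ a, b].
Proof.
apply: quotient_abelianP; [exact: FSgroup_subgroup|exact: germ_subgroup|by move=> g []|].
exact: germ_conj_closed.
Qed.

End Germs.
End Kernel.

Theorem theorem1 (F : fs_category) (oreF : ore F) :
  let G := FSgroup oreF in
  let GT := FSgroupT oreF in
  let GV := [set: FSgroupV oreF] in
  let K := group_K oreF in
  let simpleK := simple_group (derived_subgroup K) in
  let simpleT := simple_group (derived_subgroup GT) in
  let simpleV := simple_group (derived_subgroup GV) in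
  let faithful := faithful_on_cosets G GT G in
  (faithful <-> simpleK \/ simpleT \/ simpleV) /\
  (faithful <-> simpleK /\ simpleT /\ simpleV) /\
  (faithful /\ quotient_abelian G (group_Ko oreF)
            /\ quotient_abelian G (group_Komega oreF)
    <-> simple_group (derived_subgroup G)).
Proof.
move=> G GT GV K simpleK simpleT simpleV faithful.
have KG : K `<=` G by exact: K_sub_G.
have KT : K `<=` GT by move=> a /KG; exact: FSgroup_sub_T.
have sK : is_subgroup K := K_subgroup oreF.
have sG : is_subgroup G := FSgroup_subgroup oreF.
have [k K'k [x kx]] := derived_K_moves oreF.
have k1 : k <> 1%g by move=> E; apply: kx; rewrite E act1.
have nontriv H : K `<=` H -> exists2 g, derived_subgroup H g & g <> 1%g.
  by move=> KH; exists k => //; exact: derived_mono K'k.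
have effP : faithful <-> effective oreF by exact: faithfulP.
have eff_of H : K `<=` H -> simple_group (derived_subgroup H) -> effective oreF.
  by move=> KH sH; apply: contrapT => neff; exact: (derived_not_simple KH neff sH).
have minK N g : effective oreF -> is_subgroup N ->
    conj_closed N (derived_subgroup K) -> N g -> g <> 1%g -> derived_subgroup K `<=` N.
  by move=> eff; apply: (derived_sub_normalised eff) => // a /group_KP[].
have all_simple : effective oreF -> simpleK /\ simpleT /\ simpleV.
  move=> eff; split; [|split]; apply: simple_of_minimal; try exact: derived_is_subgroup;
    try exact: nontriv.
  - by move=> N g; exact: minK.
  - by move=> N g; apply: (derived_large_min eff) => //; exact: FSgroupT_subgroup.
  - by move=> N g; apply: (derived_large_min eff).
split; [|split].
- rewrite effP; split=> [/all_simple[]|]; first by left.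
  by move=> [|[]]; apply: eff_of.
- rewrite effP; split=> // -[sK' _]; exact: eff_of sK'.
have fixmin g : G g -> act g (limit_min F) = limit_min F by exact: G_fixes_min.
have fixmax g : G g -> act g (limit_max F) = limit_max F by exact: G_fixes_max.
rewrite effP (germ_abelianP fixmin) (germ_abelianP fixmax).
split=> [[eff [abo abw]]|sG'].
  have G'K' : derived_subgroup G `<=` derived_subgroup K.
    have [u Eu] := tree_of_size F 4.
    apply: derived_sub; first exact: derived_is_subgroup.
    by move=> a b Ga Gb; apply: (comm_derived_K eff Eu) => //; split; [exact: abo|exact: abw].
  apply: simple_of_minimal; [exact: derived_is_subgroup|exact: nontriv|].
  move=> N g sN nN Ng g1; apply: subset_trans G'K' _; apply: minK Ng g1 => //.
  by move=> n h Nn /(derived_mono KG); exact: nN.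
split; first exact: eff_of sG'.
have [_ _ G'simple] := sG'.
have nK : conj_closed K G.
  move=> a g [ao aw] Gg; split; exact: germ_conj_closed.
(* The derived subgroup of [K] is normal in that of [G] and nontrivial, so simplicity makes them
   equal; commutators of [G] then lie in [K] and have trivial germs at both ends. *)
have [|E|E] := G'simple (derived_subgroup K).
- split; [exact: derived_is_subgroup|exact: derived_mono|].
  by move=> n h K'n /(derived_le sG); apply: derived_normalised.
- by move: K'k; rewrite E.
have commK a b : G a -> G b -> K [~ a, b]%g.
  by move=> Ga Gb; apply: derived_le => //; rewrite E; exact: derived_comm.
by split=> a b Ga Gb; have [] := commK a b Ga Gb.
Qed.
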